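(* Let $m,n$ be positive integers and let $P$ be the uniform probability measure (Lebesgue measure) on $[0,1]^{mn}$, identified with the set $M_{m\times n}([0,1])$ of $m\times n$ matrices with entries in $[0,1]$. Then for every $T>0$, as $\delta\to 0$ (with $\delta>0$), $$P\left(\left\{X\in M_{m\times n}([0,1]):\delta^{\frac{m}{m+n}}Q^{m,n}(X,\delta)\leq T\right\}\right)\longrightarrow \mu_{m+n}\left(\left\{ \Lambda\in X_{m+n}: F_1^{m,n}(\Lambda)\leq T\right\}\right).$$
   Context: $\|\cdot\|_k$ denotes the max norm on $\mathbb{R}^k$. For an $m\times n$ matrix $X$ with entries in $[0,1]$ and $\delta>0$, $$Q^{m,n}(X,\delta)=\min\left\{\|\mathbf{q}\|_n: (\mathbf{q},\mathbf{p})\in\mathbb{Z}^n\times\mathbb{Z}^m,\ \|X\mathbf{q}-\mathbf{p}\|_m<\delta\|\mathbf{q}\|_n\right\}.$$ $X_{m+n}=SL(m+n,\mathbb{R})/SL(m+n,\mathbb{Z})$ is the space of unimodular (covolume one) lattices in $\mathbb{R}^{m+n}$, where the coset $g\,SL(m+n,\mathbb{Z})$ is identified with the lattice $g\mathbb{Z}^{m+n}$. $\mu_{m+n}$ is the $SL(m+n,\mathbb{R})$-invariant probability measure on $X_{m+n}$ arising from Haar measure. Vectors of $\mathbb{R}^{m+n}=\mathbb{R}^n\oplus\mathbb{R}^m$ are written $\begin{bmatrix}\mathbf{u}\\ \mathbf{v}\end{bmatrix}$ with $\mathbf{u}\in\mathbb{R}^n$, $\mathbf{v}\in\mathbb{R}^m$.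 The function $F^{m,n}_1:X_{m+n}\to\mathbb{R}$ is $$F_1^{m,n}(\Lambda)=\min\left\{\|\mathbf{u}\|_n: \begin{bmatrix}\mathbf{u}\\ \mathbf{v}\end{bmatrix}\in \Lambda\cap C^{m,n}_1\right\},\qquad C^{m,n}_1=\left\{r\begin{bmatrix}\mathbf{s}\\ \mathbf{t}\end{bmatrix}: r>0,\ \mathbf{s}\in\mathbb{R}^n,\ \mathbf{t}\in\mathbb{R}^m,\ \|\mathbf{s}\|_n=1,\ \|\mathbf{t}\|_m<1\right\}.$$ *)

(* Defs.v *)
From HB Require Import structures.
From mathcomp Require Import all_boot all_order all_algebra generic_quotient.
From mathcomp Require Import all_classical all_reals all_analysis.
Import Order.TTheory GRing.Theory Num.Theory.
Import numFieldNormedType.Exports.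

Set Implicit Arguments.
Unset Strict Implicit.
Unset Printing Implicit Defensive.

Local Open Scope classical_set_scope.
Local Open Scope ring_scope.
Local Open Scope quotient_scope.

(* The least element of S; the default value 0 is taken only if there is none.
   The sets to which it is applied below do have one when m, n and delta are
   positive: for Q the elements are natural numbers and the set is nonempty by
   Dirichlet's theorem; for F1 the lattice meets C1, by Minkowski's theorem, and
   has finitely many points in each bounded part of C1. *)
Definition set_min (R : realType) (S : set R) : R :=
  xget 0 [set a | S a /\ lbound S a].

(* The library norm on 'cV[R]_k is the max norm. *)

Section Q.
Context {R : realType} {m n : nat}.

Definition Q_vectors (X : 'M[R]_(m, n)) (delta : R) : set 'cV[int]_n :=
  [set q | exists p : 'cV[int]_m,
     `|X *m map_mx intr q - map_mx intr p : 'cV[R]_m|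
       < delta * `|map_mx intr q : 'cV[R]_n|].

Definition Q (X : 'M[R]_(m, n)) (delta : R) : R :=
  set_min [set `|map_mx intr q : 'cV[R]_n| | q in Q_vectors X delta].

End Q.

Section uniform.
Context {R : realType}.

Definition cons_pair k (xt : measurableTypeR R * k.-tuple (measurableTypeR R)) :
    k.+1.-tuple (measurableTypeR R) :=
  [tuple of xt.1 :: xt.2].

Lemma measurable_cons_pair k : measurable_fun setT (@cons_pair k).
Proof. exact: measurable_cons. Qed.

HB.instance Definition _ k :=
  isMeasurableFun.Build _ _ _ _ (@cons_pair k) (@measurable_cons_pair k).

(* The k-fold product of the uniform probability on [0, 1]. *)
Fixpoint uniform_cube k : probability (k.-tuple (measurableTypeR R)) R :=
  match k with
  | 0 => \d_([tuple] : 0.-tuple (measurableTypeR R))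
  | k'.+1 => distribution (uniform_prob (@ltr01 R) \x uniform_cube k')%E
               (@cons_pair k')
  end.

Lemma uniform_cube_box k (A : 'I_k -> set (measurableTypeR R)) :
  (forall i, measurable (A i)) ->
  uniform_cube k [set t | forall i, A i (tnth t i)] =
    (\prod_(i < k) uniform_prob (@ltr01 R) (A i))%E.
Proof.
elim: k A => [|k IH] A mA.
  rewrite big_ord0 /= /dirac indicE mem_set// => i; by case: i.
rewrite big_ord_recl -IH; last by move=> i; exact: mA.
rewrite /= /distribution /pushforward -product_measure1E//; last first.
  rewrite [X in measurable X](_ : _ = \bigcap_(i : 'I_k) ((fun t => tnth t i) @^-1` A (lift ord0 i))).
    apply: fin_bigcap_measurable => // i _.
    rewrite -[X in measurable X]setTI; exact: measurable_tnth.
  apply/seteqP; split=> t /=; first by move=> h i _; exact: h.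
  by move=> h i; exact: h.
congr product_measure1; apply/seteqP; split => -[x t] /=.
  move=> h; split; first exact: (h ord0).
  by move=> i; have := h (lift ord0 i); rewrite tnthS.
case=> h0 h i; case: (unliftP ord0 i) => [j ->|->]; last exact: h0.
by rewrite tnthS; exact: h.
Qed.

Definition tuple_mx m n (t : (m * n).-tuple R) : 'M[R]_(m, n) :=
  vec_mx (\row_k tnth t k).

Definition uniform_mx m n (A : set 'M[R]_(m, n)) : \bar R :=
  uniform_cube (m * n) (@tuple_mx m n @^-1` A).

End uniform.

Section special_linear.
Context {R : realType} {d : nat}.

Definition SL : Type := set_type [set g : 'M[R]_d | \det g = 1].

HB.instance Definition _ := Choice.on SL.
HB.instance Definition _ := Topological.on SL.

Definition SLval (g : SL) : 'M[R]_d := set_val g.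
Coercion SLval : SL >-> matrix.

Lemma SLval_inj : injective SLval.
Proof. exact: val_inj. Qed.

Lemma det_SL (g : SL) : \det g = 1.
Proof. by have := set_valP g. Qed.

Definition mkSL (g : 'M[R]_d) (hg : \det g = 1) : SL := SigSub (mem_set hg).

Definition SL1 : SL := mkSL (det1 R d).

HB.instance Definition _ := isPointed.Build SL SL1.

Lemma det_mulSL (g h : SL) : \det (g *m h) = 1.
Proof. by rewrite det_mulmx !det_SL mulr1. Qed.

Definition mulSL (g h : SL) : SL := mkSL (det_mulSL g h).

Lemma SLval_mul (g h : SL) : mulSL g h = g *m h :> 'M[R]_d.
Proof. by []. Qed.

(* h belongs to the left coset g SL(d, Z). *)
Definition coset_rel (g h : SL) : bool :=
  `[< exists2 c : 'M[int]_d, \det c = 1 &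
      (h : 'M[R]_d) = g *m map_mx intr c >].

Lemma coset_rel_refl : reflexive coset_rel.
Proof.
by move=> g; apply/asboolP; exists 1%:M; rewrite ?det1// map_mx1 mulmx1.
Qed.

Lemma coset_rel_symm (g h : SL) : coset_rel g h -> coset_rel h g.
Proof.
move=> /asboolP[c c1 hE]; apply/asboolP; exists (\adj c).
  have := congr1 determinant (mul_mx_adj c).
  by rewrite det_mulmx c1 mul1r det1.
by rewrite hE -mulmxA -map_mxM/= mul_mx_adj c1 map_mx1 mulmx1.
Qed.

Lemma coset_rel_sym : symmetric coset_rel.
Proof. by move=> g h; apply/idP/idP; exact: coset_rel_symm. Qed.

Lemma coset_rel_trans : transitive coset_rel.
Proof.
move=> h g k /asboolP[b b1 hE] /asboolP[c c1 kE]; apply/asboolP.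
exists (b *m c); first by rewrite det_mulmx b1 c1 mulr1.
by rewrite kE hE map_mxM mulmxA.
Qed.

Canonical coset_equiv :=
  EquivRel coset_rel coset_rel_refl coset_rel_sym coset_rel_trans.

(* SL(d, R) / SL(d, Z) with the quotient topology. *)
Definition lattices : Type := quotient_topology {eq_quot coset_equiv}.

Definition act_lattices (g : SL) (x : lattices) : lattices :=
  \pi_lattices (mulSL g (repr x)).

Lemma act_lattices_pi (g h : SL) :
  act_lattices g (\pi_lattices h) = \pi_lattices (mulSL g h).
Proof.
apply/eqmodP/asboolP.
have /eqmodP/asboolP[c c1 hE] : \pi_lattices (repr (\pi_lattices h)) = \pi_lattices h.
  exact: reprK.
by exists c => //; rewrite !SLval_mul hE mulmxA.
Qed.

Definition integer_span (g : 'M[R]_d) : set 'cV[R]_d :=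
  [set g *m map_mx intr z | z in [set: 'cV[int]_d]].

(* The coset g SL(d, Z) identified with the lattice g Z^d. *)
Definition lattice_points (x : lattices) : set 'cV[R]_d := integer_span (repr x : SL).

Lemma lattice_points_pi (g : SL) :
  lattice_points (\pi_lattices g) = integer_span g.
Proof.
have /eqmodP/asboolP[c c1 gE] : \pi_lattices (repr (\pi_lattices g)) = \pi_lattices g.
  exact: reprK.
apply/seteqP; split=> _ [z _ <-].
  exists (\adj c *m z) => //.
  by rewrite [in LHS]gE -mulmxA -map_mxM/= mulmxA mul_mx_adj c1 mul1mx.
by exists (c *m z) => //; rewrite [in RHS]gE -mulmxA -map_mxM.
Qed.

Definition borel_lattices := g_sigma_algebraType (@open lattices).

(* There is exactly one SL_invariant probability measure on borel_lattices,
   namely the one induced by the Haar measure of SL(d, R). *)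
Definition SL_invariant (mu : set borel_lattices -> \bar R) : Prop :=
  forall (g : SL) (A : set borel_lattices), measurable A ->
    mu (act_lattices g @` A) = mu A.

End special_linear.
Arguments SL : clear implicits.
Arguments lattices : clear implicits.
Arguments borel_lattices : clear implicits.

Section F1.
Context {R : realType} {m n : nat}.

Definition C1 : set 'cV[R]_(n + m) :=
  [set w | exists (r : R) (s : 'cV[R]_n) (t : 'cV[R]_m),
     [/\ 0 < r, `|s| = 1, `|t| < 1 & w = r *: col_mx s t]].

Definition F1 (x : lattices R (n + m)) : R :=
  set_min [set `|usubmx w| | w in lattice_points x `&` C1].

End F1.

(* Main.v *)
(* Put al = delta^(m/(m+n)). Then al * Q X delta <= T says that the lattice
   horo X Z^(n+m), with horo X = [al, 0; (al/delta) X, al/delta] of determinant 1,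
   has a point in the truncated cone |v| < |u| <= T, and F1 L <= T says the same
   of L. So the theorem is the equidistribution of the expanding horospheres
   { horo X Z^(n+m) : X in [0,1]^(m x n) }, tested on a set with small boundary.

   Averages of f along one root group, chosen of almost minimal L2 norm, are
   almost invariant under that group (parallelogram law), hence under all of SL
   (Mautner). Passing from f to such an average hardly changes the horospherical
   mean F of f, because the flow contracts that root group; so F is almost
   invariant in L2, hence almost constant in mean. F is also equicontinuous,
   uniformly in delta: for g near 1, right multiplication of horo X by g is the
   change of variables X -> mobius g X up to a factor that the flow does not
   expand. Hence F is close to the mean of f at every point of a compact part,
   in particular at the base point. Integrals over the cube are replaced by
   means over grids, for which changes of variables amount to counting cells. *)

Require Import Defs.
From HB Require Import structures.
From mathcomp Require Import all_boot all_order all_algebra.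
From mathcomp Require Import all_classical all_reals all_analysis.
From mathcomp Require Import measurable_realfun ring lra zify.
Import Order.TTheory GRing.Theory Num.Theory.
Import numFieldNormedType.Exports.

Set Implicit Arguments.
Unset Strict Implicit.
Unset Printing Implicit Defensive.

Local Open Scope classical_set_scope.
Local Open Scope ring_scope.

(** The horospherical mean of [f] is kept as a function of the starting lattice, although only [x0]
    matters in the end: on the whole space it can be integrated against [mu], so almost invariance
    can be measured in L2, and a Chebyshev argument with equicontinuity then returns to the single
    point [x0]. The order of choices is essential: the radius of equicontinuity and the average of
    [f] depend on [f] and the error alone; then delta is taken small; only then the grid, whose mesh
    must be far below delta. The root group used for averaging is a direction of the horosphere
    itself: moving along it by [s] shifts [X] by delta times [s]. Nothing is integrated over the
    group and no Jacobian occurs; tightness of [mu] comes from a finite part of a countable cover by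
    tubes. The last obstacle is that the truncated cone is neither open nor closed; lattices with a
    point near its boundary are shown to be rare by shearing thin slabs, with no mean value formula
    for lattice sums. *)

(** * Max norm of matrices, and inverses near the identity *)

Section matrix_norm.
Context {R : realType}.

Lemma mx_entry_norm p q (A : 'M[R]_(p, q)) i j : `|A i j| <= `|A|.
Proof.
rewrite [leRHS]/Num.norm /= mx_normrE; apply/bigmax_geP; right => /=.
by exists (i, j).
Qed.

Lemma mx_norm_le p q (A : 'M[R]_(p, q)) c :
  0 <= c -> (forall i j, `|A i j| <= c) -> `|A| <= c.
Proof.
move=> c0 Ac; rewrite [leLHS]/Num.norm /= mx_normrE; by apply/bigmax_leP; split=> // ij _; exact: Ac.
Qed.

Lemma mx_norm_lt p q (A : 'M[R]_(p, q)) c :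
  0 < c -> (forall i j, `|A i j| < c) -> `|A| < c.
Proof.
move=> c0 Ac; rewrite [ltLHS]/Num.norm /= mx_normrE; by apply/bigmax_ltP; split=> // ij _; exact: Ac.
Qed.

Lemma mx_norm_attained p q (A : 'M[R]_(p, q)) :
  0 < `|A| -> exists i j, `|A| = `|A i j|.
Proof.
move=> A0; have : mx_norm A != 0 by apply: lt0r_neq0.
by move=> /mx_norm_neq0[[i j] ij]; exists i, j.
Qed.

Lemma mx_norm_mul p q r (A : 'M[R]_(p, q)) (B : 'M[R]_(q, r)) :
  `|A *m B| <= q%:R * `|A| * `|B|.
Proof.
apply: mx_norm_le => [|i j]; first by rewrite !mulr_ge0.
rewrite mxE (le_trans (ler_norm_sum _ _ _))//.
rewrite (@le_trans _ _ (\sum_(k < q) (`|A| * `|B|)))//.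
  by apply: ler_sum => k _; rewrite normrM ler_pM// mx_entry_norm.
by rewrite sumr_const card_ord -[leLHS]mulr_natl mulrA.
Qed.

Lemma mx_norm1 p : `|1%:M : 'M[R]_p| <= 1.
Proof.
apply: mx_norm_le => // i j; rewrite mxE.
by case: (i == j); rewrite ?normr1// normr0.
Qed.

(* For the unit: a kernel vector v of A satisfies |v| = |v (A - 1)| <= |v| / 2. *)
Lemma near1_inverse p (A : 'M[R]_p) (e : R) :
  `|A - 1%:M| <= e -> p%:R * e <= 2^-1 ->
  [/\ A \in unitmx, `|invmx A| <= 2 & `|invmx A - 1%:M| <= 2 * p%:R * e].
Proof.
move=> Ae pe.
have pA : p%:R * `|A - 1%:M| <= 2^-1.
  by apply: le_trans pe; rewrite ler_wpM2l.
have uA : A \in unitmx.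
  rewrite unitmxE unitfE; apply/negP => /det0P[v v0 vA].
  have vE : v = - (v *m (A - 1%:M)).
    by rewrite mulmxBr mulmx1 vA sub0r opprK.
  have := mx_norm_mul v (A - 1%:M); rewrite -normrN -vE.
  have v_gt0 : 0 < `|v| by rewrite normr_gt0.
  have := ler_wpM2l (ltW v_gt0) pA; lra.
have JE : invmx A = 1%:M - invmx A *m (A - 1%:M).
  by rewrite mulmxBr mulmx1 mulVmx// opprB addrC subrK.
have J2 : `|invmx A| <= 2.
  have /le_trans/(_ (lerD (mx_norm1 p) (mx_norm_mul _ _))) :=
    ler_normB 1%:M (invmx A *m (A - 1%:M)).
  rewrite -JE.
  have := ler_wpM2l (normr_ge0 (invmx A)) pA; lra.
split=> //.
have -> : invmx A - 1%:M = - (invmx A *m (A - 1%:M)).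
  by rewrite [in LHS]JE addrAC subrr sub0r.
rewrite normrN (le_trans (mx_norm_mul _ _))//.
have := ler_wpM2l (mulr_ge0 (ler0n R p) (normr_ge0 (invmx A))) Ae.
have e0 : 0 <= e by exact: le_trans Ae.
have := ler_wpM2l (mulr_ge0 (ler0n R p) e0) J2; lra.
Qed.

End matrix_norm.

(** * Group laws of SL(d, R), the transitive action on lattices, neighbourhoods of 1 *)

Section group.
Context {R : realType} {d : nat}.
Implicit Types g h k : SL R d.
Notation X := (lattices R d).

Lemma unitSL g : (g : 'M[R]_d) \in unitmx.
Proof. by rewrite unitmxE det_SL unitr1. Qed.

Lemma det_invSL g : \det (invmx (g : 'M[R]_d)) = 1.
Proof. by rewrite det_inv det_SL invr1. Qed.

Definition invSL g : SL R d := mkSL (det_invSL g).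

Lemma mulSLA g h k : mulSL g (mulSL h k) = mulSL (mulSL g h) k.
Proof. by apply: SLval_inj; rewrite !SLval_mul mulmxA. Qed.

Lemma mul1SL g : mulSL (SL1 : SL R d) g = g.
Proof. by apply: SLval_inj; rewrite SLval_mul mul1mx. Qed.

Lemma mulSL1 g : mulSL g (SL1 : SL R d) = g.
Proof. by apply: SLval_inj; rewrite SLval_mul mulmx1. Qed.

Lemma mulVSL g : mulSL (invSL g) g = SL1.
Proof. by apply: SLval_inj; rewrite SLval_mul mulVmx// unitSL. Qed.

Lemma mulSLV g : mulSL g (invSL g) = SL1.
Proof. by apply: SLval_inj; rewrite SLval_mul mulmxV// unitSL. Qed.

Lemma invSLM g h : invSL (mulSL g h) = mulSL (invSL h) (invSL g).
Proof.
rewrite -[RHS]mul1SL -(mulVSL (mulSL g h)) -mulSLA; set u := mulSL (mulSL g h) _.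
suff -> : u = SL1 by rewrite mulSL1.
by rewrite /u -mulSLA (mulSLA h) mulSLV mul1SL mulSLV.
Qed.

Definition x0 : X := \pi_(lattices R d)%qT (SL1 : SL R d).

Lemma latticeP (x : X) : exists g, x = \pi_(lattices R d)%qT g.
Proof. by exists (repr x); rewrite reprK. Qed.

Lemma actM g h (x : X) : act_lattices (mulSL g h) x = act_lattices g (act_lattices h x).
Proof. by have [k ->] := latticeP x; rewrite !act_lattices_pi mulSLA. Qed.

Lemma act1 (x : X) : act_lattices SL1 x = x.
Proof. by have [k ->] := latticeP x; rewrite act_lattices_pi mul1SL. Qed.

Lemma actK g (x : X) : act_lattices (invSL g) (act_lattices g x) = x.
Proof. by rewrite -actM mulVSL act1. Qed.

Lemma actVK g (x : X) : act_lattices g (act_lattices (invSL g) x) = x.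
Proof. by rewrite -actM mulSLV act1. Qed.

Lemma act_x0 g : act_lattices g x0 = \pi_(lattices R d)%qT g.
Proof. by rewrite act_lattices_pi mulSL1. Qed.

Lemma act_transitive (x : X) : exists g, x = act_lattices g x0.
Proof. by have [g ->] := latticeP x; exists g; rewrite act_x0. Qed.

Definition nearSL (r : R) g := `|(g : 'M[R]_d) - 1%:M| < r.

Lemma nearSL_inv (r : R) : 0 < r ->
  exists2 s, 0 < s & forall g, nearSL s g -> nearSL r (invSL g).
Proof.
move=> r0; pose s := Num.min (2^-1) (r / 4) / d.+1%:R.
have s0 : 0 < s by rewrite divr_gt0// lt_min invr_gt0 divr_gt0//= ltr0n.
exists s => // g gs.
have ds : d%:R * s <= Num.min 2^-1 (r / 4).
  have m0 : 0 <= Num.min 2^-1 (r / 4) by rewrite le_min invr_ge0 divr_ge0// ltW.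
  rewrite /s mulrC -mulrA ler_piMr// mulrC ler_pdivrMr// mul1r.
  by rewrite ler_nat.
have ds2 : d%:R * s <= 2^-1 by rewrite (le_trans ds)// ge_min lexx.
have dr : d%:R * s <= r / 4 by rewrite (le_trans ds)// ge_min lexx orbT.
have [_ _ h] := near1_inverse (ltW gs) ds2.
rewrite /nearSL /= (le_lt_trans h)//; lra.
Qed.

Lemma nearSL_conj g (r : R) : 0 < r ->
  exists2 s, 0 < s & forall h, nearSL s h -> nearSL r (mulSL (mulSL g h) (invSL g)).
Proof.
move=> r0; pose C := d%:R * (d%:R * `|(g : 'M[R]_d)|) * `|invmx (g : 'M[R]_d)| + 1.
have C0 : 0 < C by rewrite ltr_wpDl// !mulr_ge0.
exists (r / C); first by rewrite divr_gt0.
move=> h hs; rewrite /nearSL.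
have -> : (mulSL (mulSL g h) (invSL g) : 'M[R]_d) - 1%:M =
    (g : 'M[R]_d) *m ((h : 'M[R]_d) - 1%:M) *m invmx (g : 'M[R]_d).
  by rewrite mulmxBr mulmxBl mulmx1 mulmxV ?unitSL.
move: hs; rewrite /nearSL ltr_pdivlMr// => hs.
apply: le_lt_trans hs; rewrite (le_trans (mx_norm_mul _ _))//.
rewrite /C mulrDr mulr1 ler_wpDr// mulrC.
have /(ler_wpM2l (normr_ge0 (invmx (g : 'M[R]_d)))) := mx_norm_mul (g : 'M[R]_d) ((h : 'M[R]_d) - 1%:M).
move/(ler_wpM2l (ler0n R d)); lra.
Qed.

End group.

(** * Open sets of SL(d, R) and of the space of lattices *)

Section topology.
Context {R : realType} {d : nat}.
Implicit Types g h k : SL R d.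
Notation X := (lattices R d).

(** The topology of [SL] is induced from the matrices, so [P] is exhibited as the trace of a union
    [U] of matrix balls. *)
Lemma SL_open (P : set (SL R d)) :
  (forall g, P g -> exists2 s, 0 < s &
    forall h, `|(h : 'M[R]_d) - (g : 'M[R]_d)| < s -> P h) ->
  open P.
Proof.
move=> Ploc.
pose U := \bigcup_(gs in [set gs : SL R d * R | P gs.1 /\
  forall h, `|(h : 'M[R]_d) - (gs.1 : 'M[R]_d)| < gs.2 -> P h])
  ball (gs.1 : 'M[R]_d) gs.2.
have oU : open U by apply: bigcup_open => gs _; exact: ball_open.
have -> : P = @SLval R d @^-1` U.
  apply/seteqP; split=> [g Pg|h [[g s] /= [Pg]]].
    have [s s0 sP] := Ploc g Pg.
    by exists (g, s) => //=; exact: ballxx.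
  by move=> gP; rewrite mx_norm_ball /ball_ /= distrC; exact: gP.
exact: (open_comp (fun x _ => @initial_continuous _ _ set_val x) oU).
Qed.

Lemma SL_open_ball (P : set (SL R d)) g : open P -> P g ->
  exists2 s, 0 < s & forall h, `|(h : 'M[R]_d) - (g : 'M[R]_d)| < s -> P h.
Proof.
move=> [V oV <-]; move: oV; rewrite openE => oV /oV /nbhs_ballP[s /= s0 sV].
exists s => // h hg; apply: sV.
by rewrite mx_norm_ball /ball_ /= distrC.
Qed.

Lemma SL_translate_near (a b g : SL R d) (e : R) : 0 < e ->
  exists2 s, 0 < s & forall h, `|(h : 'M[R]_d) - (g : 'M[R]_d)| < s ->
    `|(mulSL (mulSL a h) b : 'M[R]_d) - (mulSL (mulSL a g) b : 'M[R]_d)| < e.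
Proof.
move=> e0; pose C := d%:R * (d%:R * `|(a : 'M[R]_d)|) * `|(b : 'M[R]_d)| + 1.
have C0 : 0 < C by rewrite ltr_wpDl// !mulr_ge0.
exists (e / C); first by rewrite divr_gt0.
move=> h; rewrite ltr_pdivlMr// => hs.
rewrite !SLval_mul -mulmxBl -mulmxBr.
apply: le_lt_trans hs; rewrite (le_trans (mx_norm_mul _ _))//.
rewrite /C mulrDr mulr1 ler_wpDr// mulrC.
have := mx_norm_mul (a : 'M[R]_d) ((h : 'M[R]_d) - (g : 'M[R]_d)).
move/(ler_wpM2l (normr_ge0 (b : 'M[R]_d)))/(ler_wpM2l (ler0n R d)); lra.
Qed.

Lemma SL_divr_near g (r : R) : 0 < r ->
  exists2 s, 0 < s & forall h, `|(h : 'M[R]_d) - (g : 'M[R]_d)| < s ->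
    nearSL r (mulSL h (invSL g)).
Proof.
move=> r0; have [s s0 sP] := SL_translate_near SL1 (invSL g) g r0.
by exists s => // h /sP; rewrite !mul1SL mulSLV.
Qed.

Lemma SL_divl_near g (r : R) : 0 < r ->
  exists2 s, 0 < s & forall h, `|(h : 'M[R]_d) - (g : 'M[R]_d)| < s ->
    nearSL r (mulSL (invSL g) h).
Proof.
move=> r0; have [s s0 sP] := SL_translate_near (invSL g) SL1 g r0.
by exists s => // h /sP; rewrite !mulSL1 mulVSL.
Qed.

Lemma lattices_open (U : set X) :
  (forall g, U (act_lattices g x0) -> exists2 s, 0 < s &
    forall h, `|(h : 'M[R]_d) - (g : 'M[R]_d)| < s -> U (act_lattices h x0)) ->
  open U.
Proof.
move=> Uloc; apply: SL_open => g Ug.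
have [|s s0 sU] := Uloc g; first by rewrite act_x0.
by exists s => // h /sU; rewrite act_x0.
Qed.

(** The perturbation [g] stands to the right of [h], so tubes of equal radius are translates of one
    another and have equal measure. *)
Definition tube h (r : R) : set X :=
  [set act_lattices (mulSL h g) x0 | g in [set g | nearSL r g]].

Lemma act_x0_eq g h : act_lattices g x0 = act_lattices h x0 ->
  exists c : SL R d, h = mulSL g c /\ act_lattices c x0 = x0.
Proof.
move=> gh; exists (mulSL (invSL g) h); split.
  by rewrite mulSLA mulSLV mul1SL.
by rewrite actM -gh actK.
Qed.

Lemma open_tube h (r : R) : open (tube h r).
Proof.
apply: lattices_open => k [g gr /act_x0_eq[c [kE cx0]]].
have rg : 0 < r - `|(g : 'M[R]_d) - 1%:M| by rewrite subr_gt0.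
have [s s0 sP] := SL_translate_near (invSL h) (invSL c) k rg.
exists s => // k' /sP k'P; exists (mulSL (mulSL (invSL h) k') (invSL c)).
  rewrite /= /nearSL.
  have gE : mulSL (mulSL (invSL h) k) (invSL c) = g.
    by rewrite kE !mulSLA mulVSL mul1SL -mulSLA mulSLV mulSL1.
  rewrite gE in k'P.
  rewrite -(subrK (g : 'M[R]_d) (mulSL (mulSL (invSL h) k') (invSL c) : 'M[R]_d)).
  by rewrite -addrA (le_lt_trans (ler_normD _ _))// -ltrBrDr.
rewrite !mulSLA mulSLV mul1SL actM.
by rewrite -[in LHS]cx0 actK.
Qed.

(** A rational matrix near [g] need not have determinant 1, so for each rational [q] and each radius
    1/(k+1) some element of [SL] within that radius of [q] is chosen, with [SL1] as default if there
    is none. *)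
Lemma countable_dense_SL : exists u : nat -> SL R d,
  forall g s, 0 < s -> exists i, `|(u i : 'M[R]_d) - (g : 'M[R]_d)| < s.
Proof.
pose near (q : 'M[rat]_d) (k : nat) :=
  [set g : SL R d | `|(g : 'M[R]_d) - map_mx ratr q| < k.+1%:R^-1].
pose u i := if @unpickle ('M[rat]_d * nat)%type i is Some qk
  then xget SL1 (near qk.1 qk.2) else SL1.
exists u => g s s0.
have [k ks] : exists k : nat, k.+1%:R^-1 < s / 2.
  exists (Num.bound (2 / s)).
  rewrite invf_plt ?posrE ?divr_gt0//.
  rewrite invf_div.
  apply: lt_le_trans (archi_boundP _) _; first by rewrite divr_ge0// ltW.
  by rewrite ler_nat.
have /choice[f fP] : forall ij : 'I_d * 'I_d, exists q : rat,
    `|(g : 'M[R]_d) ij.1 ij.2 - ratr q| < k.+1%:R^-1.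
  move=> ij; have [] := @rat_in_itvoo R ((g : 'M[R]_d) ij.1 ij.2)
    ((g : 'M[R]_d) ij.1 ij.2 + k.+1%:R^-1); first by rewrite ltrDl.
  move=> q; rewrite in_itv/= => /andP[q1 q2]; exists q.
  by rewrite distrC gtr0_norm ?subr_gt0// ltrBlDl.
pose q : 'M[rat]_d := \matrix_(i, j) f (i, j).
have gq : near q k g.
  by apply: mx_norm_lt => // i j; rewrite !mxE; exact: (fP (i, j)).
exists (pickle (q, k)).
have : near q k (u (pickle (q, k))).
  by rewrite /u pickleK; apply: xgetPex; exists g.
move: (u (pickle (q, k)) : SL R d) => h hq.
rewrite -(subrK (map_mx ratr q) (h : 'M[R]_d)) -addrA.
rewrite (le_lt_trans (ler_normD _ _))//.
rewrite [s]splitr ltrD//; first exact: lt_trans hq ks.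
by rewrite distrC; exact: lt_trans gq ks.
Qed.

End topology.

(** * Bounded functions that are uniformly continuous along the action *)

Section test_functions.
Context {R : realType} {d : nat}.
Implicit Types g h k : SL R d.
Notation X := (lattices R d).
Implicit Types f F : X -> R.

(** The radius does not depend on [x]: on the noncompact space of lattices this replaces uniform
    continuity for a metric, and it survives translation and averaging. *)
Definition ucont f := forall e, 0 < e -> exists2 r, 0 < r &
  forall g x, nearSL r g -> `|f (act_lattices g x) - f x| <= e.

Definition bounded_ucont f := ucont f /\ exists M, forall x, `|f x| <= M.

Lemma bounded_ucont_cst (c : R) : bounded_ucont (fun=> c).
Proof.
split; last by exists `|c|.
by move=> e e0; exists 1 => // g x _; rewrite subrr normr0 ltW.
Qed.

Lemma bounded_ucontD f F : bounded_ucont f -> bounded_ucont F ->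
  bounded_ucont (fun x => f x + F x).
Proof.
move=> [uf [M fM]] [uF [N FN]]; split; last first.
  by exists (M + N) => x; rewrite (le_trans (ler_normD _ _))// lerD.
move=> e e0; have e20 : 0 < e / 2 by rewrite divr_gt0.
have [r r0 fr] := uf _ e20; have [s s0 Fs] := uF _ e20.
exists (Num.min r s); first by rewrite lt_min r0.
move=> g x; rewrite /nearSL lt_min => /andP[gr gs].
rewrite opprD addrACA (le_trans (ler_normD _ _))// [e]splitr.
by rewrite lerD ?fr ?Fs.
Qed.

Lemma bounded_ucontM f F : bounded_ucont f -> bounded_ucont F ->
  bounded_ucont (fun x => f x * F x).
Proof.
move=> [uf [M fM]] [uF [N FN]]; split; last first.
  by exists (M * N) => x; rewrite normrM ler_pM.
have M0 : 0 <= M by exact: le_trans (fM x0).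
have N0 : 0 <= N by exact: le_trans (FN x0).
move=> e e0; have e20 : 0 < e / (M + N + 1) by rewrite divr_gt0// ltr_wpDl// addr_ge0.
have [r r0 fr] := uf _ e20; have [s s0 Fs] := uF _ e20.
exists (Num.min r s); first by rewrite lt_min r0.
move=> g x; rewrite /nearSL lt_min => /andP[/fr gr /Fs gs].
set y := act_lattices g x.
have -> : f y * F y - f x * F x = (f y - f x) * F y + f x * (F y - F x) by ring.
rewrite (le_trans (ler_normD _ _))// !normrM.
have : `|f y - f x| * `|F y| <= e / (M + N + 1) * N by rewrite ler_pM// gr.
have : `|f x| * `|F y - F x| <= M * (e / (M + N + 1)) by rewrite ler_pM// gs.
have : e = e / (M + N + 1) * (M + N + 1) by rewrite divfK// gt_eqF// ltr_wpDl// addr_ge0.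
move: e20; nra.
Qed.

Lemma bounded_ucontZ (c : R) f : bounded_ucont f ->
  bounded_ucont (fun x => c * f x).
Proof. by move=> bf; apply: bounded_ucontM => //; exact: bounded_ucont_cst. Qed.

Lemma bounded_ucontB f F : bounded_ucont f -> bounded_ucont F ->
  bounded_ucont (fun x => f x - F x).
Proof.
move=> bf bF; under eq_fun => x do rewrite -mulN1r.
by apply: bounded_ucontD => //; exact: bounded_ucontZ.
Qed.

Lemma bounded_ucont_sum (J : Type) (s : seq J) (f : J -> X -> R) :
  (forall j, bounded_ucont (f j)) -> bounded_ucont (fun x => \sum_(j <- s) f j x).
Proof.
move=> bf; elim: s => [|j s IH].
  by under eq_fun do rewrite big_nil; exact: bounded_ucont_cst.
by under eq_fun do rewrite big_cons; exact: bounded_ucontD.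
Qed.

(** Translating by [h] before [g] is translating by the conjugate [g h g^-1] after [g], and this
    conjugate is still near 1. *)
Lemma bounded_ucont_act g f : bounded_ucont f ->
  bounded_ucont (fun x => f (act_lattices g x)).
Proof.
move=> [uf [M fM]]; split; last by exists M.
move=> e /uf[r /(nearSL_conj g)[s s0 sr] fr]; exists s => // h x /sr.
by move=> /(fr _ (act_lattices g x)); rewrite -!actM -!mulSLA mulVSL mulSL1.
Qed.

Lemma ucont_open f (U : set R) : ucont f -> open U -> open (f @^-1` U).
Proof.
move=> uf; rewrite openE => oU; apply: lattices_open => g /= /oU.
move=> /nbhs_ballP[e /= e0 eU].
have [r r0 fr] := uf (e / 2) ltac:(by rewrite divr_gt0).
have [s s0 sr] := SL_divr_near g r0.
exists s => // h /sr /(fr _ (act_lattices g x0)).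
rewrite -actM -mulSLA mulVSL mulSL1 => hg; apply: eU.
rewrite /ball /= distrC (le_lt_trans hg)// ltr_pdivrMr// mulr_natr mulr2n.
by rewrite ltrDl.
Qed.

Lemma ucont_measurable f : ucont f ->
  measurable_fun [set: borel_lattices R d] f.
Proof.
move=> uf; apply: (measurability _ (RGenOpens.measurableE R)).
move=> _ [_ [a [b ->]] <-]; rewrite setTI.
apply: sub_sigma_algebra; apply: ucont_open => //; exact: interval_open.
Qed.

End test_functions.

(** * Integration against the invariant probability: invariance, positivity, tightness *)

Section mean.
Context {R : realType} {d : nat}.
Variables (mu : probability (borel_lattices R d) R) (hmu : SL_invariant mu).
Implicit Types g h k : SL R d.
Notation X := (lattices R d).
Implicit Types f F : X -> R.

Definition mean f : R := \int[mu]_x f x.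

Lemma bounded_ucont_integrable f : bounded_ucont f ->
  mu.-integrable [set: borel_lattices R d] (EFin \o f).
Proof.
move=> [uf [M fM]]; apply: measurable_bounded_integrable => //.
- by rewrite (le_lt_trans (probability_le1 _ _))// ltry.
- exact: ucont_measurable.
- exists M; split; first exact: num_real.
  by move=> y My x _; exact: le_trans (fM x) (ltW My).
Qed.

Lemma mean_cst c : mean (fun=> c) = c.
Proof.
rewrite /mean Rintegral_cst// -[RHS]mulr1; congr (_ * _).
by rewrite -[RHS]/(fine 1%E); congr fine; exact: probability_setT.
Qed.

Lemma meanD f F : bounded_ucont f -> bounded_ucont F ->
  mean (fun x => f x + F x) = mean f + mean F.
Proof. by move=> *; apply: RintegralD => //; exact: bounded_ucont_integrable. Qed.

Lemma meanB f F : bounded_ucont f -> bounded_ucont F ->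
  mean (fun x => f x - F x) = mean f - mean F.
Proof. by move=> *; apply: RintegralB => //; exact: bounded_ucont_integrable. Qed.

Lemma meanZ c f : bounded_ucont f -> mean (fun x => c * f x) = c * mean f.
Proof. by move=> *; apply: RintegralZl => //; exact: bounded_ucont_integrable. Qed.

Lemma mean_sum (J : Type) (s : seq J) (f : J -> X -> R) :
  (forall j, bounded_ucont (f j)) ->
  mean (fun x => \sum_(j <- s) f j x) = \sum_(j <- s) mean (f j).
Proof.
move=> bf; elim: s => [|j s IH].
  by under eq_fun do rewrite big_nil; rewrite big_nil mean_cst.
under eq_fun do rewrite big_cons.
by rewrite big_cons meanD ?IH//; exact: bounded_ucont_sum.
Qed.

Lemma le_mean f F : bounded_ucont f -> bounded_ucont F ->
  (forall x, f x <= F x) -> mean f <= mean F.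
Proof.
by move=> *; apply: le_Rintegral => //; exact: bounded_ucont_integrable.
Qed.

Lemma act_preimage g (A : set X) :
  act_lattices g @^-1` A = act_lattices (invSL g) @` A.
Proof.
apply/seteqP; split=> [x Ax|_ [x Ax <-]] /=; last by rewrite actVK.
by exists (act_lattices g x) => //; rewrite actK.
Qed.

Lemma act_open g (A : set X) : open A -> open (act_lattices g @^-1` A).
Proof.
move=> oA; apply: lattices_open => h; rewrite /= -actM act_x0 => Ah.
have [s s0 sA] := SL_open_ball oA Ah.
have [r r0 rs] := SL_translate_near g SL1 h s0.
by exists r => // k /rs; rewrite !mulSL1 => /sA; rewrite -actM act_x0.
Qed.

Lemma act_measurable g : measurable_fun [set: borel_lattices R d]
  (act_lattices g : borel_lattices R d -> borel_lattices R d).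
Proof.
refine (@measurability _ _ (borel_lattices R d) (borel_lattices R d) setT
  (act_lattices g) (@open X) erefl _) => _ [A oA <-].
by rewrite setTI; apply: sub_sigma_algebra; exact: act_open.
Qed.

Lemma mean_act g f : bounded_ucont f ->
  mean (fun x => f (act_lattices g x)) = mean f.
Proof.
move=> bf; rewrite /mean /Rintegral; congr fine.
rewrite -[LHS](@integral_pushforward _ _ _ _ _ _ (act_measurable g) mu setT
  (EFin \o f))//; last 2 first.
  by apply/measurable_EFinP; apply: ucont_measurable; case: bf.
  by apply: bounded_ucont_integrable; exact: bounded_ucont_act.
apply: eq_measure_integral; first exact: act_measurable.
move=> mg A mA _.
by change (mu (act_lattices g @^-1` A) = mu A); rewrite act_preimage; exact: hmu.
Qed.

Lemma tube_measurable h r : measurable (tube h r : set (borel_lattices R d)).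
Proof. by apply: sub_sigma_algebra; exact: open_tube. Qed.

Lemma tube_act h r : tube h r = act_lattices h @` tube SL1 r.
Proof.
apply/seteqP; split=> [_ [g gr <-]|_ [_ [g gr <-] <-]].
  exists (act_lattices (mulSL SL1 g) x0); first by exists g.
  by rewrite mul1SL actM.
by exists g => //; rewrite mul1SL actM.
Qed.

Lemma tube_cover r : 0 < r -> exists u : nat -> SL R d,
  \bigcup_i tube (u i) r = [set: X].
Proof.
move=> r0; have [s s0 sr] := nearSL_inv (d := d) r0.
have [u uP] := @countable_dense_SL R d.
exists u; apply/seteqP; split=> // x _.
have [g ->] := act_transitive x.
have [t t0 tP] := SL_divl_near g s0.
have [i /tP/sr gi] := uP g _ t0; exists i => //.
exists (invSL (mulSL (invSL g) (u i))) => //; congr act_lattices.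
set k := mulSL (invSL g) (u i).
have -> : u i = mulSL g k by rewrite mulSLA mulSLV mul1SL.
by rewrite -mulSLA mulSLV mulSL1.
Qed.

Lemma integrable_indic_mu (A : set (borel_lattices R d)) : measurable A ->
  mu.-integrable [set: borel_lattices R d] (EFin \o \1_A).
Proof.
move=> mA; apply: measurable_bounded_integrable => //.
  by rewrite (le_lt_trans (probability_le1 _ _))// ltry.
exists 1; split; first exact: num_real.
move=> y y1 x _ /=; apply: le_trans (ltW y1).
by rewrite indicE; case: (_ \in _); rewrite ?normr0 ?normr1.
Qed.

Lemma mean_indic (A : set (borel_lattices R d)) : measurable A ->
  mean \1_A = fine (mu A).
Proof. by move=> mA; rewrite /mean /Rintegral integral_indic// setIT. Qed.

Lemma le_mean_indic f (A : set (borel_lattices R d)) : bounded_ucont f ->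
  measurable A -> (forall x, f x <= \1_A x) -> mean f <= fine (mu A).
Proof.
move=> bf mA fA; rewrite -mean_indic//; apply: le_Rintegral => //.
  exact: bounded_ucont_integrable.
exact: integrable_indic_mu.
Qed.

Lemma ge_mean_indic f (A : set (borel_lattices R d)) : bounded_ucont f ->
  measurable A -> (forall x, \1_A x <= f x) -> fine (mu A) <= mean f.
Proof.
move=> bf mA fA; rewrite -mean_indic//; apply: le_Rintegral => //.
  exact: integrable_indic_mu.
exact: bounded_ucont_integrable.
Qed.

(* Countably many translates of a tube cover, so it has positive measure. *)
Lemma tube_gt0 r : 0 < r -> 0 < fine (mu (tube SL1 r)).
Proof.
move=> r0; apply: fine_gt0; rewrite (le_lt_trans (probability_le1 _ _)) ?ltry ?andbT//;
  last exact: tube_measurable.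
rewrite lt0e measure_ge0 andbT; apply/eqP => mu0.
have [u uP] := tube_cover r0.
have : mu.-negligible (\bigcup_i (tube (u i) r : set (borel_lattices R d))).
  apply: negligible_bigcup => i; apply/negligibleP; first exact: tube_measurable.
  by rewrite tube_act -[RHS]mu0; apply: hmu; exact: tube_measurable.
rewrite uP => /negligibleP => /(_ measurableT) muT0.
have : 0%E = 1%E :> \bar R by rewrite -[LHS]muT0; exact: probability_setT.
by move=> [] /esym/eqP; rewrite oner_eq0.
Qed.

(** Used contrapositively: a nonnegative function of mean below [c * b] takes a value below [c] at
    some lattice near [x0]. Here [b] is the measure of the tube at 1. *)
Lemma mean_positive r : 0 < r -> exists2 b, 0 < b &
  forall F c, bounded_ucont F -> (forall x, 0 <= F x) -> 0 <= c ->
    (forall g, nearSL r g -> c <= F (act_lattices g x0)) -> c * b <= mean F.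
Proof.
move=> r0; exists (fine (mu (tube SL1 r))); first exact: tube_gt0.
move=> F c bF F0 c0 cF.
have mt := tube_measurable SL1 r.
rewrite -mean_indic// -RintegralZl//; last exact: integrable_indic_mu.
apply: le_Rintegral => //.
- have -> : EFin \o (fun x : borel_lattices R d => c * \1_(tube SL1 r) x) =
      (fun x => c%:E * (EFin \o \1_(tube SL1 r)) x)%E by apply/funext.
  by apply: integrableZl => //; exact: integrable_indic_mu.
- exact: bounded_ucont_integrable.
move=> x _; rewrite indicE; have [|_] := boolP (x \in _); last by rewrite mulr0.
by rewrite inE mulr1 => -[g gr <-]; rewrite mul1SL; exact: cF.
Qed.

(** This plays the role of a compact part of measure at least [1 - e]: finitely many tubes of a
    countable cover carry that measure, and lattices in them have representatives bounded together
    with their inverses. *)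
Lemma mean_tight e : 0 < e -> exists2 rho, 0 < rho &
  forall F c, bounded_ucont F -> (forall x, F x <= 1) -> 0 <= c ->
    (forall g, `|(g : 'M[R]_d)| <= rho -> `|(invSL g : 'M[R]_d)| <= rho ->
      F (act_lattices g x0) <= c) -> mean F <= c + e.
Proof.
move=> e0.
(* With this radius [near1_inverse] applies, so every [g] in a tube at 1 and its inverse have norm
   at most 2. *)
have r0 : (0 : R) < 2^-1 / d.+1%:R by rewrite divr_gt0// invr_gt0.
have [u uP] := tube_cover r0.
set r := 2^-1 / _ in r0 uP.
pose D n := \bigcup_(i in `I_n.+1) (tube (u i) r : set (borel_lattices R d)).
have mD n : measurable (D n).
  by apply: bigcup_measurable => i _; exact: tube_measurable.
have DT : mu (D n) @[n --> \oo] --> 1%E.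
  have bD : \bigcup_k D k = [set: borel_lattices R d].
    rewrite -[RHS]uP; apply/seteqP; split=> [x [k _ [i _ xi]]|x [i _ xi]].
      by exists i.
    by exists i => //; exists i => //=.
  have <- : mu (\bigcup_k D k) = 1%E by rewrite bD; exact: probability_setT.
  apply: (@nondecreasing_cvg_mu _ _ _ mu D) => //.
    by rewrite bD.
  move=> p q pq; apply/subsetPset.
  by apply: bigcup_sub => i /= ip x xi; exists i => //=; exact: (leq_trans ip (pq : (p < q.+1)%N)).
have [n nD] : exists n, 1 - e <= fine (mu (D n)).
  move/fine_cvgP : DT => [_ /cvgrPdist_le/(_ _ e0)[n _ /(_ n (leqnn n))]] /=.
  move=> /(le_trans (ler_norm _)) h; exists n; lra.
pose M := \sum_(i < n.+1) (`|(u i : 'M[R]_d)| + `|(invSL (u i) : 'M[R]_d)|).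
have uM i : (i < n.+1)%N -> `|(u i : 'M[R]_d)| <= M /\ `|(invSL (u i) : 'M[R]_d)| <= M.
  move=> lin; rewrite /M (bigD1 (Ordinal lin))//=.
  set S := \sum_(_ < _ | _) _; have S0 : 0 <= S by apply: sumr_ge0 => j _; exact: addr_ge0.
  have := normr_ge0 (u i : 'M[R]_d); have := normr_ge0 (invSL (u i) : 'M[R]_d); lra.
have M0 : 0 <= M by apply: sumr_ge0 => i _; exact: addr_ge0.
(* [2 * d * M] bounds both [u_i g] and its inverse; the added 1 makes the constant positive. *)
exists (2 * d%:R * M + 1); first by rewrite ltr_wpDl// !mulr_ge0.
move=> F c bF F1 c0 Fc.
have FD x : D n x -> F x <= c.
  move=> [i /= /uM[ui vi] [g gr <-]].
  have dr : d%:R * r <= 2^-1.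
    by rewrite /r mulrCA ler_piMr// ler_pdivrMr// mul1r ler_nat.
  have [_ g2 _] := near1_inverse (ltW gr) dr.
  have gg2 : `|(g : 'M[R]_d)| <= 2.
    rewrite -(subrK 1%:M (g : 'M[R]_d)) (le_trans (ler_normD _ _))//.
    have r1 : r <= 1.
      by rewrite /r ler_pdivrMr// mul1r (@le_trans _ _ 1) ?invf_le1 ?ler1n.
    have := mx_norm1 (R := R) d; have := ltW gr; lra.
  apply: Fc; rewrite ler_wpDr//.
    rewrite SLval_mul (le_trans (mx_norm_mul _ _))// [2 * _]mulrC -!mulrA ler_wpM2l//.
    by rewrite mulrC ler_pM.
  rewrite invSLM SLval_mul.
  rewrite (le_trans (mx_norm_mul _ _))// [2 * _]mulrC -!mulrA ler_wpM2l//.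
  by rewrite ler_pM.
have mC : measurable (~` D n) by exact: measurableC.
have -> : c + e = mean (fun x => c + e) by rewrite mean_cst.
have : mean F <= mean (fun x => c + \1_(~` D n) x).
  apply: le_Rintegral => //; first exact: bounded_ucont_integrable.
    have -> : EFin \o (fun x : borel_lattices R d => c + \1_(~` D n) x) =
      ((EFin \o (fun=> c)) \+ (EFin \o \1_(~` D n)))%E by apply/funext.
    apply: integrableD => //.
      by apply: bounded_ucont_integrable; exact: bounded_ucont_cst.
    by apply: integrable_indic_mu.
  move=> x _; rewrite indicE; case: (pselect (D n x)) => xD.
    by rewrite memNset ?addr0; [exact: FD|move=> /(_ xD)].
  by rewrite mem_set// (le_trans (F1 x))// ler_wpDl.
move=> /le_trans; apply; rewrite mean_cst [leLHS]RintegralD//; last 2 first.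
- by apply: bounded_ucont_integrable; exact: bounded_ucont_cst.
- by apply: integrable_indic_mu.
rewrite [X in X + _]mean_cst [X in _ + X]mean_indic// probability_setC// fineB//.
  rewrite lerD2l; move: nD => /=; lra.
exact: fin_num_measure.
Qed.

End mean.

(** * Generation of SL(d, R) by elementary matrices with bounded word length *)

Section elementary.
Context {R : realType} {d : nat}.
Implicit Types (g h : SL R d) (i j k l : 'I_d) (s t : R).

Lemma det_elementary i j s : i != j ->
  \det (1%:M + s *: delta_mx i j : 'M[R]_d) = 1.
Proof.
wlog lt_ij : i j / (j < i)%N => [wl|] ij.
  have [/wl->//|ji|/val_inj e] := ltngtP j i; last by rewrite e eqxx in ij.
  rewrite -det_tr linearD /= trmx1 linearZ /= trmx_delta wl//.
  by rewrite eq_sym.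
rewrite det_trig.
  rewrite big1// => k _; rewrite !mxE eqxx.
  by case: eqP => [->|_]; rewrite ?(negbTE ij) /= mulr0 addr0.
apply/is_trig_mxP => k l kl; rewrite !mxE.
have -> : (k == l) = false by apply/eqP => e; rewrite e ltnn in kl.
have -> : (k == i) && (l == j) = false.
  apply/negP => /andP[/eqP ki /eqP lj]; rewrite ki lj in kl.
  by have := ltn_trans kl lt_ij; rewrite ltnn.
by rewrite mulr0 addr0.
Qed.

Definition elem i j (ij : i != j) s : SL R d := mkSL (det_elementary s ij).

Lemma SLval_elem i j (ij : i != j) s :
  elem ij s = 1%:M + s *: delta_mx i j :> 'M[R]_d.
Proof. by []. Qed.

Lemma elem_mulE q i j (ij : i != j) s (g : 'M[R]_(d, q)) k (l : 'I_q) :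
  ((elem ij s : 'M[R]_d) *m g) k l = g k l + (k == i)%:R * (s * g j l).
Proof.
rewrite SLval_elem mulmxDl mul1mx -scalemxAl !mxE; congr (_ + _).
rewrite (bigD1 j)//= big1 ?addr0 => [|p /negbTE pj].
  by rewrite !mxE eqxx andbT mulrCA.
by rewrite mxE pj andbF mul0r.
Qed.

Lemma mul_elemE i j (ij : i != j) s (g : 'M[R]_d) k l :
  (g *m (elem ij s : 'M[R]_d)) k l = g k l + (l == j)%:R * (s * g k i).
Proof.
rewrite SLval_elem mulmxDr mulmx1 -scalemxAr !mxE; congr (_ + _).
rewrite (bigD1 i)//= big1 ?addr0 => [|p /negbTE pj].
  by rewrite !mxE eqxx /= (mulrC (g k i)) mulrCA.
by rewrite mxE pj mulr0.
Qed.

Lemma elemD i j (ij : i != j) s t :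
  mulSL (elem ij s) (elem ij t) = elem ij (s + t).
Proof.
apply: SLval_inj; apply/matrixP => k l; rewrite SLval_mul elem_mulE !mxE.
rewrite (eq_sym l j) (eq_sym j i) (negbTE ij).
by case: (j == l); case: (k == i) => /=; ring.
Qed.

Lemma elem0 i j (ij : i != j) : elem ij 0 = SL1.
Proof. by apply: SLval_inj; rewrite SLval_elem scale0r addr0. Qed.

Lemma nearSL_elem i j (ij : i != j) s r : `|s| < r -> nearSL r (elem ij s).
Proof.
move=> sr; rewrite /nearSL SLval_elem addrAC subrr add0r (le_lt_trans _ sr)//.
apply: mx_norm_le => // k l; rewrite !mxE normrM ler_piMr//.
by case: (_ && _); rewrite ?normr0 ?normr1.
Qed.

(** Letters may be added on either side, since elimination uses row and column operations; [ewS]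
    pads shorter words, so one length serves for the whole group. *)
Inductive elem_word : nat -> SL R d -> Prop :=
| ew1 : elem_word 0 SL1
| ewl n g i j (ij : i != j) s : elem_word n g -> elem_word n.+1 (mulSL (elem ij s) g)
| ewr n g i j (ij : i != j) s : elem_word n g -> elem_word n.+1 (mulSL g (elem ij s))
| ewS n g : elem_word n g -> elem_word n.+1 g.

Lemma ewl_inv n g i j (ij : i != j) s :
  elem_word n (mulSL (elem ij s) g) -> elem_word n.+1 g.
Proof.
move/(ewl ij (- s)); rewrite mulSLA elemD addNr elem0 mul1SL; exact.
Qed.

Lemma ewr_inv n g i j (ij : i != j) s :
  elem_word n (mulSL g (elem ij s)) -> elem_word n.+1 g.
Proof.
move/(ewr ij (- s)); rewrite -mulSLA elemD subrr elem0 mulSL1; exact.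
Qed.

Definition cleared (r : nat) g :=
  forall i j, (i < r)%N || (j < r)%N -> (g : 'M[R]_d) i j = (i == j)%:R.

(** At most one diagonal entry is left undetermined, and the determinant forces it to be 1. *)
Lemma cleared_last r g : (d <= r.+1)%N -> cleared r g -> g = SL1.
Proof.
move=> dr cg; apply: SLval_inj; rewrite /=.
have offd i j : i != j -> (g : 'M[R]_d) i j = 0.
  move=> ij; rewrite cg ?(negbTE ij)//.
  rewrite -[_ || _]negbK negb_or -!leqNgt; apply: contra_neqN ij.
  move=> /andP[ri rj]; apply: val_inj => /=.
  have big (k : 'I_d) : (r <= k)%N -> k = r :> nat.
    move=> rk; apply/eqP; rewrite eqn_leq rk andbT -ltnS.
    exact: leq_trans (ltn_ord k) dr.
  by rewrite (big _ ri) (big _ rj).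
have dg : is_trig_mx (g : 'M[R]_d).
  by apply/is_trig_mxP => i j ij; apply: offd; apply/eqP => e; rewrite e ltnn in ij.
have := det_SL g; rewrite (det_trig dg) => gd.
apply/matrixP => i j; rewrite mxE; have [<-|] := eqVneq i j; last exact: offd.
have [ir|ir] := boolP (i < r)%N; first by rewrite cg ?ir// eqxx.
move: gd; rewrite (bigD1 i)//= big1 ?mulr1// => k ki.
rewrite cg ?eqxx// orbb ltnNge; apply: contra_neqN ki => rk; apply: val_inj.
apply/eqP; rewrite eqn_leq /= -ltnS (leq_trans (ltn_ord k))//=; last first.
  by rewrite (leq_trans dr)// ltnS leqNgt.
by rewrite -ltnS (leq_trans (ltn_ord i))// (leq_trans dr).
Qed.

(** [s] lists the columns still allowed a nonzero entry in the pivot row. The pivot column is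
    already a unit vector, so subtracting a multiple of it changes that one entry only. *)
Lemma clear_row n r (rd : (r < d)%N) (s : seq 'I_d) g :
  (forall h, cleared r.+1 h -> elem_word n h) ->
  {in s, forall k, (r < k)%N} ->
  cleared r g ->
  (forall i, (g : 'M[R]_d) i (Ordinal rd) = (i == Ordinal rd)%:R) ->
  (forall k, (r < k)%N -> k \notin s -> (g : 'M[R]_d) (Ordinal rd) k = 0) ->
  elem_word (n + size s) g.
Proof.
set o := Ordinal rd => IH; elim: s g => [|k s IHs] g sr cg go gs.
  rewrite addn0; apply: IH => i j; rewrite !ltnS (leq_eqVlt i) (leq_eqVlt j).
  move=> /orP[/orP[/eqP ir|ir]|/orP[/eqP jr|jr]].
  - have -> : i = o by exact: val_inj.
    have [jr|jr|jr] := ltngtP j r; first by rewrite cg// jr orbT.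
      by rewrite gs// -(val_eqE o j) /= ltn_eqF.
    by have -> : j = o; [exact: val_inj|rewrite go].
  - by rewrite cg// ir.
  - by have -> : j = o; [exact: val_inj|rewrite go].
  - by rewrite cg// jr orbT.
have rk : (r < k)%N by apply: sr; rewrite mem_head.
have ok : o != k by rewrite -val_eqE /= ltn_eqF.
rewrite /= addnS; apply: (@ewr_inv _ _ _ _ ok (- (g : 'M[R]_d) o k)).
apply: IHs => [l ls|i j ijr|i|l rl ls].
- by apply: sr; rewrite inE ls orbT.
- rewrite SLval_mul mul_elemE cg// go.
  have [jk|] := eqVneq j k; last by rewrite mul0r addr0.
  have [io|] := eqVneq i o; last by rewrite !mulr0 addr0.
  by move: ijr; rewrite io jk /= ltnn /= ltnNge ltnW.
- by rewrite SLval_mul mul_elemE go (negbTE ok) mul0r addr0.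
- rewrite SLval_mul mul_elemE go eqxx mulr1.
  have [->|lk] := eqVneq l k; first by rewrite mul1r subrr.
  by rewrite mul0r addr0 gs// inE negb_or lk.
Qed.

(** The pivot row is not yet clean, so a row operation also alters entries to the right of the pivot
    column; the columns before the pivot survive because the pivot row vanishes there. *)
Lemma clear_col n r (rd : (r < d)%N) (s : seq 'I_d) g :
  (forall h, cleared r h -> (forall i, (h : 'M[R]_d) i (Ordinal rd) = (i == Ordinal rd)%:R) ->
     elem_word n h) ->
  {in s, forall k, (r < k)%N} ->
  cleared r g ->
  (g : 'M[R]_d) (Ordinal rd) (Ordinal rd) = 1 ->
  (forall k, (r < k)%N -> k \notin s -> (g : 'M[R]_d) k (Ordinal rd) = 0) ->
  elem_word (n + size s) g.
Proof.
set o := Ordinal rd => IH; elim: s g => [|k s IHs] g sr cg go gs.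
  rewrite addn0; apply: IH => // i.
  have [ir|ir|ir] := ltngtP i r; first by rewrite cg// ir.
    by rewrite gs// -(val_eqE i o) /= gtn_eqF.
  by have -> : i = o; [exact: val_inj|rewrite go eqxx].
have rk : (r < k)%N by apply: sr; rewrite mem_head.
have ok : k != o by rewrite -val_eqE /= gtn_eqF.
rewrite /= addnS; apply: (@ewl_inv _ _ _ _ ok (- (g : 'M[R]_d) k o)).
apply: IHs => [l ls|i j ijr||l rl ls].
- by apply: sr; rewrite inE ls orbT.
- rewrite SLval_mul elem_mulE cg//.
  have [ik|] := eqVneq i k; last by rewrite mul0r addr0.
  have [jr|jr] := boolP (j < r)%N.
    rewrite (cg o j) ?jr ?orbT// (_ : o == j = false) ?mulr0 ?addr0//.
    by rewrite -val_eqE /= gtn_eqF.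
  by move: ijr; rewrite ik (negbTE jr) orbF ltnNge ltnW.
- by rewrite SLval_mul elem_mulE go eq_sym (negbTE ok) mul0r addr0.
- rewrite SLval_mul elem_mulE go mulr1.
  have [->|lk] := eqVneq l k; first by rewrite mul1r subrr.
  by rewrite mul0r addr0 gs// inE negb_or lk.
Qed.

(** Gaussian elimination without scaling rows: a nonzero entry below the pivot makes the pivot equal
    to 1 by one row operation. If there is none, invertibility makes the pivot nonzero, and adding
    its row to the next one creates such an entry. *)
Lemma elem_word_cleared m r : (d <= m + r.+1)%N ->
  exists n, forall g, cleared r g -> elem_word n g.
Proof.
elim: m r => [|m IHm] r; first by exists 0%N => g /cleared_last ->//; constructor.
rewrite addSnnS => /IHm[n nP].
have [dr|rd1] := leqP d r.+1.
  by exists 0%N => g /cleared_last ->//; constructor.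
have rd : (r < d)%N by exact: ltnW.
set o := Ordinal rd.
pose s := [seq k : 'I_d <- enum 'I_d | (r < k)%N].
have sr : {in s, forall k : 'I_d, (r < k)%N} by move=> k; rewrite mem_filter => /andP[].
have sn (k : 'I_d) : (r < k)%N -> k \notin s -> False.
  by rewrite mem_filter mem_enum => ->.
pose p := (n + size s + size s)%N.
have gp g : cleared r g -> (g : 'M[R]_d) o o = 1 -> elem_word p g.
  move=> cg goo; apply: (@clear_col _ _ rd) => // [h ch ho|k rk /sn-/(_ rk)//].
  by apply: (@clear_row _ _ rd) => // k rk /sn-/(_ rk).
have gp1 g k : cleared r g -> (r < k)%N -> (g : 'M[R]_d) k o != 0 -> elem_word p.+1 g.
  move=> cg rk gko.
  have ok : o != k by rewrite -val_eqE /= ltn_eqF.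
  (* The multiple of row [k] that turns the pivot into 1. *)
  apply: (@ewl_inv _ _ _ _ ok ((1 - (g : 'M[R]_d) o o) / (g : 'M[R]_d) k o)).
  apply: gp => [i j ijr|].
    rewrite SLval_mul elem_mulE cg//.
    have [io|] := eqVneq i o; last by rewrite mul0r addr0.
    move: ijr; rewrite io /= ltnn /= => jr.
    rewrite (cg k j) ?jr ?orbT// (_ : k == j = false) ?mulr0 ?addr0//.
    by rewrite -val_eqE /= gtn_eqF// (ltn_trans jr).
  by rewrite SLval_mul elem_mulE eqxx mul1r divfK// addrC subrK.
exists p.+2 => g cg.
have [/existsP[k /andP[rk gko]]|/existsPn none] :=
    boolP [exists k : 'I_d, (r < k)%N && ((g : 'M[R]_d) k o != 0)].
  by apply: ewS; exact: (gp1 g k).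
have g0 i : i != o -> (g : 'M[R]_d) i o = 0.
  move=> io; have [ir|ir|ir] := ltngtP (i : nat) r.
  - by rewrite cg ?ir// (negbTE io).
  - by have := none i; rewrite ir /= negbK => /eqP.
  - by move: io; rewrite -(val_eqE i o) /= ir eqxx.
have goo : (g : 'M[R]_d) o o != 0.
  apply/negP => /eqP goo; have := congr1 (fun A : 'M[R]_d => A o o) (mulVmx (unitSL g)).
  rewrite !mxE eqxx big1 => [/eqP|i _]; first by rewrite eq_sym oner_eq0.
  by have [->|/g0->] := eqVneq i o; rewrite ?goo mulr0.
pose k := Ordinal rd1.
have ko : k != o by rewrite -val_eqE /= gtn_eqF.
apply: (@ewl_inv _ _ _ _ ko 1); apply: (gp1 _ k) => //.
  move=> i j ijr; rewrite SLval_mul elem_mulE cg//.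
  have [ik|] := eqVneq i k; last by rewrite mul0r addr0.
  move: ijr; rewrite ik /= ltnNge leqnSn /= => jr.
  rewrite (cg o j) ?jr ?orbT// (_ : o == j = false) ?mulr0 ?addr0//.
  by rewrite -val_eqE /= gtn_eqF.
by rewrite SLval_mul elem_mulE eqxx !mul1r (g0 k)// add0r.
Qed.

Lemma elem_generation : exists n, forall g, elem_word n g.
Proof.
have [n nP] := @elem_word_cleared d 0 (leq_addr _ _).
by exists n => g; apply: nP => i j; rewrite !ltn0.
Qed.

End elementary.

(** * Diagonal matrices as short words in two opposite root groups *)

Section mautner_matrices.
Context {R : realType} {d : nat}.
Variables (i j : 'I_d) (ij : i != j).
Implicit Types (a b c s t : R) (k l : 'I_d).

Let ji : j != i. Proof. by rewrite eq_sym. Qed.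

(* The embedded 2 x 2 matrix [1 + p, q; t, 1 + s] in the coordinates i, j. *)
Let sl2 (p q t s : R) : 'M[R]_d :=
  1%:M + (p *: delta_mx i i + q *: delta_mx i j + t *: delta_mx j i + s *: delta_mx j j).

Let sl2_upper p q t s y :
  sl2 p q t s *m (elem ij y : 'M[R]_d) = sl2 p (q + y * (1 + p)) t (s + y * t).
Proof.
apply/matrixP => k l; rewrite mul_elemE !mxE.
have simp := (eqxx, negbTE ij, negbTE ji, andbT, andbF).
have [->|li] := eqVneq l i; rewrite ?simp; first by rewrite /=; ring.
have [->|lj] := eqVneq l j; rewrite ?simp; last by rewrite /=; ring.
have [->|ki] := eqVneq k i; rewrite ?simp; first by rewrite /=; ring.
by have [_|_] := eqVneq k j; rewrite /=; ring.
Qed.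

Let sl2_lower p q t s y :
  sl2 p q t s *m (elem ji y : 'M[R]_d) = sl2 (p + y * q) q (t + y * (1 + s)) s.
Proof.
apply/matrixP => k l; rewrite mul_elemE !mxE.
have simp := (eqxx, negbTE ij, negbTE ji, andbT, andbF).
have [->|lj] := eqVneq l j; rewrite ?simp; first by rewrite /=; ring.
have [->|li] := eqVneq l i; rewrite ?simp; last by rewrite /=; ring.
have [->|kj] := eqVneq k j; rewrite ?simp; first by rewrite /=; ring.
by have [_|_] := eqVneq k i; rewrite /=; ring.
Qed.

(** For every nonzero [c] this word is the diagonal matrix with entries [a] and [a^-1] at [i] and
    [j]. The freedom in [c] makes both lower factors as close to 1 as desired. *)
Let diag_word a c := mulSL (elem ij ((a - 1) / c)) (mulSL (elem ji c)
  (mulSL (elem ij ((a^-1 - 1) / c)) (elem ji (- (c * a))))).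

Let diag_wordE a c : a != 0 -> c != 0 ->
  diag_word a c = sl2 (a - 1) 0 0 (a^-1 - 1) :> 'M[R]_d.
Proof.
move=> a0 c0; rewrite /diag_word !SLval_mul !mulmxA.
have -> : (elem ij ((a - 1) / c) : 'M[R]_d) = sl2 0 ((a - 1) / c) 0 0.
  by rewrite /sl2 !scale0r !addr0 add0r.
rewrite sl2_lower sl2_upper sl2_lower; congr sl2; by field; rewrite ?a0 ?c0.
Qed.

Definition torus a := diag_word a 1.

Lemma torus_word a c : a != 0 -> c != 0 -> torus a = diag_word a c.
Proof.
move=> a0 c0; apply: SLval_inj.
by rewrite [LHS]diag_wordE ?[RHS]diag_wordE ?oner_neq0.
Qed.

Definition weight a k : R := if k == i then a else if k == j then a^-1 else 1.

Lemma torus_elem a k l (kl : k != l) s : a != 0 ->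
  mulSL (torus a) (elem kl s) = mulSL (elem kl (s * (weight a k / weight a l))) (torus a).
Proof.
move=> a0; have w0 p : weight a p != 0.
  by rewrite /weight; case: ifP => // _; case: ifP => // _; rewrite ?invr_eq0 ?oner_eq0.
have torusE p q : (torus a : 'M[R]_d) p q = (p == q)%:R * weight a p.
  rewrite /torus diag_wordE ?oner_neq0// /weight !mxE.
  have [->|pi] := eqVneq p i.
    rewrite (negbTE ij) eq_sym; case: (q == i) => /=; ring.
  have [->|pj] := eqVneq p j.
    rewrite eq_sym; case: (q == j) => /=; ring.
  by rewrite /=; ring.
apply: SLval_inj; apply/matrixP => p q.
rewrite (SLval_mul (torus a)) (SLval_mul (elem kl _)) mul_elemE (elem_mulE kl) !torusE.
congr (_ + _); rewrite (eq_sym l q).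
have [->|_] := eqVneq p k; last by rewrite !(mul0r, mulr0).
by case: (q == l); rewrite ?mul0r ?mulr0 //=; field.
Qed.

(* Every root space not orthogonal to (i, j) is contracted by the torus. *)
Lemma weight_contract k l b : k != l ->
  [|| k == i, k == j, l == i | l == j] -> 0 < b -> b <= 1 ->
  exists2 a, a != 0 & `|weight a k / weight a l| <= b.
Proof.
move=> kl meet b0 b1.
have b10 : b != 0 by rewrite gt_eqF.
have bb : b * b <= b by rewrite ler_piMr// ltW.
have nb : `|b| = b by rewrite gtr0_norm.
have nbb : `|b * b| <= b by rewrite normrM nb.
have [/orP[/eqP ki|/eqP lj]|] := boolP ((k == i) || (l == j)).
- exists b => //; rewrite /weight ki eqxx.
  rewrite ki eq_sym in kl; rewrite (negbTE kl).
  by case: ifP => _; rewrite ?invrK ?invr1 ?mulr1 ?nb.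
- exists b => //; rewrite /weight lj eqxx (negbTE ji) invrK.
  rewrite lj in kl; rewrite (negbTE kl).
  by case: ifP => _; rewrite ?mul1r ?nb.
rewrite negb_or => /andP[/negbTE ki /negbTE lj].
move: meet; rewrite ki lj /= orbF => meet.
(* Here [k = j] or [l = i], and the inverse torus element contracts. *)
exists b^-1; first by rewrite invr_eq0.
rewrite /weight ki lj invrK.
case: (k == j) meet => [_|/= ->]; last by rewrite invrK mul1r nb.
by case: ifP => _; rewrite ?invrK ?invr1 ?mulr1 ?nb.
Qed.

End mautner_matrices.

(** * A quantitative Mautner phenomenon, and almost invariant averages *)

Section mautner.
Context {R : realType} {d : nat}.
Variables (mu : probability (borel_lattices R d) R) (hmu : SL_invariant mu).
Implicit Types (g : SL R d) (f h : lattices R d -> R).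

(** The squared L2 distance from [h] to its translate. Without the square root the triangle
    inequality costs a factor 2 per step, harmless because word lengths are bounded. *)
Definition defect h g := mean mu (fun x => (h (act_lattices g x) - h x) ^+ 2).

Lemma bounded_ucont_sqr h : bounded_ucont h -> bounded_ucont (fun x => h x ^+ 2).
Proof. by move=> bh; under eq_fun do rewrite expr2; exact: bounded_ucontM. Qed.

Lemma bounded_ucont_defect h g : bounded_ucont h ->
  bounded_ucont (fun x => (h (act_lattices g x) - h x) ^+ 2).
Proof.
move=> bh; apply: bounded_ucont_sqr; apply: bounded_ucontB => //.
exact: bounded_ucont_act.
Qed.

Lemma mean_sqrD f h : bounded_ucont f -> bounded_ucont h ->
  mean mu (fun x => (f x + h x) ^+ 2) <=
  2 * mean mu (fun x => f x ^+ 2) + 2 * mean mu (fun x => h x ^+ 2).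
Proof.
move=> bf bh.
have bf2 := bounded_ucont_sqr bf; have bh2 := bounded_ucont_sqr bh.
rewrite -(meanZ mu 2 bf2) -(meanZ mu 2 bh2) -meanD; try exact: bounded_ucontZ.
apply: le_mean => [||x].
- by apply: bounded_ucont_sqr; exact: bounded_ucontD.
- by apply: bounded_ucontD; exact: bounded_ucontZ.
- have := sqr_ge0 (f x - h x); nra.
Qed.

(** Triangle inequality through [h (k x)]; invariance of [mu] removes [k] from the first term. *)
Lemma defectM h g k : bounded_ucont h ->
  defect h (mulSL g k) <= 2 * defect h g + 2 * defect h k.
Proof.
move=> bh; have bhg g' := bounded_ucont_act g' bh.
rewrite -[defect h g](mean_act hmu k (bounded_ucont_defect g bh)).
rewrite /defect; under [X in mean _ X <= _]eq_fun => x do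
  rewrite -(subrKA (h (act_lattices k x))) actM.
apply: mean_sqrD; apply: bounded_ucontB => //.
by apply: bounded_ucont_act (bhg g).
Qed.

Lemma defectV h g : bounded_ucont h -> defect h (invSL g) = defect h g.
Proof.
move=> bh; rewrite -[RHS](mean_act hmu (invSL g) (bounded_ucont_defect g bh)).
by rewrite /defect; congr (mean mu); apply/funext => x; rewrite actVK -opprB sqrrN.
Qed.

Lemma defect_ge0 h g : 0 <= defect h g.
Proof. by apply: Rintegral_ge0 => x _; exact: sqr_ge0. Qed.

Lemma defect1 h : defect h SL1 = 0.
Proof.
by rewrite /defect; under eq_fun do rewrite act1 subrr expr0n /=; rewrite mean_cst.
Qed.

Lemma defect_near h e : bounded_ucont h -> 0 < e ->
  exists2 r, 0 < r & forall g, nearSL r g -> defect h g <= e.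
Proof.
(* A difference that is at most both [e] and 1 has square at most [e]. *)
move=> bh e0; have m0 : 0 < Num.min e 1 by rewrite lt_min e0 /=.
have [r r0 hr] := bh.1 _ m0; exists r => // g gr.
rewrite -[leRHS](mean_cst mu); apply: le_mean => [||x].
- exact: bounded_ucont_defect.
- exact: bounded_ucont_cst.
have := hr g x gr; rewrite le_min -real_normK ?num_real// => /andP[xe x1].
by rewrite expr2 (le_trans _ xe)// ler_piMr.
Qed.

Section elementary_root.
Variables (i j : 'I_d) (ij : i != j) (h : lattices R d -> R) (bh : bounded_ucont h).
Variables (eta : R) (hij : forall s, defect h (elem ij s) <= eta).

Let eta0 : 0 <= eta. Proof. exact: le_trans (defect_ge0 h _) (hij 0). Qed.

(* Mautner: the two lower triangular factors of the word are arbitrarily small. *)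
Lemma defect_torus a : a != 0 -> defect h (torus ij a) <= 10 * eta.
Proof.
move=> a0; apply/ler_addgt0Pr => e e0.
have [r r0 hr] := defect_near bh (divr_gt0 e0 (ltr0n R 12)).
have a'0 : 0 < `|a| by rewrite normr_gt0.
pose c := Num.min (r / 2) (r / 2 / `|a|).
have c0 : 0 < c by rewrite lt_min !divr_gt0.
rewrite (torus_word ij a0 (lt0r_neq0 c0)).
have cr : c <= r / 2 by rewrite ge_min lexx.
have car : c * `|a| <= r / 2 by rewrite -ler_pdivlMr// ge_min lexx orbT.
set ji := (X in mulSL (elem X c) _).
have h1 : defect h (elem ji c) <= e / 12.
  by apply: hr; apply: nearSL_elem; rewrite gtr0_norm//; lra.
have h2 : defect h (elem ji (- (c * a))) <= e / 12.
  by apply: hr; apply: nearSL_elem; rewrite normrN normrM gtr0_norm//; lra.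
(* The four factors weigh 2, 4, 8, 8: the two upper ones give [(2 + 8) * eta], the two lower ones
   [(4 + 8) * e / 12 = e]. *)
rewrite (le_trans (defectM _ _ bh))//.
have := defectM (elem ji c) (mulSL (elem ij ((a^-1 - 1) / c)) (elem ji (- (c * a)))) bh.
have := defectM (elem ij ((a^-1 - 1) / c)) (elem ji (- (c * a))) bh.
have := hij ((a^-1 - 1) / c); have := hij ((a - 1) / c); lra.
Qed.

(** Conjugation by a suitable torus element carries [elem kl s] to an element near 1, of negligible
    defect. The two torus factors weigh 2 and 4, whence [(2 + 4) * 10 = 60]. *)
Lemma defect_contracted k l (kl : k != l) s :
  [|| k == i, k == j, l == i | l == j] -> defect h (elem kl s) <= 60 * eta.
Proof.
move=> meet; apply/ler_addgt0Pr => e e0.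
have [r r0 hr] := defect_near bh (divr_gt0 e0 (ltr0n R 4)).
pose b := Num.min 1 (r / 2 / (`|s| + 1)).
have b0 : 0 < b by rewrite lt_min ltr01 !divr_gt0.
have b1 : b <= 1 by rewrite ge_min lexx.
have br : (`|s| + 1) * b <= r / 2 by rewrite mulrC -ler_pdivlMr// ge_min lexx orbT.
have [a a0 ab] := weight_contract ij kl meet b0 b1.
have := torus_elem ij kl s a0; set t := s * _ => tE.
have ht : defect h (elem kl t) <= e / 4.
  apply: hr; apply: nearSL_elem; rewrite /t normrM.
  apply: (@le_lt_trans _ _ (`|s| * b)); first exact: ler_wpM2l.
  move: br; rewrite mulrDl mul1r; lra.
have -> : elem kl s = mulSL (invSL (torus ij a)) (mulSL (elem kl t) (torus ij a)).
  by rewrite -tE mulSLA mulVSL mul1SL.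
rewrite (le_trans (defectM _ _ bh))// defectV//.
have := defectM (elem kl t) (torus ij a) bh.
have := defect_torus a0; lra.
Qed.

(** A root disjoint from [i] and [j] is a commutator of the roots [(k, i)] and [(i, l)], which meet
    [i]; the four factors weigh [2 + 4 + 8 + 8 = 22]. *)
Lemma defect_elem k l (kl : k != l) s : defect h (elem kl s) <= 22 * (60 * eta).
Proof.
have [/(defect_contracted kl s)|] := boolP [|| k == i, k == j, l == i | l == j].
  by move=> /le_trans; apply; rewrite ler_peMl ?mulr_ge0// ler1n.
rewrite !negb_or => /and4P[ki kj li lj].
have il : i != l by rewrite eq_sym.
have -> : elem kl s = mulSL (elem ki s) (mulSL (elem il 1)
    (mulSL (elem ki (- s)) (elem il (- 1)))).
  apply: SLval_inj; apply/matrixP => p q.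
  rewrite !SLval_mul !elem_mulE !mxE.
  have ik : i != k by rewrite eq_sym.
  have lk : l != k by rewrite eq_sym.
  have simp := (eqxx, negbTE li, negbTE il, negbTE ki, negbTE ik, negbTE kl, negbTE lk).
  rewrite ?simp (eq_sym l q) (eq_sym i q).
  have [->|pk] := eqVneq p k; rewrite ?simp.
    by case: (q == l); case: (q == i) => /=; ring.
  by case: (p == i); case: (q == l); case: (q == i) => /=; ring.
have h1 t : defect h (elem ki t) <= 60 * eta.
  by apply: defect_contracted; rewrite eqxx !orbT.
have h2 t : defect h (elem il t) <= 60 * eta.
  by apply: defect_contracted; rewrite eqxx.
rewrite (le_trans (defectM _ _ bh))//.
have := defectM (elem il 1) (mulSL (elem ki (- s)) (elem il (- 1))) bh.
have := defectM (elem ki (- s)) (elem il (- 1)) bh.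
have := h1 s; have := h1 (- s); have := h2 1; have := h2 (- 1); lra.
Qed.

(** With [E] the bound for one letter, a further letter takes a bound [x] to [2 * E + 2 * x]; the
    subtracted [2 * E] lets the estimate reproduce itself. *)
Lemma defect_word n g : elem_word n g ->
  defect h g <= 4 ^+ n * (2 * (22 * (60 * eta))) - 2 * (22 * (60 * eta)).
Proof.
have e0 : 0 <= 22 * (60 * eta) by rewrite !mulr_ge0.
have := defect_elem; move: (22 * (60 * eta)) e0 => E e0 hE.
have p1 m : 1 <= 4 ^+ m :> R by rewrite exprn_ege1// ler1n.
elim=> {n g} [|n g k l kl s _ IH|n g k l kl s _ IH|n g _ IH].
- by rewrite defect1 expr0; lra.
- rewrite (le_trans (defectM _ _ bh))//.
  have := hE _ _ kl s; rewrite exprS.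
  have := ler_wpM2r e0 (p1 n); lra.
- rewrite (le_trans (defectM _ _ bh))//.
  have := hE _ _ kl s; rewrite exprS.
  have := ler_wpM2r e0 (p1 n); lra.
- rewrite exprS; have := ler_wpM2r e0 (p1 n); lra.
Qed.

End elementary_root.

Lemma mautner (i j : 'I_d) (ij : i != j) : exists2 C, 0 < C &
  forall h eta, bounded_ucont h -> (forall s, defect h (elem ij s) <= eta) ->
  forall g, defect h g <= C * eta.
Proof.
have [n nP] := @elem_generation R d.
exists (4 ^+ n * (2 * (22 * 60))); first by rewrite !mulr_gt0 ?exprn_gt0.
move=> h eta bh hij g.
have eta0 : 0 <= eta by exact: le_trans (defect_ge0 h _) (hij 0).
rewrite (le_trans (defect_word bh hij (nP g)))// -!mulrA gerDl oppr_le0.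
by rewrite !mulr_ge0.
Qed.

(** Part of the convex hull of the orbit of [f] under one root group. Midpoints suffice for the
    parallelogram law, and being built one step at a time they can be followed through horospherical
    means by induction. *)
Inductive orbit_average i j (ij : i != j) f : (lattices R d -> R) -> Prop :=
| oa_refl : orbit_average ij f f
| oa_mid h s : orbit_average ij f h ->
    orbit_average ij f (fun x => (h x + h (act_lattices (elem ij s) x)) / 2).

Lemma orbit_average_bounded_ucont i j (ij : i != j) f h : bounded_ucont f ->
  orbit_average ij f h -> bounded_ucont h.
Proof.
move=> bf; elim=> // k s _ bk.
under eq_fun do rewrite mulrC; apply: bounded_ucontZ; apply: bounded_ucontD => //.
exact: bounded_ucont_act.
Qed.

(* An almost norm-minimal average is almost invariant, by the parallelogram law. *)
Lemma almost_invariant_average i j (ij : i != j) f e : bounded_ucont f -> 0 < e ->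
  exists2 h, orbit_average ij f h & forall g, defect h g <= e.
Proof.
move=> bf e0; have [C C0 CP] := mautner ij.
pose N := [set mean mu (fun x => h x ^+ 2) | h in orbit_average ij f].
have N0 : N (mean mu (fun x => f x ^+ 2)) by exists f => //; exact: oa_refl.
have Nlb : has_inf N.
  split; first by eexists; exact: N0.
  by exists 0 => _ [h _ <-]; apply: Rintegral_ge0 => x _; exact: sqr_ge0.
(* The defect along the root is four times the drop of the squared norm from [h] to the midpoint,
   and no midpoint goes below the infimum; [C] is the loss in [mautner]. *)
have eC : 0 < e / C / 4 by rewrite !divr_gt0.
have [_ [h fh <-] hN] := inf_adherent eC Nlb.
have bh := orbit_average_bounded_ucont bf fh.
exists h => // g; rewrite -[leRHS](@divfK _ C) ?gt_eqF// mulrC.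
apply: CP => // s.
have := ge_inf Nlb.2 (ex_intro2 _ _ _ (oa_mid s fh) erefl : N _).
set k := fun x => h (act_lattices (elem ij s) x).
have bk : bounded_ucont k by exact: bounded_ucont_act.
have hk : mean mu (fun x => k x ^+ 2) = mean mu (fun x => h x ^+ 2).
  exact: (mean_act hmu (elem ij s) (bounded_ucont_sqr bh)).
have : defect h (elem ij s) = 2 * mean mu (fun x => h x ^+ 2)
    + 2 * mean mu (fun x => k x ^+ 2) - 4 * mean mu (fun x => ((h x + k x) / 2) ^+ 2).
  have bm : bounded_ucont (fun x => ((h x + k x) / 2) ^+ 2).
    apply: bounded_ucont_sqr; under eq_fun do rewrite mulrC.
    by apply: bounded_ucontZ; exact: bounded_ucontD.
  have bh2 := bounded_ucont_sqr bh; have bk2 := bounded_ucont_sqr bk.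
  rewrite -(meanZ mu 2 bh2) -(meanZ mu 2 bk2) -(meanZ mu 4 bm) -meanD;
    try exact: bounded_ucontZ.
  rewrite -meanB; [|by apply: bounded_ucontD; exact: bounded_ucontZ|exact: bounded_ucontZ].
  by rewrite /defect -/k; congr (mean mu); apply/funext => x; rewrite /k; field.
move=> -> hinf; rewrite hk; lra.
Qed.

End mautner.

(** * Grid means over the cube under maps close to the identity *)

Section grid.
Local Close Scope classical_set_scope.
Local Open Scope set_scope.
Local Open Scope ring_scope.
Context {R : realType} (m n : nat).
Notation K := (m * n)%N.
Notation idx := ('I_m * 'I_n)%type.
Notation mat := 'M[R]_(m, n).

Definition grid_point N (a : {ffun idx -> 'I_N}) : mat :=
  \matrix_(i, j) ((a (i, j))%:R / N%:R).

Definition grid_mean N (H : mat -> R) : R :=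
  (\sum_(a : {ffun idx -> 'I_N}) H (grid_point a)) / (N ^ K)%:R.

Lemma card_idx : #|{: idx}| = K.
Proof. by rewrite card_prod !card_ord. Qed.

Lemma grid_point_norm N (a : {ffun idx -> 'I_N}) : `|grid_point a| <= 1.
Proof.
apply: mx_norm_le => // i j; rewrite mxE ger0_norm ?divr_ge0//.
have N0 : (0 < N)%N by exact: leq_ltn_trans (ltn_ord (a (i, j))).
by rewrite ler_pdivrMr ?ltr0n// mul1r ler_nat ltnW.
Qed.

Lemma card_bounded_diameter N (S : {set 'I_N}) (w : R) : 0 <= w ->
  {in S &, forall s t : 'I_N, s%:R - t%:R <= w} -> #|S|%:R <= w + 1.
Proof.
move=> w0 Sw; have [->|[s0 s0S]] := set_0Vmem S.
  by rewrite cards0 addr_ge0.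
have [t0 t0S t0min] := @arg_minnP _ s0 (mem S) val s0S.
pose f (s : 'I_N) : 'I_(Num.truncn w).+1 := inord (s - t0).
have sf s : s \in S -> (s - t0 < (Num.truncn w).+1)%N.
  move=> sS; rewrite ltnS truncn_ge_nat// natrB; last exact: t0min.
  exact: Sw.
have finj : {in S &, injective f}.
  move=> s t sS tS /(congr1 val); rewrite /= !inordK ?sf// => e.
  by apply: val_inj; rewrite -(subnK (t0min s sS)) e subnK// t0min.
have := @leq_card_in _ _ f S finj; rewrite card_ord -(ler_nat R) => /le_trans; apply.
by rewrite -addn1 natrD lerD2r; have /andP[] := truncn_itv w0.
Qed.

Lemma card_family_le N (F : idx -> {set 'I_N}) (c : R) :
  (forall k, #|F k|%:R <= c) -> #|family (fun k => mem (F k))|%:R <= c ^+ K.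
Proof.
move=> Fc; rewrite card_family -[foldr _ _ _]/(foldr muln 1%N (map _ _)).
rewrite -card_idx cardE; elim: (enum _) => [|k s IH] /=; first by rewrite expr0.
by rewrite natrM exprS ler_pM.
Qed.

(** Multiplied by [N] to avoid the exponent [K - 1]. *)
Lemma card_column N (k : idx) (B : {set 'I_N}) :
  (#|[set a : {ffun idx -> 'I_N} | a k \in B]| * N = #|B| * N ^ K)%N.
Proof.
pose F l := if l == k then mem B else mem [set: 'I_N].
have -> : #|[set a : {ffun idx -> 'I_N} | a k \in B]| = #|family F|.
  suff -> : [set a : {ffun idx -> 'I_N} | a k \in B] = [set a in family F] by rewrite cardsE.
  apply/setP => a.
  rewrite [LHS]inE [RHS]inE; apply/idP/familyP => [aB l|/(_ k)].
    by rewrite /F; case: eqP => [->|_] //; rewrite inE.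
  by rewrite /F eqxx.
rewrite card_family foldrE big_image (bigD1 k)//= /F eqxx.
rewrite (eq_bigr (fun=> N)) => [|l /negbTE->]; last by rewrite cardsT card_ord.
rewrite big_const iter_muln_1 -mulnA -expnSr; congr (_ * N ^ _)%N.
have := cardD1 k {: idx}; rewrite inE add1n card_idx => ->; congr _.+1.
by apply: eq_card => l; rewrite !inE andbT.
Qed.

Section comparison.
Variables (M L : nat) (M0 : (0 < M)%N) (L0 : (0 < L)%N).
Let N := (M * L)%N.
Variables (H : mat -> R) (w : R).
Hypotheses (H0 : forall X, 0 <= H X) (H1 : forall X, H X <= 1).
Hypothesis Hw : forall X Y, `|X - Y| <= M%:R^-1 -> `|H X - H Y| <= w.

Let N0 : (0 < N)%N. Proof. by rewrite muln_gt0 M0. Qed.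
Let Mr0 : (0 : R) < M%:R. Proof. by rewrite ltr0n. Qed.
Let Lr0 : (0 : R) < L%:R. Proof. by rewrite ltr0n. Qed.
Let Nr0 : (0 : R) < N%:R. Proof. by rewrite ltr0n. Qed.
Let NML : N%:R = M%:R * L%:R :> R. Proof. by rewrite /N natrM. Qed.

Let quo_subproof (t : 'I_N) : (t %/ L < M)%N.
Proof. by rewrite ltn_divLR. Qed.

Let quo (a : {ffun idx -> 'I_N}) : {ffun idx -> 'I_M} :=
  [ffun k => Ordinal (quo_subproof (a k))].

Let card_quo b : #|[set a | quo a == b]| = (L ^ K)%N.
Proof.
pose F k := [set t : 'I_N | t %/ L == b k]%N.
have -> : #|[set a | quo a == b]| = #|family (fun k => mem (F k))|.
  suff -> : [set a | quo a == b] = [set a in family (fun k => mem (F k))] by rewrite cardsE.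
  apply/setP => a.
  rewrite [LHS]inE [RHS]inE; apply/eqP/familyP => [e k|h].
    by rewrite /F inE -e ffunE.
  by apply/ffunP => k; rewrite ffunE; apply: val_inj; have := h k; rewrite inE => /eqP.
rewrite card_family foldrE big_image (eq_bigr (fun=> L)) => [|k _].
  by rewrite big_const iter_muln_1 cardT -cardE card_idx.
have bL (r : 'I_L) : (b k * L + r < N)%N.
  rewrite /N (@leq_trans ((b k).+1 * L))//; last by rewrite leq_mul2r ltn_ord orbT.
  by rewrite mulSn addnC ltn_add2r.
have -> : #|F k| = #|[set Ordinal (bL r) | r in 'I_L]|.
  suff -> : F k = [set Ordinal (bL r) | r in 'I_L] by [].
  apply/setP => t.
  rewrite inE; apply/eqP/imsetP => [e|[r _ ->]].
    exists (Ordinal (ltn_pmod t L0)) => //; apply: val_inj.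
    by rewrite /= -e -divn_eq.
  by rewrite /= divnMDl// divn_small ?addn0.
rewrite card_imset ?card_ord// => r s /(congr1 val) /= /addnI e.
exact: val_inj.
Qed.

Let quo_near a : `|grid_point (quo a) - grid_point a| <= M%:R^-1.
Proof.
apply: mx_norm_le => [|i j]; first by rewrite invr_ge0 ltW.
rewrite !mxE ffunE /=; set t := a (i, j).
have tN : t%:R / N%:R = (t %/ L)%:R / M%:R + (t %% L)%:R / N%:R :> R.
  rewrite {1}(divn_eq t L) natrD natrM mulrDl NML; congr (_ + _).
  by field; rewrite !gt_eqF.
rewrite tN opprD addNKr normrN ger0_norm ?divr_ge0// ler_pdivrMr// NML.
by rewrite mulKf ?gt_eqF// ler_nat ltnW// ltn_mod.
Qed.

Let coarse : (\sum_(b : {ffun idx -> 'I_M}) (H (grid_point b) + w)) * (L ^ K)%:R <=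
  \sum_(a : {ffun idx -> 'I_N}) (H (grid_point a) + 2 * w).
Proof.
rewrite mulr_suml [leRHS](partition_big quo xpredT)//=.
apply: ler_sum => b _; rewrite -(card_quo b) mulr_natr -sumr_const.
rewrite [leLHS](eq_bigl (fun a => quo a == b)) => [|a]; last by rewrite inE.
apply: ler_sum => a /eqP <-.
have := Hw (quo_near a); rewrite ler_norml => /andP[_]; lra.
Qed.

Variables (phi : mat -> mat) (e : R) (e0 : 0 <= e).
Hypothesis phi_expand : forall X Y, `|X| <= 1 -> `|Y| <= 1 ->
  `|X - Y| <= (1 + e) * `|phi X - phi Y|.
Hypothesis phi_near : forall X, `|X| <= 1 -> `|phi X - X| <= e.

Let inside (a : {ffun idx -> 'I_N}) :=
  [forall k : idx, 0 <= phi (grid_point a) k.1 k.2 < 1].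

Let w0 : 0 <= w.
Proof. by apply: le_trans (normr_ge0 _) (Hw (X := 0) (Y := 0) _); rewrite subrr normr0 invr_ge0 ltW. Qed.

(** The value 0 outside [[0, 1)] only makes [cell] total; it is read at images of points satisfying
    [inside]. *)
Let cell_subproof (X : mat) k :
  ((if (0 <= X k.1 k.2 < 1)%R then Num.truncn (M%:R * X k.1 k.2)%R else 0%N) < M)%N.
Proof.
case: ifP => [/andP[X0 X1]|//]; rewrite truncn_lt_nat ?mulr_ge0//.
by rewrite -[ltRHS]mulr1 ltr_pM2l.
Qed.
Let cell (X : mat) : {ffun idx -> 'I_M} := [ffun k => Ordinal (cell_subproof X k)].

Let cell_near a : inside a ->
  `|phi (grid_point a) - grid_point (cell (phi (grid_point a)))| <= M%:R^-1 /\
  forall i j, 0 <= phi (grid_point a) i j -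
    (cell (phi (grid_point a)) (i, j))%:R / M%:R < M%:R^-1.
Proof.
move=> /forallP ia; set X := phi _.
have h i j : 0 <= X i j - (cell X (i, j))%:R / M%:R < M%:R^-1.
  have Xij := ia (i, j); rewrite ffunE /= Xij.
  move: Xij => /= /andP[X0 _].
  have /truncn_itv/andP[] : 0 <= M%:R * X i j by rewrite mulr_ge0.
  set t := Num.truncn _ => t1 t2.
  rewrite subr_ge0 ler_pdivrMr// mulrC t1 /= ltrBlDl -[X in _ + X]mul1r -mulrDl.
  by rewrite ltr_pdivlMr// mulrC natr1.
split=> //; apply: mx_norm_le => [|i j]; first by rewrite invr_ge0 ltW.
by rewrite !mxE; have /andP[h0 h1] := h i j; rewrite ger0_norm// ltW.
Qed.

(** Fine points whose images share a coarse cell have images within [1/M], so by [phi_expand] each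
    coordinate ranges over at most [(1 + e) * L + 1] consecutive indices. *)
Let class_card b :
  #|[set a | inside a & cell (phi (grid_point a)) == b]|%:R <= ((1 + e) * L%:R + 1) ^+ K.
Proof.
set C := [set a | _ & _].
pose F k := [set a k | a : {ffun idx -> 'I_N} in C].
apply: (@le_trans _ _ #|family (fun k => mem (F k))|%:R).
  rewrite ler_nat; apply: subset_leq_card; apply/fintype.subsetP => a aC; apply/familyP => k.
  exact: imset_f.
apply: card_family_le => k.
apply: card_bounded_diameter => [|_ _ /imsetP[a aC ->] /imsetP[a' a'C ->]].
  by rewrite mulr_ge0 ?addr_ge0.
move: aC a'C; rewrite !inE => /andP[ia /eqP ca] /andP[ia' /eqP ca'].
have [_ ha] := cell_near ia; have [_ ha'] := cell_near ia'.
have pp : `|phi (grid_point a) - phi (grid_point a')| <= M%:R^-1.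
  apply: mx_norm_le => [|i j]; first by rewrite invr_ge0 ltW.
  move: (ha i j) (ha' i j); rewrite ca ca' !mxE ler_norml => /andP[? ?] /andP[? ?].
  by apply/andP; split; lra.
have := phi_expand (grid_point_norm a) (grid_point_norm a').
move=> /(le_trans (mx_entry_norm _ k.1 k.2)); rewrite !mxE.
case: k => i j /= /(le_trans (ler_norm _)).
move=> /le_trans/(_ (ler_wpM2l (addr_ge0 ler01 e0) pp)).
rewrite -mulrBl ler_pdivrMr// NML => /le_trans; apply.
by rewrite -mulrA mulKf ?gt_eqF.
Qed.

(** As [phi] moves points by at most [e], a point sent outside has a coordinate within [e] of 0 or
    1; such indices make up at most [2 * e + 2 / N] of each of the [K] columns. *)
Let outside_card : #|[set a | ~~ inside a]|%:R <= K%:R * (2 * e + 2 / N%:R) * (N ^ K)%:R.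
Proof.
pose B := [set t : 'I_N | (t%:R / N%:R < e) || (1 - e <= t%:R / N%:R)].
have cB : #|B|%:R <= (2 * e + 2 / N%:R) * N%:R.
  have -> : (2 * e + 2 / N%:R) * N%:R = (e * N%:R + 1) + (e * N%:R + 1) :> R.
    by field; rewrite gt_eqF.
  pose B1 := [set t : 'I_N | t%:R / N%:R < e].
  pose B2 := [set t : 'I_N | 1 - e <= t%:R / N%:R].
  have -> : B = B1 :|: B2 by apply/setP => t; rewrite !inE.
  rewrite (@le_trans _ _ (#|B1|%:R + #|B2|%:R))//.
    by rewrite -natrD ler_nat cardsU leq_subr.
  have eN : 0 <= e * N%:R by rewrite mulr_ge0// ltW.
  rewrite lerD// card_bounded_diameter// => s t; rewrite !inE.
    rewrite !ltr_pdivrMr// => s1 _; have := ler0n R t; have := ltW s1; lra.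
  rewrite !ler_pdivlMr// => _; have : s%:R <= N%:R :> R by rewrite ler_nat ltnW.
  lra.
pose Bk k := [set a : {ffun idx -> 'I_N} | a k \in B].
have sub : [set a | ~~ inside a] \subset \bigcup_k Bk k.
  apply/fintype.subsetP => a; rewrite inE => /forallPn[[i j] /= nij].
  apply/bigcupP; exists (i, j) => //; rewrite !inE.
  have := le_trans (mx_entry_norm _ i j) (phi_near (grid_point_norm a)).
  rewrite !mxE ler_norml => /andP[p1 p2].
  move: nij; rewrite negb_and -ltNge -leNgt => /orP[q|q]; apply/orP; [left|right]; lra.
apply: (@le_trans _ _ (\sum_k #|Bk k|)%:R).
  rewrite ler_nat (leq_trans (subset_leq_card sub))//.
  elim/big_rec2 : _ => [|k s t _ IH]; first by rewrite cards0.
  by rewrite cardsU (leq_trans (leq_subr _ _))// leq_add2l.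
rewrite natr_sum -mulrA -card_idx mulr_natl -sumr_const; apply: ler_sum => k _.
rewrite -(@ler_pM2r _ N%:R)// -natrM card_column natrM card_idx.
rewrite mulrAC ler_wpM2r//; exact: cB.
Qed.

(** A change of variables with the Jacobian replaced by counting: fine points are sorted by the
    coarse cell of their image, and each class is hardly larger than the [L ^ K] fine points of a
    cell. [H] varies by [w] from the image to the corner of its cell, and again from that corner to
    the fine points of the cell. *)
Lemma grid_sum_change : \sum_(a : {ffun idx -> 'I_N}) H (phi (grid_point a)) <=
  (1 + e + L%:R^-1) ^+ K * \sum_(a : {ffun idx -> 'I_N}) (H (grid_point a) + 2 * w)
  + K%:R * (2 * e + 2 / N%:R) * (N ^ K)%:R.
Proof.
rewrite (bigID inside)/=; apply: lerD; last first.
  apply: le_trans outside_card; rewrite -sum1_card natr_sum.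
  rewrite [leRHS](eq_bigl (fun a => ~~ inside a)) => [|a]; last by rewrite inE.
  by apply: ler_sum.
apply: le_trans (_ : (1 + e + L%:R^-1) ^+ K * ((\sum_(b : {ffun idx -> 'I_M})
    (H (grid_point b) + w)) * (L ^ K)%:R) <= _); last first.
  by rewrite ler_wpM2l// exprn_ge0// !addr_ge0// invr_ge0.
rewrite mulrCA natrX -exprMn mulrDl mulVf ?gt_eqF// mulr_suml.
rewrite [leLHS](partition_big (fun a => cell (phi (grid_point a))) xpredT)//=.
apply: ler_sum => b _.
apply: (@le_trans _ _ (#|[set a | inside a & cell (phi (grid_point a)) == b]|%:R * (H (grid_point b) + w))); last first.
  by rewrite mulrC ler_wpM2l ?addr_ge0// class_card.
rewrite mulrC mulr_natr -sumr_const.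
rewrite [leRHS](eq_bigl (fun a => inside a && (cell (phi (grid_point a)) == b))) => [|a];
  last by rewrite inE.
apply: ler_sum => a /andP[ia /eqP <-].
have [/Hw + _] := cell_near ia; rewrite ler_norml => /andP[_]; lra.
Qed.

End comparison.

Lemma grid_mean_change (eps : R) : 0 < eps -> exists2 e, 0 < e &
  forall M, (0 < M)%N -> exists2 N0, (0 < N0)%N &
  forall N, (0 < N)%N -> (N0 %| N)%N ->
  forall (H : mat -> R) (phi : mat -> mat),
  (forall X, 0 <= H X) -> (forall X, H X <= 1) ->
  (forall X Y, `|X - Y| <= M%:R^-1 -> `|H X - H Y| <= e) ->
  (forall X Y, `|X| <= 1 -> `|Y| <= 1 -> `|X - Y| <= (1 + e) * `|phi X - phi Y|) ->
  (forall X, `|X| <= 1 -> `|phi X - X| <= e) ->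
  grid_mean N (fun X => H (phi X)) <= grid_mean N H + eps.
Proof.
(* [D * e] dominates the three errors of [grid_sum_change]: the power close to 1, the modulus of
   [H], and the points leaving the cube. *)
move=> eps0; pose D : R := 6 * 3 ^+ K + 2 + 4 * K%:R.
have D0 : 0 < D.
  have : 0 < 3 ^+ K :> R by rewrite exprn_gt0.
  by have := ler0n R K; rewrite /D; lra.
have pow_le (x : R) k : 0 <= x -> x <= 1 -> (1 + x) ^+ k <= 1 + 3 ^+ k * x.
  move=> x0 x1; elim: k => [|k IH]; first by rewrite !expr0 mul1r lerDl.
  have p1 : 1 <= 3 ^+ k :> R by rewrite exprn_ege1// ler1n.
  rewrite !exprS mulrC; apply: le_trans (_ : (1 + 3 ^+ k * x) * (1 + x) <= _).
    by rewrite ler_wpM2r// addr_ge0.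
  have := ler_wpM2r x0 p1; have := ler_wpM2l (mulr_ge0 (le_trans ler01 p1) x0) x1; lra.
pose e := Num.min (eps / D) (1 / 2).
have e0 : 0 < e by rewrite lt_min !divr_gt0.
exists e => // M M0; have [L L0 Le] : exists2 L, (0 < L)%N & L%:R^-1 <= e.
  exists (Num.bound e^-1).+1 => //; rewrite invf_ple ?posrE//.
  by rewrite (le_trans (ltW (archi_boundP _)))// ?invr_ge0 ?(ltW e0)// ler_nat.
exists (M * L)%N; first by rewrite muln_gt0 M0.
move=> N N0 /dvdnP[q Nq] H phi H0 H1 HM p1 p2.
have q0 : (0 < q)%N by move: N0; rewrite Nq; case: q {Nq}.
have {Nq}NE : N = (M * (q * L))%N by rewrite Nq mulnCA mulnA.
have qL0 : (0 < q * L)%N by rewrite muln_gt0 q0.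
have Nk0 : (0 : R) < (N ^ K)%:R by rewrite ltr0n expn_gt0 N0.
rewrite /grid_mean ler_pdivrMr// mulrDl divfK ?gt_eqF//.
have := @grid_sum_change M (q * L)%N M0 qL0 H e H0 H1 HM phi e (ltW e0) p1 p2.
rewrite -NE => /le_trans; apply.
set S := \sum_(a : {ffun idx -> 'I_N}) H _.
have S0 : 0 <= S by apply: sumr_ge0.
have SN : S <= (N ^ K)%:R.
  rewrite /S (le_trans (ler_sum _ (fun a _ => H1 _)))//.
  by rewrite sumr_const card_ffun card_ord card_idx.
have -> : \sum_(a : {ffun idx -> 'I_N}) (H (grid_point a) + 2 * e) = S + 2 * e * (N ^ K)%:R.
  by rewrite big_split /= sumr_const card_ffun card_ord card_idx mulr_natr.
move: Nk0 SN; move: (N ^ K)%:R => W W0 SW.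
have qLe : (q * L)%:R^-1 <= e.
  rewrite (le_trans _ Le)// lef_pV2 ?posrE ?ltr0n// ler_nat.
  by rewrite -[leqLHS]mul1n leq_mul2r q0 orbT.
have Ne : N%:R^-1 <= e.
  rewrite (le_trans _ qLe)// lef_pV2 ?posrE ?ltr0n// ler_nat NE.
  by rewrite -[leqLHS]mul1n leq_mul2r M0 orbT.
have e12 : e <= 1 / 2 by rewrite ge_min lexx orbT.
have pw : (1 + e + (q * L)%:R^-1) ^+ K <= 1 + 3 ^+ K * (2 * e).
  apply: le_trans (_ : (1 + 2 * e) ^+ K <= _); last by apply: pow_le; lra.
  rewrite lerXn2r ?nnegrE ?addr_ge0 ?invr_ge0 ?mulr_ge0 ?(ltW e0)//; lra.
have De : D * e <= eps by rewrite mulrC -ler_pdivlMr// ge_min lexx.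
have t1 : (1 + e + (q * L)%:R^-1) ^+ K * (S + 2 * e * W) <= (1 + 3 ^+ K * (2 * e)) * (S + 2 * e * W).
  by rewrite ler_wpM2r// addr_ge0// !mulr_ge0 ?(ltW e0) ?(ltW W0).
have t2 : K%:R * (2 * e + 2 / N%:R) * W <= K%:R * (4 * e) * W.
  rewrite ler_wpM2r ?(ltW W0)// ler_wpM2l//; lra.
apply: le_trans (lerD t1 t2) _.
have P0 : 0 <= 3 ^+ K * e :> R by rewrite mulr_ge0 ?exprn_ge0// ltW.
have : 3 ^+ K * e * (S + 2 * e * W) <= 3 ^+ K * e * (2 * W).
  rewrite ler_wpM2l//; have := ler_wpM2r (ltW W0) e12; lra.
have : D * e * W <= eps * W by rewrite ler_wpM2r// ltW.
rewrite /D; have : 0 <= 3 ^+ K * e * W by rewrite mulr_ge0// ltW.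
lra.
Qed.

End grid.

(** * Matrices of the expanding horosphere and multiplication on their right *)

Lemma SL_divE {R : realType} {d : nat} (g h : SL R d) (A : 'M[R]_d) :
  A *m (h : 'M[R]_d) = g -> (mulSL g (invSL h) : 'M[R]_d) = A.
Proof. by move=> Ah; rewrite SLval_mul -Ah mulmxK// unitSL. Qed.

Section horospherical.
Context {R : realType} {m n : nat}.
Notation mat := 'M[R]_(m, n).
Implicit Types (X Y : mat) (g : SL R (n + m)).

Section one_scale.
Variables (al be : R) (al0 : 0 < al) (be0 : 0 < be) (albe : al ^+ n * be ^+ m = 1).

Lemma det_horo X : \det (block_mx al%:M 0 (be *: X) be%:M : 'M[R]_(n + m)) = 1.
Proof. by rewrite det_lblock !det_scalar. Qed.

Definition horo X : SL R (n + m) := mkSL (det_horo X).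

Lemma horoE X : horo X = block_mx al%:M 0 (be *: X) be%:M :> 'M[R]_(n + m).
Proof. by []. Qed.

Lemma block_near1 (A : 'M[R]_n) (B : 'M[R]_(n, m)) (C : 'M[R]_(m, n)) (D : 'M[R]_m) r :
  0 <= r -> `|A - 1%:M| <= r -> `|B| <= r -> `|C| <= r -> `|D - 1%:M| <= r ->
  `|block_mx A B C D - 1%:M : 'M[R]_(n + m)| <= r.
Proof.
move=> r0 Ar Br Cr Dr; rewrite scalar_mx_block opp_block_mx add_block_mx !subr0.
apply: mx_norm_le => // i j.
case: (split_ordP i) => k ->; case: (split_ordP j) => l ->.
- by rewrite block_mxEul (le_trans (mx_entry_norm _ _ _)).
- by rewrite block_mxEur (le_trans (mx_entry_norm _ _ _)).
- by rewrite block_mxEdl (le_trans (mx_entry_norm _ _ _)).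
- by rewrite block_mxEdr (le_trans (mx_entry_norm _ _ _)).
Qed.

Lemma horo_div_near X Y r : 0 < r -> be / al * `|X - Y| < r ->
  nearSL r (mulSL (horo X) (invSL (horo Y))).
Proof.
move=> r0 XYr; rewrite /nearSL.
rewrite (@SL_divE _ _ _ _ (block_mx 1%:M 0 ((be / al) *: (X - Y)) 1%:M)).
  apply: le_lt_trans XYr; apply: block_near1.
  - by rewrite mulr_ge0// divr_ge0// ltW.
  - by rewrite subrr normr0 mulr_ge0// divr_ge0// ltW.
  - by rewrite normr0 mulr_ge0// divr_ge0// ltW.
  - by rewrite mx_normZ ger0_norm// divr_ge0// ltW.
  - by rewrite subrr normr0 mulr_ge0// divr_ge0// ltW.
rewrite !horoE mulmx_block !mul0mx !mulmx0 !mul1mx !addr0 !add0r.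
rewrite mul_mx_scalar scalerA mulrC divfK ?gt_eqF// -scalerDr subrK //.
Qed.

(** Both sides are [horo] at [X] with its entry [(i, j)] shifted by [al / be * y]. As a right factor
    the shift acts on the starting lattice, where equicontinuity applies. *)
Lemma elem_horo (i : 'I_m) (j : 'I_n) (ij : rshift n i != lshift m j) y X :
  mulSL (elem ij y) (horo X) = mulSL (horo X) (elem ij (al / be * y)).
Proof.
apply: SLval_inj; apply/matrixP => k l.
rewrite (SLval_mul (elem ij y)) (SLval_mul (horo X)) elem_mulE mul_elemE.
congr (_ + _); rewrite !horoE.
have -> : block_mx al%:M 0 (be *: X) be%:M (lshift m j) l = al * (l == lshift m j)%:R.
  case: (split_ordP l) => p ->; last by rewrite block_mxEur mxE eq_rlshift mulr0.
  by rewrite block_mxEul mxE eq_lshift eq_sym; case: (p == j); rewrite ?mulr1 ?mulr0.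
have -> : block_mx al%:M 0 (be *: X) be%:M k (rshift n i) = be * (k == rshift n i)%:R.
  case: (split_ordP k) => p ->; first by rewrite block_mxEur mxE eq_lrshift mulr0.
  by rewrite block_mxEdr mxE eq_rshift; case: (p == i); rewrite ?mulr1 ?mulr0.
by case: (l == _); case: (k == _); rewrite /=; field; rewrite gt_eqF.
Qed.

End one_scale.

(* [horo X * g = z * horo (mobius g X)] with [z] not expanded by the flow. *)
Definition mobius g X : mat :=
  invmx (X *m ursubmx (g : 'M[R]_(n + m)) + drsubmx (g : 'M[R]_(n + m))) *m
  (X *m ulsubmx (g : 'M[R]_(n + m)) + dlsubmx (g : 'M[R]_(n + m))).

Section near_identity.
Variables (e r : R) (e0 : 0 < e) (e1 : e <= 1) (r0 : 0 < r).
Let k : R := (m + n).+1%:R.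
(** Each matrix product costs a factor [k], and at most three occur in a row. The number 24 makes
    the error [8 * k ^+ 3 * rho] in [mobius_expand] at most [e / 3]. *)
Let s := Num.min e r / (24 * k ^+ 3).
Variables (g : SL R (n + m)) (gs : nearSL s g).

Let rho := `|(g : 'M[R]_(n + m)) - 1%:M|.
Let a := ulsubmx (g : 'M[R]_(n + m)).
Let b := ursubmx (g : 'M[R]_(n + m)).
Let c := dlsubmx (g : 'M[R]_(n + m)).
Let dd := drsubmx (g : 'M[R]_(n + m)).

Let k1 : 1 <= k. Proof. by rewrite ler1n. Qed.
Let mk : m%:R <= k. Proof. by rewrite ler_nat leqW// leq_addr. Qed.
Let nk1 : n%:R + 1 <= k. Proof. by rewrite natr1 ler_nat ltnS leq_addl. Qed.
Let nk : n%:R <= k. Proof. by rewrite ler_nat leqW// leq_addl. Qed.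
Let rho0 : 0 <= rho. Proof. exact: normr_ge0. Qed.

Let krho3 : 24 * (k ^+ 3 * rho) <= Num.min e r.
Proof.
have := ltW gs; rewrite /s ler_pdivlMr; last by rewrite mulr_gt0// exprn_gt0.
rewrite -/rho; lra.
Qed.
Let k3e : 24 * (k ^+ 3 * rho) <= e.
Proof. by rewrite (le_trans krho3)// ge_min lexx. Qed.
Let k3r : 24 * (k ^+ 3 * rho) <= r.
Proof. by rewrite (le_trans krho3)// ge_min lexx orbT. Qed.
Let k2le : k ^+ 2 * rho <= k ^+ 3 * rho.
Proof. by rewrite ler_wpM2r// ler_weXn2l. Qed.
Let k1le : k * rho <= k ^+ 2 * rho.
Proof. by rewrite ler_wpM2r// expr2 ler_peMr// ltW. Qed.
Let k3ge : 0 <= k ^+ 3 * rho. Proof. by rewrite mulr_ge0// exprn_ge0// ltW. Qed.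

Let gE : (g : 'M[R]_(n + m)) = block_mx a b c dd.
Proof. by rewrite submxK. Qed.

Let gB i j : `|(g : 'M[R]_(n + m)) i j - (i == j)%:R| <= rho.
Proof. by have := mx_entry_norm ((g : 'M[R]_(n + m)) - 1%:M) i j; rewrite !mxE. Qed.

Let a_near : `|a - 1%:M| <= rho.
Proof.
apply: mx_norm_le => // i j; rewrite !mxE.
by have := gB (lshift m i) (lshift m j); rewrite eq_lshift.
Qed.
Let b_small : `|b| <= rho.
Proof.
apply: mx_norm_le => // i j; rewrite !mxE.
by have := gB (lshift m i) (rshift n j); rewrite eq_lrshift subr0.
Qed.
Let c_small : `|c| <= rho.
Proof.
apply: mx_norm_le => // i j; rewrite !mxE.
by have := gB (rshift n i) (lshift m j); rewrite eq_rlshift subr0.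
Qed.
Let d_near : `|dd - 1%:M| <= rho.
Proof.
apply: mx_norm_le => // i j; rewrite !mxE.
by have := gB (rshift n i) (rshift n j); rewrite eq_rshift.
Qed.

Let mul_le p q l (A : 'M[R]_(p, q)) (B : 'M[R]_(q, l)) x y :
  q%:R <= k -> `|A| <= x -> `|B| <= y -> `|A *m B| <= k * x * y.
Proof.
move=> qk Ax By; rewrite (le_trans (mx_norm_mul _ _))//.
by rewrite ler_pM ?mulr_ge0// ler_pM.
Qed.

Let D X := X *m b + dd.

Let D_near X : `|X| <= 1 -> `|D X - 1%:M| <= k * rho.
Proof.
move=> X1; rewrite /D -addrA (le_trans (ler_normD _ _))//.
have : `|X *m b| <= n%:R * rho.
  rewrite (le_trans (mx_norm_mul _ _))// -mulrA ler_wpM2l//.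
  by rewrite -[leRHS]mul1r ler_pM.
have := ler_wpM2r rho0 nk1; rewrite mulrDl mul1r; have := d_near; lra.
Qed.

Let D_inv X : `|X| <= 1 -> [/\ D X \in unitmx, `|invmx (D X)| <= 2 &
  `|invmx (D X) - 1%:M| <= 2 * (k ^+ 2 * rho)].
Proof.
move=> X1.
have mkr : m%:R * (k * rho) <= k ^+ 2 * rho.
  by rewrite expr2 -mulrA ler_wpM2r// mulr_ge0// ltW.
have [|u j2 j1] := near1_inverse (D_near X1).
  apply: le_trans mkr _; apply: le_trans k2le _; move: k3e.
  by move: (k ^+ 3 * rho) => z zk; move: e1; lra.
split=> //; rewrite (le_trans j1)// -mulrA ler_wpM2l//.
Qed.

Let mobiusP X : `|X| <= 1 -> D X *m mobius g X = X *m a + c.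
Proof. by move=> /D_inv[u _ _]; rewrite /mobius mulKVmx. Qed.

Lemma mobius_near X : `|X| <= 1 -> `|mobius g X - X| <= e.
Proof.
move=> X1; have [u j2 _] := D_inv X1.
have -> : mobius g X - X = invmx (D X) *m (X *m (a - 1%:M) + c - (D X - 1%:M) *m X).
  rewrite -[X in _ - X = _](mulKmx u) -mulmxBr; congr (_ *m _).
  rewrite mulmxBr mulmxBl mulmx1 mul1mx -/(D X); move: (X *m a) (D X *m X) => P Q.
  by apply/matrixP => i j; rewrite !mxE; ring.
have h1 : `|X *m (a - 1%:M)| <= k * 1 * rho by exact: mul_le.
have h2 : `|(D X - 1%:M) *m X| <= k * (k * rho) * 1 by apply: mul_le => //; exact: D_near.
have h3 : `|X *m (a - 1%:M) + c - (D X - 1%:M) *m X| <= 3 * (k ^+ 2 * rho).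
  rewrite (le_trans (ler_normB _ _))//.
  have := ler_normD (X *m (a - 1%:M)) c.
  have rk : rho <= k * rho by rewrite ler_peMl.
  have := k1le; have -> : k ^+ 2 * rho = k * (k * rho) by rewrite expr2 mulrA.
  have := c_small; lra.
rewrite (le_trans (mul_le mk j2 h3))//.
have -> : k * 2 * (3 * (k ^+ 2 * rho)) = 6 * (k ^+ 3 * rho) by rewrite !exprS; ring.
have := k3e; have := k3ge; lra.
Qed.

Let mobius_norm X : `|X| <= 1 -> `|mobius g X| <= 2.
Proof.
move=> X1; rewrite -(subrK X (mobius g X)) (le_trans (ler_normD _ _))//.
have := mobius_near X1; have := e1; lra.
Qed.

Let A_near X : `|X| <= 1 -> `|a - b *m mobius g X - 1%:M| <= 3 * (k * rho).
Proof.
move=> X1; rewrite addrAC (le_trans (ler_normB _ _))//.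
have := mul_le mk b_small (mobius_norm X1).
have rk : rho <= k * rho by rewrite ler_peMl.
have := a_near; lra.
Qed.

(** The identity [D X *m (mobius g X - mobius g Y) = (X - Y) *m A] has both [D X] and [A] near 1.
    Solving for [U = X - Y] gives [|U| <= |V| + (e / 3) * |U|], with [V] the difference of images,
    and [e <= 1] turns this into the factor [1 + e]. *)
Lemma mobius_expand X Y : `|X| <= 1 -> `|Y| <= 1 ->
  `|X - Y| <= (1 + e) * `|mobius g X - mobius g Y|.
Proof.
move=> X1 Y1; have [u j2 j1] := D_inv X1.
set U := X - Y; set A := a - b *m mobius g Y.
have VE : mobius g X - mobius g Y = invmx (D X) *m (U *m A).
  rewrite -[LHS](mulKmx u); congr (_ *m _); rewrite mulmxBr mobiusP//.
  have := mobiusP Y1; rewrite /U /A; move: (mobius g Y) => W.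
  rewrite /D !(mulmxDl, mulmxDr, mulmxN, mulNmx) !mulmxA.
  move: (X *m a) (Y *m a) (X *m b *m W) (Y *m b *m W) (dd *m W) => P P' Q Q' S QS.
  have -> : S = P' + c - Q' by rewrite -QS addrAC subrr add0r.
  by apply/matrixP => i j; rewrite !mxE; ring.
have h1 : `|U *m (A - 1%:M)| <= k * `|U| * (3 * (k * rho)).
  by apply: mul_le => //; exact: A_near.
have h2 : `|invmx (D X) *m (U *m (A - 1%:M))| <= k * 2 * (k * `|U| * (3 * (k * rho))).
  exact: mul_le.
have h3 : `|(invmx (D X) - 1%:M) *m U| <= k * (2 * (k ^+ 2 * rho)) * `|U|.
  exact: mul_le.
have UE : U = (mobius g X - mobius g Y) - invmx (D X) *m (U *m (A - 1%:M))
    - (invmx (D X) - 1%:M) *m U.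
  rewrite VE (mulmxBr U A 1%:M) mulmx1 (mulmxBr (invmx (D X)) (U *m A) U).
  rewrite (mulmxBl (invmx (D X)) 1%:M U) mul1mx.
  move: (invmx (D X) *m _) (invmx (D X) *m U) => P Q.
  by apply/matrixP => i j; rewrite !mxE; ring.
have := ler_normB (mobius g X - mobius g Y - invmx (D X) *m (U *m (A - 1%:M)))
  ((invmx (D X) - 1%:M) *m U).
rewrite -UE.
have := ler_normB (mobius g X - mobius g Y) (invmx (D X) *m (U *m (A - 1%:M))).
have E2 : k * 2 * (k * `|U| * (3 * (k * rho))) = 6 * (k ^+ 3 * rho) * `|U|.
  by rewrite !exprS; ring.
have E3 : k * (2 * (k ^+ 2 * rho)) * `|U| = 2 * (k ^+ 3 * rho) * `|U|.
  by rewrite !exprS; ring.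
rewrite E2 in h2; rewrite E3 in h3.
set V := `|mobius g X - _| => g1 g2.
have hU : `|U| <= V + 8 * (k ^+ 3 * rho) * `|U| by lra.
have U0 : 0 <= `|U| by [].
have V0 : 0 <= V by exact: normr_ge0.
clear g1 g2 UE; move: k3e hU U0 V0; move: (k ^+ 3 * rho) `|U| V e0 e1 => z u' v e_gt0 e_le1 ze uv u0 v0.
have zu := ler_wpM2r u0 ze.
have euv := ler_wpM2l (ltW e_gt0) uv.
have ezu := ler_wpM2l (ltW e_gt0) zu.
have eu0 := mulr_ge0 (ltW e_gt0) u0.
have eeu := ler_wpM2r eu0 e_le1.
lra.
Qed.

(** The left factor is explicit: [mobius] is chosen to make its lower left block vanish, its
    diagonal blocks are near 1 whatever the scale, and its upper right block carries the factor
    [al / be <= 1]. *)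
Lemma horo_mobius_near (al be : R) (al0 : 0 < al) (albe : al ^+ n * be ^+ m = 1) X :
  al <= be -> `|X| <= 1 ->
  nearSL r (mulSL (mulSL (horo albe X) g) (invSL (horo albe (mobius g X)))).
Proof.
move=> ab X1; have be0 : 0 < be by exact: lt_le_trans ab.
have [u _ _] := D_inv X1.
rewrite /nearSL (@SL_divE _ _ _ _ (block_mx (a - b *m mobius g X) ((al / be) *: b) 0 (D X))).
  apply: (@le_lt_trans _ _ (4 * (k * rho))).
    have kr : 0 <= k * rho by rewrite mulr_ge0// ltW.
    apply: block_near1; rewrite ?normr0//.
    - by rewrite mulr_ge0.
    - have := A_near X1; lra.
    - have rk : rho <= k * rho by rewrite ler_peMl.
      have ab0 : 0 <= al / be by rewrite divr_ge0 ?(ltW al0) ?(ltW be0).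
      have ab1 : al / be <= 1 by rewrite ler_pdivrMr// mul1r.
      rewrite mx_normZ ger0_norm//; have := ler_pM ab0 (normr_ge0 b) ab1 b_small; lra.
    - by rewrite mulr_ge0.
    - have := D_near X1; lra.
  have [/eqP kr|kr] := boolP (k * rho == 0); first by rewrite kr mulr0.
  have : 0 < k * rho by rewrite lt0r kr mulr_ge0// ltW.
  have := k1le; have := k2le; have := k3r; lra.
rewrite !horoE SLval_mul horoE gE !mulmx_block.
rewrite !mul0mx !addr0 !mul_scalar_mx !mul_mx_scalar add0r.
congr block_mx.
- rewrite -scalemxAr -scalemxAl !scalerA mulrC divfK ?gt_eqF//.
  by rewrite -scalerDr subrK.
- by rewrite scalerA mulrC divfK ?gt_eqF// mulmx0 add0r.
- by rewrite -scalemxAr -scalemxAl -scalerDr mobiusP.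
- by rewrite add0r -scalemxAl -scalerDr.
Qed.

End near_identity.
End horospherical.

(** * Horospherical means and their equidistribution *)

(** Large [N] is understood in the sense of divisibility, because a grid must refine the coarse grid
    it is compared with; two such conditions can still be met together. *)
Definition eventually_dvd (P : nat -> Prop) :=
  exists2 N0, (0 < N0)%N & forall N, (0 < N)%N -> (N0 %| N)%N -> P N.

Lemma eventually_dvdI (P Q : nat -> Prop) :
  eventually_dvd P -> eventually_dvd Q -> eventually_dvd (fun N => P N /\ Q N).
Proof.
move=> [a a0 aP] [b b0 bQ]; exists (a * b)%N; first by rewrite muln_gt0 a0.
move=> N N0 abN; split; [apply: aP => //|apply: bQ => //].
  exact: dvdn_trans (dvdn_mulr _ _) abN.
exact: dvdn_trans (dvdn_mull _ _) abN.
Qed.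

Lemma eventually_dvdS (P Q : nat -> Prop) : (forall N, (0 < N)%N -> P N -> Q N) ->
  eventually_dvd P -> eventually_dvd Q.
Proof. by move=> PQ [a a0 aP]; exists a => // N N0 /(aP N N0)/(PQ N N0). Qed.

(** Cauchy-Schwarz, read off from the sum of the squares of [#|I| * u i - S], with [S] the sum. *)
Lemma sqr_sum_le {R : realType} (I : finType) (u : I -> R) :
  (\sum_i u i) ^+ 2 <= #|I|%:R * \sum_i u i ^+ 2.
Proof.
have [W0|W0] := eqVneq #|I| 0%N.
  by rewrite !big1 ?expr0n ?mulr0// => i; have := card0_eq W0 i.
have Wp : (0 : R) < #|I|%:R by rewrite ltr0n lt0n.
set S := \sum_i u i; set Q := \sum_i _.
have : 0 <= \sum_i (#|I|%:R * u i - S) ^+ 2 by apply: sumr_ge0 => i _; exact: sqr_ge0.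
have -> : \sum_i (#|I|%:R * u i - S) ^+ 2 = #|I|%:R * (#|I|%:R * Q - S ^+ 2).
  rewrite (eq_bigr (fun i => #|I|%:R ^+ 2 * u i ^+ 2 - 2 * #|I|%:R * S * u i + S ^+ 2)) => [|i _].
    rewrite big_split /= sumrB -!mulr_sumr sumr_const -/S -/Q -mulr_natl; ring.
  by ring.
by rewrite pmulr_rge0// subr_ge0.
Qed.

Section horospherical_mean.
Context {R : realType} {m n : nat}.
Notation X := (lattices R (n + m)).
Implicit Types (f h : X -> R) (g : SL R (n + m)).
Variables (al be : R) (al0 : 0 < al) (albe : al ^+ n * be ^+ m = 1).

Definition horo_mean N f (x : X) : R :=
  grid_mean N (fun Y : 'M[R]_(m, n) => f (act_lattices (horo albe Y) x)).

Notation pts N := {ffun 'I_m * 'I_n -> 'I_N}.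

Lemma card_pts N : #|{: pts N}|%:R = (N ^ (m * n))%:R :> R.
Proof. by rewrite card_ffun card_ord card_idx. Qed.

Lemma grid_card_gt0 N : (0 < N)%N -> (0 : R) < (N ^ (m * n))%:R.
Proof. by move=> N0; rewrite ltr0n expn_gt0 N0. Qed.

Lemma grid_mean_cst N (c : R) : (0 < N)%N -> grid_mean N (fun _ : 'M[R]_(m, n) => c) = c.
Proof.
move=> N0; rewrite /grid_mean sumr_const card_ffun card_ord card_idx -[c *+ _]mulr_natr mulfK//.
by rewrite gt_eqF// grid_card_gt0.
Qed.

Lemma grid_meanD N (F G : 'M[R]_(m, n) -> R) :
  grid_mean N (fun Y => F Y + G Y) = grid_mean N F + grid_mean N G.
Proof. by rewrite /grid_mean big_split mulrDl. Qed.

Lemma grid_meanZ N c (F : 'M[R]_(m, n) -> R) :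
  grid_mean N (fun Y => c * F Y) = c * grid_mean N F.
Proof. by rewrite /grid_mean -mulr_sumr mulrA. Qed.

Lemma le_grid_mean N (F G : 'M[R]_(m, n) -> R) :
  (forall Y, `|Y| <= 1 -> F Y <= G Y) -> grid_mean N F <= grid_mean N G.
Proof.
move=> FG; rewrite /grid_mean ler_wpM2r ?invr_ge0//; apply: ler_sum => a _.
by apply: FG; exact: grid_point_norm.
Qed.

Lemma horo_mean_bounded_ucont N f : bounded_ucont f -> bounded_ucont (horo_mean N f).
Proof.
move=> bf; rewrite /horo_mean /grid_mean.
under eq_fun do rewrite mulrC; apply: bounded_ucontZ; apply: bounded_ucont_sum => a.
exact: bounded_ucont_act.
Qed.

Lemma horo_mean_ge0 N f x : (forall y, 0 <= f y) -> 0 <= horo_mean N f x.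
Proof. by move=> f0; rewrite divr_ge0//; apply: sumr_ge0 => a _; exact: f0. Qed.

Lemma horo_mean_le1 N f x : (0 < N)%N -> (forall y, f y <= 1) -> horo_mean N f x <= 1.
Proof.
move=> N0 f1; rewrite -(grid_mean_cst 1 N0).
by apply: le_grid_mean => Y _; exact: f1.
Qed.

Variables (mu : probability (borel_lattices R (n + m)) R) (hmu : SL_invariant mu).

Lemma mean_horo_mean N f : (0 < N)%N -> bounded_ucont f -> mean mu (horo_mean N f) = mean mu f.
Proof.
move=> N0 bf; rewrite /horo_mean /grid_mean; under eq_fun do rewrite mulrC.
have bfa (a : pts N) := bounded_ucont_act (horo albe (grid_point a)) bf.
rewrite meanZ; last exact: bounded_ucont_sum.
rewrite mean_sum// (eq_bigr (fun=> mean mu f)) => [|a _]; last exact: (mean_act hmu).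
rewrite sumr_const card_ffun card_ord card_idx -[mean mu f *+ _]mulr_natl mulKf//.
by rewrite gt_eqF// grid_card_gt0.
Qed.

(** At each grid point [g] is replaced by its conjugate by [horo], arbitrarily far from 1; this is
    why [h] must be almost invariant under the whole group. Convexity of the square then passes to
    the mean. *)
Lemma defect_horo_mean N h e g : (0 < N)%N -> bounded_ucont h ->
  (forall g', defect mu h g' <= e) -> defect mu (horo_mean N h) g <= e.
Proof.
move=> N0 bh he; have W0 := grid_card_gt0 N0.
pose u (a : pts N) x := h (act_lattices (horo albe (grid_point a)) (act_lattices g x))
  - h (act_lattices (horo albe (grid_point a)) x).
have bu a : bounded_ucont (u a).
  apply: bounded_ucontB; last exact: bounded_ucont_act.
  by apply: (bounded_ucont_act g (f := fun x => h (act_lattices _ x))); exact: bounded_ucont_act.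
apply: (@le_trans _ _ (mean mu (fun x => (N ^ (m * n))%:R^-1 * \sum_a u a x ^+ 2))).
  apply: le_mean => [||x].
  - by apply: bounded_ucont_defect; exact: horo_mean_bounded_ucont.
  - by apply: bounded_ucontZ; apply: bounded_ucont_sum => a; exact: bounded_ucont_sqr.
  rewrite /horo_mean /grid_mean -mulrBl -sumrB -/(u _ _) exprMn mulrC expr2 -mulrA.
  rewrite ler_wpM2l ?invr_ge0 ?(ltW W0)// mulrC ler_pdivrMr// mulrC -card_pts.
  exact: sqr_sum_le.
rewrite meanZ; last by apply: bounded_ucont_sum => a; exact: bounded_ucont_sqr.
rewrite mean_sum; last by move=> a; exact: bounded_ucont_sqr.
rewrite mulrC ler_pdivrMr// -card_pts mulr_natr -sumr_const; apply: ler_sum => a _.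
set ga := horo albe (grid_point a).
rewrite (le_trans _ (he (mulSL (mulSL ga g) (invSL ga))))// /defect.
rewrite -(mean_act hmu ga (bounded_ucont_defect _ bh)) /u -/ga.
have -> // : (fun x => (h (act_lattices ga (act_lattices g x)) - h (act_lattices ga x)) ^+ 2) =
  (fun x => (h (act_lattices (mulSL (mulSL ga g) (invSL ga)) (act_lattices ga x))
    - h (act_lattices ga x)) ^+ 2).
by apply/funext => x; rewrite !actM actK.
Qed.

End horospherical_mean.

Section equicontinuity.
Context {R : realType} {m n : nat}.
Notation X := (lattices R (n + m)).
Implicit Types (f h : X -> R) (g : SL R (n + m)).

(** Half of [eps] pays for the left factor in [horo_mobius_near], through the modulus of [f]; half
    for the change of variables [mobius g]. Neither radius involves the scale: only the grid
    does. *)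
Lemma horo_mean_equicont_le f eps : bounded_ucont f ->
  (forall x, 0 <= f x) -> (forall x, f x <= 1) -> 0 < eps ->
  exists2 s, 0 < s & forall (al be : R) (albe : al ^+ n * be ^+ m = 1),
  0 < al -> al <= be -> eventually_dvd (fun N => forall g x, nearSL s g ->
    horo_mean albe N f (act_lattices g x) <= horo_mean albe N f x + eps).
Proof.
move=> [uf _] f0 f1 eps0; have eps20 : 0 < eps / 2 by rewrite divr_gt0.
have [e e0 He] := @grid_mean_change R m n _ eps20.
have [r r0 fr] := uf _ eps20; have [r' r'0 fr'] := uf _ e0.
pose e' := Num.min e 1.
have e'0 : 0 < e' by rewrite lt_min e0 /=.
have e'1 : e' <= 1 by rewrite ge_min lexx orbT.
have e'e : e' <= e by rewrite ge_min lexx.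
pose s := Num.min e' r / (24 * (m + n).+1%:R ^+ 3).
have s0 : 0 < s.
  apply: divr_gt0; first by rewrite lt_min; apply/andP.
  by apply: mulr_gt0 => //; exact: exprn_gt0.
exists s => // al be albe al0 ab; have be0 : 0 < be by exact: lt_le_trans ab.
(* The coarse mesh must be finer than the expansion [be / al], so that the integrand varies by at
   most [e] over a cell. *)
have [M M0 Mr] : exists2 M, (0 < M)%N & be / al * M%:R^-1 < r'.
  exists (Num.bound (be / al / r')).+1 => //.
  rewrite ltr_pdivrMr// -ltr_pdivrMl// [ltLHS]mulrC.
  rewrite (lt_le_trans (archi_boundP _))// ?ler_nat//.
  by rewrite ltW// !divr_gt0.
have [N0 N00 HN] := He _ M0; exists N0 => // N Np N0N g x gs.
apply: (@le_trans _ _ (grid_mean N (fun Y => f (act_lattices (horo albe (mobius g Y)) x)) + eps / 2)).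
  rewrite -[X in _ + X](grid_mean_cst (m := m) (n := n) _ Np) -grid_meanD.
  apply: le_grid_mean => Y Y1.
  have := fr _ (act_lattices (horo albe (mobius g Y)) x)
    (horo_mobius_near e'1 r0 gs al0 albe ab Y1).
  rewrite -!actM -(mulSLA (mulSL _ g)) mulVSL mulSL1 ler_norml => /andP[_]; lra.
rewrite [X in _ <= _ + X]splitr addrA lerD2r.
apply: (HN N Np N0N (fun Y => f (act_lattices (horo albe Y) x)) (mobius g)) => //.
- move=> Y Z YZ.
  have YZr : be / al * `|Y - Z| < r'.
    by apply: le_lt_trans Mr; rewrite ler_wpM2l// ltW// divr_gt0.
  have := fr' _ (act_lattices (horo albe Z) x) (horo_div_near al0 be0 albe r'0 YZr).
  by rewrite -actM -mulSLA mulVSL mulSL1.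
- move=> Y Z Y1 Z1; rewrite (le_trans (mobius_expand e'0 e'1 gs Y1 Z1))//.
  by rewrite ler_wpM2r// lerD2l.
- by move=> Y Y1; rewrite (le_trans (mobius_near e'1 gs Y1)).
Qed.

Lemma horo_mean_equicont f eps : bounded_ucont f ->
  (forall x, 0 <= f x) -> (forall x, f x <= 1) -> 0 < eps ->
  exists2 s, 0 < s & forall (al be : R) (albe : al ^+ n * be ^+ m = 1),
  0 < al -> al <= be -> eventually_dvd (fun N => forall g x, nearSL s g ->
    `|horo_mean albe N f (act_lattices g x) - horo_mean albe N f x| <= eps).
Proof.
move=> bf f0 f1 eps0; have [s s0 H] := horo_mean_equicont_le bf f0 f1 eps0.
have [t t0 tV] := nearSL_inv (d := n + m) s0.
exists (Num.min s t); first by rewrite lt_min s0.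
move=> al be albe al0 ab; apply: eventually_dvdS (H _ _ albe al0 ab) => N N0 HN g x.
rewrite /nearSL lt_min => /andP[gs gt].
have := HN g x gs; have := HN (invSL g) (act_lattices g x) (tV _ gt).
by rewrite actK ler_norml => ? ?; apply/andP; split; lra.
Qed.

(** By [elem_horo] the mean of a midpoint is the midpoint of the mean of [h] at [x] and at a lattice
    moved by [al / be * s]; equicontinuity identifies the two once [al / be] is small for the given
    [s]. *)
Lemma horo_mean_orbit_average (i : 'I_m) (j : 'I_n) (ij : rshift n i != lshift m j) f h eps :
  bounded_ucont f -> (forall x, 0 <= f x) -> (forall x, f x <= 1) ->
  orbit_average ij f h -> 0 < eps ->
  exists2 dl, 0 < dl & forall (al be : R) (albe : al ^+ n * be ^+ m = 1),
  0 < al -> al <= be -> al / be <= dl -> eventually_dvd (fun N => forall x,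
    `|horo_mean albe N h x - horo_mean albe N f x| <= eps).
Proof.
move=> bf f0 f1 fh; elim: fh eps => [|{}h s fh IH] eps eps0.
  exists 1 => // al be albe _ _ _; exists 1%N => // N _ _ x.
  by rewrite subrr normr0 ltW.
have bh := orbit_average_bounded_ucont bf fh.
have [h0 h1] : (forall x, 0 <= h x) /\ (forall x, h x <= 1).
  elim: {IH bh} fh => // k t _ [k0 k1]; split=> x.
    by rewrite divr_ge0// addr_ge0.
  by have := k1 x; have := k1 (act_lattices (elem ij t) x); lra.
have eps20 : 0 < eps / 2 by rewrite divr_gt0.
have [dl dl0 Hdl] := IH _ eps20.
have [r r0 Hr] := horo_mean_equicont bh h0 h1 eps20.
exists (Num.min dl (r / 2 / (`|s| + 1))); first by rewrite lt_min dl0 !divr_gt0.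
move=> al be albe al0 ab; rewrite le_min => /andP[abdl abr].
have be0 : 0 < be by exact: lt_le_trans ab.
have := eventually_dvdI (Hdl _ _ albe al0 ab abdl) (Hr _ _ albe al0 ab).
apply: eventually_dvdS => N N0 [HN HrN] x.
have near : nearSL r (elem ij (al / be * s)).
  apply: nearSL_elem; move: abr; rewrite ler_pdivlMr// normrM ger0_norm; last first.
    by rewrite ltW// divr_gt0.
  have : 0 < al / be by rewrite divr_gt0.
  have := normr_ge0 s; nra.
have -> : horo_mean albe N (fun y => (h y + h (act_lattices (elem ij s) y)) / 2) x =
    (horo_mean albe N h x + horo_mean albe N h (act_lattices (elem ij (al / be * s)) x)) / 2.
  rewrite -[RHS]mulrC -[in RHS]grid_meanD -grid_meanZ; congr (grid_mean N).
  apply/funext => Y; rewrite mulrC -!actM (elem_horo be0 albe) //.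
have := HN x; have := HrN _ x near; rewrite !ler_norml => /andP[? ?] /andP[? ?].
by apply/andP; split; lra.
Qed.

Variables (mu : probability (borel_lattices R (n + m)) R) (hmu : SL_invariant mu).

(** For bounded [g], the small defect of [F] gives some [g'] near 1 at which [F] hardly changes
    under [g]. Equicontinuity removes [g'] on both sides, for an error of [3 * e] between [F (g x0)]
    and [F x0]; tightness adds one more [e] for the mean, whence [e = eps / 4]. *)
Theorem horo_equidistribution f eps : (0 < m)%N -> (0 < n)%N -> bounded_ucont f ->
  (forall x, 0 <= f x) -> (forall x, f x <= 1) -> 0 < eps ->
  exists2 dl, 0 < dl & forall (al be : R) (albe : al ^+ n * be ^+ m = 1),
  0 < al -> al <= be -> al / be <= dl -> eventually_dvd (fun N =>
    `|horo_mean albe N f x0 - mean mu f| <= eps).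
Proof.
move=> m0 n0 bf f0 f1 eps0; set e := eps / 4.
have e0 : 0 < e by rewrite divr_gt0.
pose i := Ordinal m0; pose j := Ordinal n0.
have ij : rshift n i != lshift m j by rewrite eq_rlshift.
have [rho rho0 Htight] := mean_tight mu e0.
have [s s0 Hs] := horo_mean_equicont bf f0 f1 e0.
pose D : R := (n + m)%:R.
(* The loss in conjugating by [g] when [g] and its inverse are bounded by [rho]: [g'] is [r]-near 1
   so that [g g' g^-1] is [s]-near 1. *)
pose C := D * (D * rho) * rho + 1.
have C1 : 1 <= C by rewrite lerDr !mulr_ge0// ltW.
have C0 : 0 < C by exact: lt_le_trans C1.
pose r := s / C; have r0 : 0 < r by rewrite divr_gt0.
have rs : r <= s by rewrite ler_pdivrMr// ler_peMr// ltW.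
have conj_near g g' : `|(g : 'M[R]_(n + m))| <= rho -> `|(invSL g : 'M[R]_(n + m))| <= rho ->
    nearSL r g' -> nearSL s (mulSL (mulSL g g') (invSL g)).
  move=> g1 g2; rewrite /nearSL ltr_pdivlMr// => g'r; apply: le_lt_trans g'r.
  have -> : (mulSL (mulSL g g') (invSL g) : 'M[R]_(n + m)) - 1%:M =
      (g : 'M[R]_(n + m)) *m ((g' : 'M[R]_(n + m)) - 1%:M) *m (invSL g : 'M[R]_(n + m)).
    by rewrite mulmxBr mulmxBl mulmx1 -!SLval_mul mulSLV.
  rewrite (le_trans (mx_norm_mul _ _))// -/D.
  set z := `|(g' : 'M[R]_(n + m)) - 1%:M|; have z0 : 0 <= z by exact: normr_ge0.
  have h1 : `|(g : 'M[R]_(n + m)) *m ((g' : 'M[R]_(n + m)) - 1%:M)| <= D * rho * z.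
    by rewrite (le_trans (mx_norm_mul _ _))// -/D -/z !ler_wpM2r// ler_wpM2l.
  apply: (@le_trans _ _ (D * (D * rho * z) * rho)).
    by rewrite ler_pM ?mulr_ge0// ler_wpM2l.
  by rewrite /C; lra.
have [b b0 Hb] := mean_positive hmu r0.
have eb0 : 0 < e ^+ 2 * b by rewrite mulr_gt0// exprn_gt0.
have eb80 : 0 < e ^+ 2 * b / 8 by rewrite divr_gt0.
have [h fh hdef] := almost_invariant_average hmu ij bf eb80.
(* [H] and [F] differ by at most [e2], so the defect of [F] is at most
   [2 * (e ^+ 2 * b / 8) + 8 * e2], below [e ^+ 2 * b]; the bound 1 gives [e2 ^+ 2 <= e2]. *)
pose e2 := Num.min 1 (e ^+ 2 * b / 64).
have e20 : 0 < e2 by rewrite lt_min ltr01 divr_gt0.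
have [dl dl0 Hdl] := horo_mean_orbit_average bf f0 f1 fh e20.
exists dl => // al be albe al0 ab abdl.
have := eventually_dvdI (Hdl _ _ albe al0 ab abdl) (Hs _ _ albe al0 ab).
apply: eventually_dvdS => N N0 [HN HsN].
have bh := orbit_average_bounded_ucont bf fh.
set F := horo_mean albe N f; set H := horo_mean albe N h in HN.
have bF : bounded_ucont F by exact: horo_mean_bounded_ucont.
have bH : bounded_ucont H by exact: horo_mean_bounded_ucont.
have Fdef g : defect mu F g < e ^+ 2 * b.
  have Hdef : defect mu H g <= e ^+ 2 * b / 8 by exact: defect_horo_mean.
  apply: (@le_lt_trans _ _ (mean mu (fun x => 2 * (H (act_lattices g x) - H x) ^+ 2 + 8 * e2))).
    apply: le_mean => [||x].
    - exact: bounded_ucont_defect.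
    - apply: bounded_ucontD; last exact: bounded_ucont_cst.
      by apply: bounded_ucontZ; exact: bounded_ucont_defect.
    have := HN x; have := HN (act_lattices g x).
    set y := act_lattices g x; set u := H y - F y; set v := H x - F x.
    have e21 : e2 <= 1 by rewrite ge_min lexx.
    rewrite !ler_norml => /andP[u1 u2] /andP[v1 v2].
    have -> : F y - F x = (H y - H x) - (u - v) by rewrite /u /v; ring.
    have w4 : (u - v) ^+ 2 <= 4 * e2.
      have : 0 <= (2 * e2 - (u - v)) * (2 * e2 + (u - v)) by rewrite mulr_ge0//; lra.
      have : e2 * e2 <= e2 by rewrite ler_piMl// ltW.
      by rewrite !expr2; lra.
    have := sqr_ge0 ((H y - H x) + (u - v)); rewrite !expr2 in w4 *; lra.
  rewrite meanD; [|by apply: bounded_ucontZ; exact: bounded_ucont_defect|exact: bounded_ucont_cst].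
  rewrite mean_cst meanZ; last exact: bounded_ucont_defect.
  rewrite -[mean _ _]/(defect mu H g).
  have : e2 <= e ^+ 2 * b / 64 by rewrite ge_min lexx orbT.
  lra.
have Fclose g : `|(g : 'M[R]_(n + m))| <= rho -> `|(invSL g : 'M[R]_(n + m))| <= rho ->
    `|F (act_lattices g x0) - F x0| <= 3 * e.
  move=> g1 g2.
  (* Otherwise the squared difference is at least [e ^+ 2] on a whole tube, and [mean_positive]
     contradicts [Fdef]. *)
  have [g' [g'r g'e]] : exists g', nearSL r g' /\
      `|F (act_lattices g (act_lattices g' x0)) - F (act_lattices g' x0)| <= e.
    apply: contrapT => /forallNP no.
    have := Fdef g; rewrite ltNge => /negP; apply.
    apply: Hb => [|x||g' g'r]; first exact: bounded_ucont_defect.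
    - exact: sqr_ge0.
    - exact: sqr_ge0.
    have := no g'; rewrite not_andP => -[//|/negP].
    rewrite -ltNge => /ltW ge; rewrite -(real_normK (num_real (_ - _))).
    by rewrite lerXn2r ?nnegrE// ltW.
  have := HsN _ (act_lattices g x0) (conj_near _ _ g1 g2 g'r).
  rewrite -!actM -mulSLA mulVSL mulSL1 actM.
  have := HsN g' x0 (lt_le_trans g'r rs).
  move: g'e; rewrite -/F !ler_norml => /andP[? ?] /andP[? ?] /andP[? ?].
  by apply/andP; split; lra.
have F0 x : 0 <= F x by exact: horo_mean_ge0.
have F1 x : F x <= 1 by exact: horo_mean_le1.
have mF : mean mu F = mean mu f by exact: mean_horo_mean.
have e30 : 0 <= 3 * e by rewrite mulr_ge0// ltW.
have up : mean mu F - F x0 <= 3 * e + e.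
  rewrite -{1}(mean_cst mu (F x0)) -meanB//; last exact: bounded_ucont_cst.
  apply: Htight => // [|x|g g1 g2].
  - by apply: bounded_ucontB => //; exact: bounded_ucont_cst.
  - by have := F0 x0; have := F1 x; lra.
  - by have := Fclose g g1 g2; rewrite ler_norml => /andP[].
have dn : F x0 - mean mu F <= 3 * e + e.
  rewrite -{1}(mean_cst mu (F x0)) -meanB//; last exact: bounded_ucont_cst.
  apply: Htight => // [|x|g g1 g2].
  - by apply: bounded_ucontB => //; exact: bounded_ucont_cst.
  - by have := F1 x0; have := F0 x; lra.
  - by have := Fclose g g1 g2; rewrite ler_norml => /andP[]; lra.
rewrite -mF ler_norml; move: up dn; rewrite /e => up dn; apply/andP; split; lra.
Qed.

End equicontinuity.

(** * Points of a lattice, and suprema of test functions over them *)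

Section lattice_points.
Context {R : realType} {d : nat}.
Notation X := (lattices R d).
Notation vec := 'cV[R]_d.
Implicit Types (g : SL R d) (x : X) (w : vec) (psi : vec -> R).

Lemma lattice_points_act g x :
  lattice_points (act_lattices g x) = [set (g : 'M[R]_d) *m w | w in lattice_points x].
Proof.
have [h ->] := latticeP x; rewrite act_lattices_pi !lattice_points_pi.
apply/seteqP; split=> [_ [z _ <-]|_ [_ [z _ <-] <-]].
  by exists ((h : 'M[R]_d) *m map_mx intr z); [exists z|rewrite SLval_mul mulmxA].
by exists z => //; rewrite SLval_mul mulmxA.
Qed.

Lemma lattice_points_x0 :
  lattice_points (x0 : X) = [set map_mx intr z | z in [set: 'cV[int]_d]].
Proof.
rewrite lattice_points_pi; apply/seteqP.
by split=> _ [z _ <-]; exists z => //; rewrite mul1mx.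
Qed.

Definition nonzero_points x : set vec := [set w | lattice_points x w /\ w != 0].

Lemma SL_mul_eq0 g w : ((g : 'M[R]_d) *m w == 0) = (w == 0).
Proof.
apply/eqP/eqP => [gw|->]; last by rewrite mulmx0.
by rewrite -(mulKmx (unitSL g) w) gw mulmx0.
Qed.

Lemma nonzero_points_act g x :
  nonzero_points (act_lattices g x) = [set (g : 'M[R]_d) *m w | w in nonzero_points x].
Proof.
apply/seteqP; split=> [w []|_ [w [xw w0] <-]].
  rewrite lattice_points_act => -[v xv <-]; rewrite SL_mul_eq0 => v0.
  by exists v.
by split; [rewrite lattice_points_act; exists w|rewrite SL_mul_eq0].
Qed.

Lemma nonzero_points_neq0 x : (0 < d)%N -> nonzero_points x !=set0.
Proof.
move=> d0; have [g ->] := act_transitive x; rewrite nonzero_points_act.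
eexists; eexists; last reflexivity; split.
  by rewrite lattice_points_x0; exists (const_mx 1).
apply/eqP => /matrixP/(_ (Ordinal d0) 0); rewrite !mxE => /eqP.
by rewrite intr_eq0.
Qed.

Lemma mul_inv_norm g w : `|w| <= d%:R * `|(invSL g : 'M[R]_d)| * `|(g : 'M[R]_d) *m w|.
Proof.
rewrite -{1}(mulKmx (unitSL g) w); exact: mx_norm_mul.
Qed.

Lemma map_intr_norm_ge1 (z : 'cV[int]_d) :
  map_mx intr z != 0 :> vec -> 1 <= `|map_mx intr z : vec|.
Proof.
move=> z0; have [i zi] : exists i, z i 0 != 0.
  apply: contrapT => /forallNP no; move/eqP: z0; apply; apply/matrixP => i j.
  have := no i; rewrite (ord1 j) !mxE => /negP; rewrite negbK => /eqP->.
  by rewrite mulr0z.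
apply: le_trans (mx_entry_norm _ i 0); rewrite mxE -intr_norm -[1]/(1%:~R) ler_int.
by rewrite -gtz0_ge1 normr_gt0.
Qed.

(* Integer coordinates in a box encode the lattice points of a ball. *)
Lemma lattice_ball_code (rho B : R) : exists M, forall g, `|(invSL g : 'M[R]_d)| <= rho ->
  exists code : vec -> 'I_M, forall v w, lattice_points (act_lattices g x0) v ->
    lattice_points (act_lattices g x0) w -> `|v| <= B -> `|w| <= B ->
    code v = code w -> v = w.
Proof.
pose Z := (Num.truncn (d%:R * rho * B)).+1.
exists #|{ffun 'I_d -> 'I_(Z + Z).+1}| => g grho.
pose code w : {ffun 'I_d -> 'I_(Z + Z).+1} :=
  [ffun i => inord (absz (Num.floor (((invSL g : 'M[R]_d) *m w) i 0) + Z%:Z))].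
exists (fun w => enum_rank (code w)) => v w xv xw vB wB /enum_rank_inj/ffunP vw.
have int_of u : lattice_points (act_lattices g x0) u -> `|u| <= B ->
    exists2 z : 'cV[int]_d, u = (g : 'M[R]_d) *m map_mx intr z &
    forall i, (- Z%:Z <= z i 0 <= Z%:Z) /\ (code u i : nat) = absz (z i 0 + Z%:Z).
  rewrite lattice_points_act lattice_points_x0 => -[_ [z _ <-] <-] uB.
  exists z => // i; set y := map_mx intr z : vec.
  have yZ : `|y i 0| <= Z%:R.
    rewrite (le_trans (mx_entry_norm _ _ _))// (le_trans (mul_inv_norm g y))//.
    have : d%:R * rho * B < Z%:R by rewrite real_truncnS_gt// num_real.
    move=> /ltW/(le_trans _); apply; rewrite ler_pM ?mulr_ge0//.
    by rewrite ler_wpM2l.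
  have zZ : - Z%:Z <= z i 0 <= Z%:Z.
    by move: yZ; rewrite mxE -intr_norm -[Z%:R]/(Z%:~R) ler_int ler_norml.
  split=> //; rewrite ffunE mulKmx ?unitSL// mxE intrKfloor inordK//.
  have /andP[z1 z2] := zZ; rewrite ltnS -lez_nat gez0_abs.
    by rewrite PoszD lerD2r.
  by rewrite -lerBlDr sub0r.
have [a va az] := int_of v xv vB; have [b wb bz] := int_of w xw wB.
rewrite va wb; congr (_ *m map_mx _ _); apply/matrixP => i j; rewrite (ord1 j).
have [/andP[a1 _] ca] := az i; have [/andP[b1 _] cb] := bz i.
have /(congr1 Posz) := etrans (esym ca) (etrans (congr1 (@nat_of_ord _) (vw i)) cb).
by rewrite !gez0_abs -?lerBlDr ?sub0r// => /addIr.
Qed.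

Lemma finite_lattice_ball x (B : R) : finite_set [set w | lattice_points x w /\ `|w| <= B].
Proof.
have [g ->] := act_transitive x.
have [M /(_ g (lexx _))[code codeP]] := lattice_ball_code `|(invSL g : 'M[R]_d)| B.
set A := [set w | _].
have : finite_set (code @` A) by exact: finite_finset.
suff <- : finite_set (code @` A) = finite_set A by [].
apply: eq_finite_set; apply: inj_card_eq.
by move=> v w /set_mem[xv vB] /set_mem[xw wB]; exact: codeP.
Qed.

(** A supremum in place of the usual sum over lattice points: it stays in [[0, 1]] for test
    functions, so it is bounded without counting points. Zero is excluded because it lies in every
    lattice. *)
Definition lattice_sup psi x : R := sup [set psi w | w in nonzero_points x].

Definition test_function psi :=
  [/\ exists K, forall v w, `|psi v - psi w| <= K * `|v - w|,
      exists B, forall w, B < `|w| -> psi w = 0,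
      forall w, 0 <= psi w & forall w, psi w <= 1].

Section test_function.
Variables (d0 : (0 < d)%N) (psi : vec -> R) (tpsi : test_function psi).

Let psi0 w : 0 <= psi w. Proof. by case: tpsi. Qed.
Let psi1 w : psi w <= 1. Proof. by case: tpsi. Qed.

Lemma le_lattice_sup x w : nonzero_points x w -> psi w <= lattice_sup psi x.
Proof.
move=> xw; apply: sup_upper_bound; last by exists w.
split; first by exists (psi w), w.
by exists 1 => _ [v _ <-].
Qed.

Lemma lattice_sup_le x c : (forall w, nonzero_points x w -> psi w <= c) ->
  lattice_sup psi x <= c.
Proof.
move=> xc; apply: sup_le_ub; first by have [w xw] := nonzero_points_neq0 x d0; exists (psi w), w.
by move=> _ [w xw <-]; exact: xc.
Qed.

Lemma lattice_sup_ge0 x : 0 <= lattice_sup psi x.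
Proof.
by have [w xw] := nonzero_points_neq0 x d0; exact: le_trans (le_lattice_sup xw).
Qed.

Lemma lattice_sup_le1 x : lattice_sup psi x <= 1.
Proof. by apply: lattice_sup_le => w _. Qed.

Lemma test_function_act e : 0 < e -> exists2 r, 0 < r &
  forall g w, nearSL r g -> `|psi ((g : 'M[R]_d) *m w) - psi w| <= e.
Proof.
move=> e0; have [[K KP] [B0 BP0] _ _] := tpsi.
pose B := Num.max B0 1.
have B1 : 1 <= B by rewrite le_max lexx orbT.
have BP w : B < `|w| -> psi w = 0 by rewrite gt_max => /andP[/BP0].
pose k : R := d%:R + 1.
have k0 : 0 < k by rewrite ltr_wpDl.
have K1 : 0 < `|K| + 1 by rewrite ltr_wpDl.
(* The first bound keeps [|g w|] at least [|w| / 2], so points beyond [2 * B] do not enter the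
   support; the second is the Lipschitz estimate for the others. *)
pose r := Num.min (2^-1 / k) (e / (k * (2 * B) * (`|K| + 1))).
have r0 : 0 < r by rewrite lt_min !divr_gt0// !mulr_gt0// (lt_le_trans _ B1).
exists r => // g w; rewrite /nearSL lt_min => /andP[g1 g2].
set z := `|(g : 'M[R]_d) - 1%:M| in g1 g2.
have z0 : 0 <= z by exact: normr_ge0.
have gw : `|(g : 'M[R]_d) *m w - w| <= k * z * `|w|.
  have -> : (g : 'M[R]_d) *m w - w = ((g : 'M[R]_d) - 1%:M) *m w.
    by rewrite mulmxBl mul1mx.
  rewrite (le_trans (mx_norm_mul _ _))// ler_wpM2r// ler_wpM2r//.
  by rewrite /k lerDl.
have kz : k * z <= 2^-1 by move: g1; rewrite ltr_pdivlMr// mulrC => /ltW.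
have w0 : 0 <= `|w| by [].
have [wB|wB] := leP `|w| (2 * B).
  apply: le_trans (KP _ _) _; apply: (@le_trans _ _ ((`|K| + 1) * (k * z * (2 * B)))).
    apply: (@le_trans _ _ ((`|K| + 1) * `|(g : 'M[R]_d) *m w - w|)).
      by rewrite ler_wpM2r// (le_trans (ler_norm K))// lerDl.
    rewrite ler_wpM2l ?(ltW K1)// (le_trans gw)// ler_wpM2l// mulr_ge0//.
    exact: ltW.
  move: g2; rewrite ltr_pdivlMr ?mulr_gt0 ?(lt_le_trans _ B1)// => /ltW; lra.
rewrite !BP ?subrr ?normr0 ?(ltW e0)//.
  by rewrite (lt_trans _ wB)//; lra.
have := ler_wpM2r w0 kz; have := ler_normB ((g : 'M[R]_d) *m w) ((g : 'M[R]_d) *m w - w).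
rewrite opprB addrC subrK; lra.
Qed.

End test_function.
End lattice_points.

Section lipschitz_functions.
Context {R : realType} {d : nat}.
Notation vec := 'cV[R]_d.
Implicit Types (f h : vec -> R).

Definition lipschitz_vec f := exists K, forall v w, `|f v - f w| <= K * `|v - w|.

Lemma lipschitz_vec_cst c : lipschitz_vec (fun=> c).
Proof. by exists 0 => v w; rewrite subrr normr0 mul0r. Qed.

Lemma lipschitz_vecD f h : lipschitz_vec f -> lipschitz_vec h ->
  lipschitz_vec (fun w => f w + h w).
Proof.
move=> [K fK] [L hL]; exists (K + L) => v w.
by rewrite opprD addrACA mulrDl (le_trans (ler_normD _ _))// lerD.
Qed.

Lemma lipschitz_vecZ c f : lipschitz_vec f -> lipschitz_vec (fun w => c * f w).
Proof.
move=> [K fK]; exists (`|c| * K) => v w.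
by rewrite -mulrBr normrM -mulrA ler_wpM2l.
Qed.

Lemma lipschitz_vecB f h : lipschitz_vec f -> lipschitz_vec h ->
  lipschitz_vec (fun w => f w - h w).
Proof.
move=> lf lh; under eq_fun do rewrite -mulN1r.
by apply: lipschitz_vecD => //; exact: lipschitz_vecZ.
Qed.

Lemma dist_min_le (a b a' b' t : R) : `|a - a'| <= t -> `|b - b'| <= t ->
  `|Num.min a b - Num.min a' b'| <= t.
Proof.
rewrite !ler_norml => /andP[? ?] /andP[? ?].
by have [|] := leP a b; have [|] := leP a' b' => ? ?; apply/andP; split; lra.
Qed.

Lemma dist_max_le (a b a' b' t : R) : `|a - a'| <= t -> `|b - b'| <= t ->
  `|Num.max a b - Num.max a' b'| <= t.
Proof.
rewrite !ler_norml => /andP[? ?] /andP[? ?].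
by have [|] := leP a b; have [|] := leP a' b' => ? ?; apply/andP; split; lra.
Qed.

Lemma lipschitz_vec_min f h : lipschitz_vec f -> lipschitz_vec h ->
  lipschitz_vec (fun w => Num.min (f w) (h w)).
Proof.
move=> [K fK] [L hL]; exists (Num.max K L) => v w; apply: dist_min_le.
  by rewrite (le_trans (fK v w))// ler_wpM2r// le_max lexx.
by rewrite (le_trans (hL v w))// ler_wpM2r// le_max lexx orbT.
Qed.

Lemma lipschitz_vec_abs f : lipschitz_vec f -> lipschitz_vec (fun w => `|f w|).
Proof.
by move=> [K fK]; exists K => v w; rewrite (le_trans (ler_dist_dist _ _)).
Qed.

Lemma lipschitz_vec_norm : lipschitz_vec (fun w => `|w|).
Proof. by exists 1 => v w; rewrite mul1r ler_dist_dist. Qed.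

Lemma lipschitz_vec_coord i : lipschitz_vec (fun w => w i 0).
Proof.
exists 1 => v w; rewrite mul1r; have := mx_entry_norm (v - w) i 0.
by rewrite !mxE.
Qed.

Definition clamp (t : R) := Num.min 1 (Num.max 0 t).

Lemma clamp_ge1 t : 1 <= t -> clamp t = 1.
Proof. by move=> t1; rewrite /clamp max_r ?min_l// (le_trans ler01). Qed.

Lemma clamp_le0 t : t <= 0 -> clamp t = 0.
Proof. by move=> t0; rewrite /clamp max_l// min_r. Qed.

Lemma clamp_gt0 t : 0 < clamp t -> 0 < t.
Proof. by apply: contraPT; rewrite -leNgt => /clamp_le0->; rewrite ltxx. Qed.

Lemma clamp_eq1 t : clamp t = 1 -> 1 <= t.
Proof.
by rewrite /clamp; have [|] := leP 0 t; have [|] := leP 1 t => //;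
  have [|] := leP (1 : R) 0 => //; lra.
Qed.

Lemma clamp_ge0 t : 0 <= clamp t.
Proof. by rewrite le_min ler01 le_max lexx. Qed.

Lemma clamp_le1 t : clamp t <= 1.
Proof. by rewrite ge_min lexx. Qed.

Lemma clamp_test_function f : lipschitz_vec f ->
  (exists B, forall w, B < `|w| -> f w <= 0) -> test_function (fun w => clamp (f w)).
Proof.
move=> [K fK] [B fB]; split=> [||w|w]; [|by exists B => w /fB/clamp_le0| exact: clamp_ge0| exact: clamp_le1].
exists K => v w; have K0 : 0 <= K * `|v - w| by exact: le_trans (fK v w).
apply: dist_min_le; first by rewrite subrr normr0.
by apply: dist_max_le => //; rewrite subrr normr0.
Qed.

Lemma fin_positive_lb (I : finType) (t : I -> R) : (forall i, 0 < t i) ->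
  exists2 s, 0 < s & forall i, s <= t i.
Proof.
move=> t0; have S0 : 0 <= \sum_i (t i)^-1 by apply: sumr_ge0 => i _; rewrite invr_ge0 ltW.
(* The added 1 covers the empty family. *)
exists (\sum_i (t i)^-1 + 1)^-1; first by rewrite invr_gt0 ltr_wpDl.
move=> i; rewrite invf_ple ?posrE ?ltr_wpDl// (bigD1 i)//= -addrA lerDl.
by rewrite addr_ge0//; apply: sumr_ge0 => k _; rewrite invr_ge0 ltW.
Qed.

End lipschitz_functions.

Section lattice_sup.
Context {R : realType} {d : nat}.
Notation X := (lattices R d).
Notation vec := 'cV[R]_d.
Variables (d0 : (0 < d)%N) (psi : vec -> R) (tpsi : test_function psi).

Lemma bounded_ucont_lattice_sup : bounded_ucont (lattice_sup psi).
Proof.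
split; last first.
  exists 1 => x; rewrite ger0_norm ?(lattice_sup_ge0 d0 tpsi)//.
  exact: lattice_sup_le1.
move=> e e0; have [r r0 H] := test_function_act tpsi e0.
exists r => // g x gr; rewrite ler_norml; apply/andP; split.
  rewrite lerNl opprB lerBlDr; apply: (lattice_sup_le d0) => w xw.
  have := H g w gr; rewrite ler_norml => /andP[+ _].
  have : psi ((g : 'M[R]_d) *m w) <= lattice_sup psi (act_lattices g x).
    by apply: (le_lattice_sup tpsi); rewrite nonzero_points_act; exists w.
  lra.
rewrite lerBlDr; apply: (lattice_sup_le d0) => v.
rewrite nonzero_points_act => -[w xw <-].
have := H g w gr; rewrite ler_norml => /andP[_].
have := le_lattice_sup tpsi xw; lra.
Qed.

(** Only finitely many lattice points lie in the ball off which [psi] vanishes; if all their values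
    were below 1, so would be the supremum. *)
Lemma lattice_sup_attained (x : X) : 1 <= lattice_sup psi x ->
  exists2 w, nonzero_points x w & psi w = 1.
Proof.
move=> x1; apply: contrapT => no.
have [_ [B BP] psi0 psi1] := tpsi.
have /finite_seqP[s sE] := finite_lattice_ball x B.
have lt1 w : nonzero_points x w -> psi w < 1.
  move=> xw; rewrite lt_neqAle psi1 andbT; apply/eqP => w1.
  by apply: no; exists w.
have [c [c0 c1 cP]] : exists c, [/\ 0 <= c, c < 1 &
    forall w, w \in s -> nonzero_points x w -> psi w <= c].
  elim: {sE} s => [|v s [c [c0 c1 cP]]]; first by exists 0.
  have [xv|nxv] := pselect (nonzero_points x v).
    exists (Num.max c (psi v)); split; first by rewrite le_max c0.
      by rewrite gt_max c1 lt1.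
    move=> w; rewrite inE => /orP[/eqP-> _|ws xw].
      by rewrite le_max lexx orbT.
    by rewrite le_max cP.
  by exists c; split=> // w; rewrite inE => /orP[/eqP->//|/cP].
have : lattice_sup psi x <= c.
  apply: (lattice_sup_le d0) => w xw; have [wB|/BP->//] := leP `|w| B.
  apply: cP => //; have : [set w | lattice_points x w /\ `|w| <= B] w by split=> //; case: xw.
  by rewrite sE.
lra.
Qed.

Lemma lattice_sup_gt0 (x : X) : 0 < lattice_sup psi x ->
  exists2 w, nonzero_points x w & 0 < psi w.
Proof.
move=> x1; apply: contrapT => no; move: x1; apply/negP; rewrite -leNgt.
apply: (lattice_sup_le d0) => w xw; rewrite leNgt; apply/negP => w0.
by apply: no; exists w.
Qed.

End lattice_sup.

(** * Thin sets of vectors met by few lattices *)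

Section small_sets.
Context {R : realType} {d : nat} (d1 : (1 < d)%N).
Variables (mu : probability (borel_lattices R d) R) (hmu : SL_invariant mu).
Notation X := (lattices R d).
Notation vec := 'cV[R]_d.
Implicit Types (S : set vec) (e : R).

Let d0 : (0 < d)%N. Proof. exact: ltnW. Qed.

(* Few lattices have a nonzero point in S. *)
Definition rarely_met S e := exists f : X -> R, [/\ bounded_ucont f,
  forall x, 0 <= f x, forall x w, nonzero_points x w -> S w -> 1 <= f x & mean mu f <= e].

Lemma rarely_metS S S' e : S' `<=` S -> rarely_met S e -> rarely_met S' e.
Proof.
by move=> S'S [f [bf f0 fS fe]]; exists f; split=> // x w xw /S'S; exact: fS.
Qed.

Lemma rarely_met_bigU (I : finType) (S : I -> set vec) e :
  (forall i, rarely_met (S i) e) -> rarely_met (\bigcup_i S i) (#|I|%:R * e).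
Proof.
move=> /choice[f fP]; have bf i : bounded_ucont (f i) by case: (fP i).
exists (fun x => \sum_i f i x); split=> [|x|x w xw [i _ Sw]|].
- exact: bounded_ucont_sum.
- by apply: sumr_ge0 => i _; case: (fP i).
- rewrite (bigD1 i)//=; have [_ _ fS _] := fP i.
  by rewrite (le_trans (fS x w xw Sw))// lerDl; apply: sumr_ge0 => k _; case: (fP k).
- rewrite mean_sum// mulr_natl -sumr_const; apply: ler_sum => i _.
  by case: (fP i).
Qed.

Lemma rarely_metU S S' e e' : rarely_met S e -> rarely_met S' e' ->
  rarely_met (S `|` S') (e + e').
Proof.
move=> [f [bf f0 fS fe]] [f' [bf' f'0 fS' fe']].
exists (fun x => f x + f' x); split=> [|x|x w xw [Sw|Sw]|].
- exact: bounded_ucontD.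
- by rewrite addr_ge0.
- by rewrite (le_trans (fS x w xw Sw))// lerDl.
- by rewrite (le_trans (fS' x w xw Sw))// lerDr.
- by rewrite meanD// lerD.
Qed.

(** If [g^-1] is bounded by [rho], nonzero vectors of the lattice of [g] have norm at least
    [1 / (d * rho)]; [k] is less than half of this since the test function extends to [2 * k]. *)
Lemma rarely_met_short e : 0 < e -> exists2 k, 0 < k &
  rarely_met [set w : vec | `|w| <= k] e.
Proof.
move=> e0; have [rho rho0 Hrho] := mean_tight mu e0.
pose k := (2 * (d%:R * rho) + 1)^-1.
have drho : 0 <= d%:R * rho by rewrite mulr_ge0// ltW.
have k0 : 0 < k by rewrite invr_gt0 ltr_wpDl// mulr_ge0.
have kd : d%:R * rho * (2 * k) < 1.
  rewrite mulrCA mulrA -[ltRHS](@mulfV _ (2 * (d%:R * rho) + 1)); last first.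
    by rewrite gt_eqF// ltr_wpDl// mulr_ge0.
  by rewrite ltr_pM2r// ltrDl.
pose psi (w : vec) := clamp (2 - k^-1 * `|w|).
have tpsi : test_function psi.
  apply: clamp_test_function.
    apply: lipschitz_vecB; first exact: lipschitz_vec_cst.
    by apply: lipschitz_vecZ; exact: lipschitz_vec_norm.
  exists (2 * k) => w kw; rewrite subr_le0 mulrC ler_pdivlMr//; exact: ltW.
exists k => //; exists (lattice_sup psi); split.
- exact: bounded_ucont_lattice_sup.
- exact: lattice_sup_ge0.
- move=> x w xw wk; apply: le_trans (le_lattice_sup tpsi xw).
  rewrite /psi clamp_ge1// lerBrDl -lerBrDr mulrC ler_pdivrMr//.
  by move: wk => /=; lra.
rewrite -[e]add0r; apply: Hrho => //.
- exact: bounded_ucont_lattice_sup.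
- by move=> x; exact: lattice_sup_le1.
move=> g _ g2; apply: (lattice_sup_le d0) => v.
rewrite nonzero_points_act => -[y0 [+ z0] <-].
rewrite lattice_points_x0 => -[z _ zE]; move: z0; rewrite -zE => /map_intr_norm_ge1 z1.
rewrite /psi clamp_le0// subr_le0 mulrC ler_pdivlMr//.
set y := map_mx _ z in z1 *; rewrite leNgt; apply/negP => gy.
have := mul_inv_norm g y.
have : d%:R * `|(invSL g : 'M[R]_d)| * `|(g : 'M[R]_d) *m y| <= d%:R * rho * (2 * k).
  by rewrite ler_pM ?mulr_ge0// ?ler_wpM2l// ltW.
lra.
Qed.

(* The sheared copies of a thin slab are disjoint, and a typical lattice has
   boundedly many points in a ball. *)
Lemma rarely_met_slab i j (ij : i != j) (L : vec -> R) c B k e :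
  lipschitz_vec L ->
  (forall s w, L ((elem ij s : 'M[R]_d) *m w) = L w + s * w j 0) ->
  0 < k -> 0 < e ->
  exists2 eta, 0 < eta &
    rarely_met [set w : vec | [/\ `|L w - c| <= eta, `|w| <= B & k <= `|w j 0|]] e.
Proof.
move=> lipL shL k0 e0; have e20 : 0 < e / 2 by rewrite divr_gt0.
have [rho rho0 Hrho] := mean_tight mu e20.
pose B1 := `|B| + 1; have B10 : 0 < B1 by rewrite ltr_wpDl.
have BB1 : B <= B1 by rewrite (le_trans (ler_norm B))// lerDl.
(* The ball contains all sheared copies of the support: shears by at most 1 have norm at most 2. *)
have [M MP] := @lattice_ball_code R d rho (d%:R * 2 * (2 * B1)).
have [P P0 PM] : exists2 P, (0 < P)%N & M%:R / P%:R <= e / 2.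
  exists (Num.bound (M%:R / (e / 2))).+1 => //.
  rewrite ler_pdivrMr// -ler_pdivrMl// mulrC (le_trans (ltW (archi_boundP _)))//.
    by rewrite divr_ge0// ltW.
  by rewrite ler_nat.
have Pr0 : (0 : R) < P%:R by rewrite ltr0n.
(* Two different shears move [L] apart by at least [k / (2 * P)], which exceeds [4 * eta], twice the
   width [2 * eta] of the support. *)
pose eta := k / (16 * P%:R).
have eta0 : 0 < eta by rewrite divr_gt0// mulr_gt0.
pose a (w : vec) := Num.min (2 - eta^-1 * `|L w - c|)
  (Num.min (2 - B1^-1 * `|w|) (2 * k^-1 * `|w j 0| - 1)).
pose psi w := clamp (a w).
have tpsi : test_function psi.
  apply: clamp_test_function.
    apply: lipschitz_vec_min; last apply: lipschitz_vec_min.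
    - apply: lipschitz_vecB; first exact: lipschitz_vec_cst.
      apply: lipschitz_vecZ; apply: lipschitz_vec_abs; apply: lipschitz_vecB => //.
      exact: lipschitz_vec_cst.
    - apply: lipschitz_vecB; first exact: lipschitz_vec_cst.
      by apply: lipschitz_vecZ; exact: lipschitz_vec_norm.
    - apply: lipschitz_vecB; last exact: lipschitz_vec_cst.
      by apply: lipschitz_vecZ; apply: lipschitz_vec_abs; exact: lipschitz_vec_coord.
  exists (2 * B1) => w Bw; rewrite /a !ge_min; apply/orP; right; apply/orP; left.
  rewrite subr_le0 mulrC ler_pdivlMr//; exact: ltW.
have psi_pos w : 0 < psi w -> [/\ `|L w - c| < 2 * eta, `|w| < 2 * B1 & k < 2 * `|w j 0|].
  move=> /clamp_gt0; rewrite !lt_min => /and3P[]; rewrite !subr_gt0.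
  rewrite -(mulrC `|_|) ltr_pdivrMr// -(mulrC `|w|) ltr_pdivrMr//.
  by rewrite mulrAC ltr_pdivlMr// mul1r.
pose f := lattice_sup psi.
have bf : bounded_ucont f by exact: bounded_ucont_lattice_sup.
exists eta => //; exists f; split=> //.
- exact: lattice_sup_ge0.
- move=> x w xw [w1 w2 w3]; apply: le_trans (le_lattice_sup tpsi xw).
  rewrite /psi clamp_ge1// !le_min; apply/and3P; split.
  + rewrite lerBrDl -lerBrDr mulrC ler_pdivrMr//; move: w1; lra.
  + rewrite lerBrDl -lerBrDr mulrC ler_pdivrMr//; lra.
  + by rewrite lerBrDl mulrAC ler_pdivlMr//; lra.
pose sh (p : 'I_P) : R := (p : nat)%:R / P%:R.
(* By invariance [G] has the same mean as [f], but on the compact part at most [M] of its [P] terms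
   are nonzero. *)
pose G x := P%:R^-1 * \sum_(p < P) f (act_lattices (elem ij (- sh p)) x).
have bG : bounded_ucont G.
  by apply: bounded_ucontZ; apply: bounded_ucont_sum => p; exact: bounded_ucont_act.
have -> : mean mu f = mean mu G.
  rewrite /G meanZ; last by apply: bounded_ucont_sum => p; exact: bounded_ucont_act.
  rewrite mean_sum; last by move=> p; exact: bounded_ucont_act.
  rewrite (eq_bigr (fun=> mean mu f)) => [|p _]; last exact: (mean_act hmu).
  by rewrite sumr_const card_ord -[mean mu f *+ _]mulr_natl mulKf ?gt_eqF.
rewrite [e]splitr (le_trans (Hrho G (M%:R / P%:R) bG _ _ _))//.
- move=> x; rewrite /G mulrC ler_pdivrMr// mul1r.
  apply: (@le_trans _ _ (\sum_(p < P) 1)); last by rewrite sumr_const card_ord.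
  by apply: ler_sum => p _; exact: lattice_sup_le1.
- move=> g _ /MP[code codeP]; set x := act_lattices g x0.
  rewrite /G mulrC ler_wpM2r ?invr_ge0 ?(ltW Pr0)//.
  pose A := [pred p : 'I_P | 0 < f (act_lattices (elem ij (- sh p)) x)].
  apply: (@le_trans _ _ #|A|%:R).
    rewrite -sum1_card natr_sum [leRHS]big_mkcond /=; apply: ler_sum => p _.
    rewrite inE; case: ltP => //= _; exact: lattice_sup_le1.
  have /choice[u uP] : forall p : 'I_P, exists w, 0 < f (act_lattices (elem ij (- sh p)) x) ->
      [/\ lattice_points x w, `|w| <= d%:R * 2 * (2 * B1), k < 2 * `|w j 0| &
        `|L w - sh p * w j 0 - c| < 2 * eta].
    move=> p; have [fp|nfp] := boolP (0 < f (act_lattices (elem ij (- sh p)) x)); last by exists 0.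
    have [v] := lattice_sup_gt0 d0 fp.
    rewrite nonzero_points_act => -[w [xw _] <-] /psi_pos; rewrite shL => -[p1 p2 p3].
    have wj : ((elem ij (- sh p) : 'M[R]_d) *m w) j 0 = w j 0.
      by rewrite elem_mulE eq_sym (negbTE ij) mul0r addr0.
    exists w => _; split=> //; last by move: p1; rewrite mulNr.
      have -> : w = (elem ij (sh p) : 'M[R]_d) *m ((elem ij (- sh p) : 'M[R]_d) *m w).
        by rewrite mulmxA -SLval_mul elemD subrr elem0 mul1mx.
      rewrite (le_trans (mx_norm_mul _ _))// ler_pM ?mulr_ge0// ?ler_wpM2l//; last exact: ltW.
      have shp : `|sh p| <= 1.
        by rewrite ger0_norm ?divr_ge0// ler_pdivrMr// mul1r ler_nat ltnW.
      rewrite SLval_elem (le_trans (ler_normD _ _))// [leRHS](_ : 2 = 1 + 1)//.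
      rewrite lerD ?mx_norm1// mx_normZ -[leRHS]mulr1 ler_pM//.
      apply: mx_norm_le => // q r; rewrite mxE.
      by case: (_ && _); rewrite ?normr0 ?normr1.
    by rewrite wj in p3.
  have inj : {in A &, injective (fun p => code (u p))}.
    move=> p q; rewrite !inE => /uP[xp pB pk pL] /uP[xq qB qk qL] /(codeP _ _ xp xq pB qB) upq.
    rewrite -upq in qL; apply: contrapT => /eqP pq.
    have : `|sh p - sh q| * `|u p j 0| < 4 * eta.
      rewrite -normrM.
      have -> : (sh p - sh q) * u p j 0 = (L (u p) - sh q * u p j 0 - c)
          - (L (u p) - sh p * u p j 0 - c) by ring.
      rewrite (le_lt_trans (ler_normB _ _))//; lra.
    apply/negP; rewrite -leNgt.
    apply: (@le_trans _ _ (P%:R^-1 * (k / 2))).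
      have : 0 < k * P%:R^-1 by rewrite mulr_gt0// invr_gt0.
      rewrite /eta invfM; lra.
    apply: ler_pM; rewrite ?invr_ge0 ?(ltW Pr0) ?divr_ge0 ?(ltW k0)//; last lra.
    rewrite /sh -mulrBl normrM [`|P%:R^-1|]ger0_norm ?invr_ge0//.
    rewrite -[leLHS]mul1r ler_wpM2r ?invr_ge0//.
    wlog lt_pq : p q pq {xp pB pk pL xq qB qk qL upq} / (p < q)%N => [wl|].
      have [/wl|/wl|/val_inj e'] := ltngtP p q; last by rewrite e' eqxx in pq.
        exact.
      by rewrite distrC eq_sym; exact.
    by rewrite distrC -natrB ?(ltnW lt_pq)// ger0_norm// ler1n subn_gt0.
  rewrite ler_nat -[leqRHS]card_ord; exact: (@leq_card_in _ _ (fun p => code (u p)) A inj).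
- by rewrite lerD2r.
Qed.

(** If another coordinate [w j] is not small, shearing by it moves [w i]. If it is small, the roles
    are exchanged: [w j] is near 0 while [w i] is at least [|c| / 2]. *)
Lemma rarely_met_coord i c B e : c != 0 -> 0 < e -> exists2 eta, 0 < eta &
  rarely_met [set w : vec | `|w i 0 - c| <= eta /\ `|w| <= B] e.
Proof.
move=> c0 e0; have e20 : 0 < e / 2 by rewrite divr_gt0.
have [j ij] : exists j : 'I_d, i != j.
  have [i0|i0] := eqVneq (i : nat) 0%N.
    by exists (Ordinal d1); rewrite -val_eqE /= i0.
  by exists (Ordinal d0); rewrite -val_eqE.
have ji : j != i by rewrite eq_sym.
have shear p q (pq : p != q) s (w : vec) :
    ((elem pq s : 'M[R]_d) *m w) p 0 = w p 0 + s * w q 0.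
  by rewrite elem_mulE eqxx mul1r.
have c20 : 0 < `|c| / 2 by rewrite divr_gt0// normr_gt0.
have [k k0 Hk] := rarely_met_slab 0 B (lipschitz_vec_coord j) (shear _ _ ji) c20 e20.
have [eta eta0 Heta] := rarely_met_slab c B (lipschitz_vec_coord i) (shear _ _ ij) k0 e20.
exists (Num.min eta (`|c| / 2)); first by rewrite lt_min eta0.
rewrite [e]splitr; apply: rarely_metS (rarely_metU Heta Hk) => w /= [].
rewrite le_min => /andP[w1 w2] wB.
have [wj|wj] := leP k `|w j 0|; [by left|right; split=> //].
  by rewrite subr0 ltW.
have := ler_normD (w i 0) (c - w i 0); rewrite subrKC (distrC c) => h; lra.
Qed.

(** Any coordinate [l] other than [i] that is not small can serve for shearing, since it moves [w i]
    alone. If there is none, [w i] is small as well, being close to [sg * w j], and [w] is short. *)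
Lemma rarely_met_diagonal i j (ij : i != j) (sg : R) B e : `|sg| <= 1 -> 0 < e ->
  exists2 eta, 0 < eta & rarely_met [set w : vec | `|w i 0 - sg * w j 0| <= eta /\ `|w| <= B] e.
Proof.
move=> sg1 e0; have e20 : 0 < e / 2 by rewrite divr_gt0.
have [k k0 Hk] := rarely_met_short e20.
have k20 : 0 < k / 2 by rewrite divr_gt0.
have d00 : (0 : R) < d%:R by rewrite ltr0n.
have ed0 : 0 < e / 2 / d%:R by rewrite divr_gt0.
have /choice[eta etaP] : forall l : 'I_d, exists eta, 0 < eta /\
    (i != l -> rarely_met [set w : vec | [/\ `|w i 0 - sg * w j 0| <= eta, `|w| <= B & k / 2 <= `|w l 0|]]
      (e / 2 / d%:R)).
  move=> l; have [il|il] := boolP (i != l); last by exists 1.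
  have [||eta eta0 H] := @rarely_met_slab i l il (fun w => w i 0 - sg * w j 0) 0 B (k / 2) _ _ _ k20 ed0.
  - apply: lipschitz_vecB; first exact: lipschitz_vec_coord.
    by apply: lipschitz_vecZ; exact: lipschitz_vec_coord.
  - move=> s w; rewrite !elem_mulE eqxx (eq_sym j i) (negbTE ij) /=; ring.
  by exists eta; split=> // _; apply: rarely_metS H => w /= [? ? ?]; rewrite subr0.
have [s s0 sP] := @fin_positive_lb R _ eta (fun l => (etaP l).1).
exists (Num.min s (k / 2)); first by rewrite lt_min s0.
have HU : rarely_met (\bigcup_l [set w : vec | [/\ i != l, `|w i 0 - sg * w j 0| <= eta l,
    `|w| <= B & k / 2 <= `|w l 0|]]) (#|'I_d|%:R * (e / 2 / d%:R)).
  apply: rarely_met_bigU => l; have [il|/negbTE il] := boolP (i != l).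
    by apply: rarely_metS ((etaP l).2 il) => w /= [].
  exists (fun=> 0); split=> //; first exact: bounded_ucont_cst.
  - by move=> x w _ [].
  - by rewrite mean_cst ltW.
have dE : #|'I_d|%:R * (e / 2 / d%:R) = e / 2 by rewrite card_ord mulrC divfK ?gt_eqF.
rewrite dE in HU.
rewrite [e]splitr; apply: rarely_metS (rarely_metU HU Hk) => w /= [].
rewrite le_min => /andP[w1 w2] wB.
have [[l [il wl]]|no] := pselect (exists l, i != l /\ k / 2 <= `|w l 0|).
  by left; exists l => //; split=> //; exact: le_trans w1 (sP l).
right; have wl l : i != l -> `|w l 0| < k / 2.
  by move=> il; rewrite ltNge; apply/negP => kl; apply: no; exists l.
apply: mx_norm_le => [|l q]; first exact: ltW.
rewrite (ord1 q); have [<-|il] := eqVneq i l; last by have := wl l il; lra.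
have := ler_normD (w i 0 - sg * w j 0) (sg * w j 0); rewrite subrK normrM.
have := ler_wpM2r (normr_ge0 (w j 0)) sg1; have := wl j ij; lra.
Qed.

End small_sets.

(** * The truncated cone: existence of minima, sandwich functions, thin boundary *)

Section cone.
Context {R : realType} {m n : nat} (hm : (0 < m)%N) (hn : (0 < n)%N).
Notation X := (lattices R (n + m)).
Notation vec := 'cV[R]_(n + m).
Implicit Types (w : vec) (x : X).

Let d0 : (0 < n + m)%N. Proof. by rewrite addn_gt0 hn. Qed.
Let d1 : (1 < n + m)%N. Proof. by case: n hn m hm => [//|p _] [//|q _]; rewrite addnS. Qed.

Lemma usubmx_norm w : `|usubmx w| <= `|w|.
Proof. by apply: mx_norm_le => // i j; rewrite !mxE mx_entry_norm. Qed.

Lemma dsubmx_norm w : `|dsubmx w| <= `|w|.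
Proof. by apply: mx_norm_le => // i j; rewrite !mxE mx_entry_norm. Qed.

Lemma vec_norm_le w c : 0 <= c -> `|usubmx w| <= c -> `|dsubmx w| <= c -> `|w| <= c.
Proof.
move=> c0 uc vc; apply: mx_norm_le => // i j.
case: (split_ordP i) => k ->.
  by apply: le_trans uc; have := mx_entry_norm (usubmx w) k j; rewrite !mxE.
by apply: le_trans vc; have := mx_entry_norm (dsubmx w) k j; rewrite !mxE.
Qed.

Lemma lipschitz_usubmx : lipschitz_vec (fun w => `|usubmx w|).
Proof.
exists 1 => v w; rewrite mul1r (le_trans (ler_dist_dist _ _))//.
by rewrite -linearB usubmx_norm.
Qed.

Lemma lipschitz_dsubmx : lipschitz_vec (fun w => `|dsubmx w|).
Proof.
exists 1 => v w; rewrite mul1r (le_trans (ler_dist_dist _ _))//.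
by rewrite -linearB dsubmx_norm.
Qed.

Lemma C1P w : C1 w <-> `|dsubmx w| < `|usubmx w|.
Proof.
split=> [[r [s [t [r0 s1 t1 ->]]]]|uv].
  rewrite !linearZ /= col_mxKu col_mxKd !mx_normZ gtr0_norm// s1 mulr1.
  by rewrite -[ltRHS]mulr1 ltr_pM2l.
set r := `|usubmx w| in uv *; have r0 : 0 < r by exact: le_lt_trans uv.
exists r, (r^-1 *: usubmx w), (r^-1 *: dsubmx w); split=> //.
- by rewrite mx_normZ gtr0_norm ?invr_gt0// mulVf ?gt_eqF.
- by rewrite mx_normZ gtr0_norm ?invr_gt0// mulrC ltr_pdivrMr// mul1r.
- by rewrite scale_col_mx !scalerA mulfV ?gt_eqF// !scale1r vsubmxK.
Qed.

Lemma seq_min (s : seq R) (a : R) : exists2 b, b \in a :: s & {in a :: s, forall c, b <= c}.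
Proof.
elim: s a => [|a' s IH] a; first by exists a; rewrite ?mem_head// => c; rewrite inE => /eqP->.
have [b bs bmin] := IH a'; exists (Num.min a b).
  by case: leP => _; rewrite inE ?eqxx// bs orbT.
by move=> c; rewrite inE ge_min => /orP[/eqP->|/bmin->]; rewrite ?lexx ?orbT.
Qed.

(** Finiteness below every bound yields a least element, so [set_min] is not its default value. *)
Lemma set_min_le (S : set R) c : S !=set0 -> (forall B, finite_set [set a | S a /\ a <= B]) ->
  set_min S <= c <-> exists2 a, S a & a <= c.
Proof.
move=> [a0 Sa0] finS.
have [b [Sb lb]] : exists b, S b /\ lbound S b.
  have /finite_seqP[s sE] := finS a0.
  have sP a : a \in s <-> S a /\ a <= a0.
    by have <- : [set a | S a /\ a <= a0] a = (a \in s) by rewrite sE.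
  have a0s : a0 \in s by apply/sP.
  case: s {sE} sP a0s => // a s sP a0s; have [b bs bmin] := seq_min s a.
  have [Sb ba0] := (sP b).1 bs; exists b; split=> // c' Sc'.
  have [c'a0|/ltW] := leP c' a0; first by apply: bmin; apply/sP.
  exact: le_trans.
have [Sm lm] : [set a | S a /\ lbound S a] (set_min S) by apply: xgetPex; exists b.
by split=> [mc|[a Sa ac]]; [exists (set_min S)|exact: le_trans (lm a Sa) ac].
Qed.

Section pigeonhole.
Variables (g : SL R (n + m)).
(** [A] exceeds the number of boxes per unit of [K] needed along one coordinate. With [K = A ^ m]
    there are [L ^ m = K * K.+1 ^ m] boxes, fewer than the [K.+1 ^ (n + m)] integer points because
    [n] is positive. *)
Let A := (Num.truncn (4 * ((n + m)%:R * `|(g : 'M[R]_(n + m))|)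
  * ((n + m)%:R * `|(invSL g : 'M[R]_(n + m))| + 1))).+2.
Let K := (A ^ m)%N.
Let L := (A * K.+1)%N.

Let box_lt : (L ^ m < K.+1 ^ (n + m))%N.
Proof.
rewrite /L expnMn expnD ltn_pmul2r ?expn_gt0// -/K.
by rewrite (leq_trans (ltnSn K))// -[leqLHS]expn1 leq_pexp2l.
Qed.

(* Pigeonhole on the last m coordinates of the points of g Z^(n + m): some
   difference has them shorter than the shortest vector. *)
Lemma cone_point : exists w, lattice_points (act_lattices g x0) w /\ `|dsubmx w| < `|usubmx w|.
Proof.
pose D : R := (n + m)%:R.
pose c := (D * `|(invSL g : 'M[R]_(n + m))| + 1)^-1.
have Dg0 : 0 <= D * `|(g : 'M[R]_(n + m))| by rewrite mulr_ge0.
have Di0 : 0 <= D * `|(invSL g : 'M[R]_(n + m))| by rewrite mulr_ge0.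
have c0 : 0 < c by rewrite invr_gt0 ltr_wpDl.
have short w : lattice_points (act_lattices g x0) w -> w != 0 -> c <= `|w|.
  rewrite lattice_points_act lattice_points_x0 => -[_ [z _ <-] <-].
  rewrite SL_mul_eq0 => /map_intr_norm_ge1 z1.
  rewrite /c invf_ple ?posrE ?ltr_wpDl//; last first.
    rewrite normr_gt0; apply: contraTneq z1 => /eqP; rewrite SL_mul_eq0 => /eqP->.
    by rewrite normr0 -ltNge.
  set y := map_mx _ z in z1 *.
  have gy0 : 0 < `|(g : 'M[R]_(n + m)) *m y|.
    rewrite normr_gt0 SL_mul_eq0; apply: contraTneq z1 => ->.
    by rewrite normr0 -ltNge.
  rewrite -[leLHS]mul1r ler_pdivrMr//.
  by have := mul_inv_norm g y; rewrite -/D mulrDl; lra.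
pose emb (f : {ffun 'I_(n + m) -> 'I_K.+1}) : 'cV[int]_(n + m) := \col_i (f i : nat)%:Z.
pose v f : 'cV[R]_m := dsubmx ((g : 'M[R]_(n + m)) *m map_mx intr (emb f)).
pose V := D * `|(g : 'M[R]_(n + m))| * K%:R.
have vV f i : `|v f i 0| <= V.
  rewrite (le_trans (mx_entry_norm _ _ _))// (le_trans (dsubmx_norm _))//.
  rewrite (le_trans (mx_norm_mul _ _))// ler_wpM2l//.
  apply: mx_norm_le => // p q; rewrite !mxE ger0_norm ?ler0z//.
  by rewrite -[_%:~R]/((f p : nat)%:R) ler_nat -ltnS.
pose q f i := (v f i 0 + V) / (c / 2).
have c20 : 0 < c / 2 by rewrite divr_gt0.
have q0 f i : 0 <= q f i.
  by rewrite divr_ge0 ?(ltW c20)//; have := vV f i; rewrite ler_norml => /andP[? ?]; lra.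
have qL f i : (Num.truncn (q f i) < L)%N.
  rewrite truncn_lt_nat//.
  apply: (@le_lt_trans _ _ (2 * V / (c / 2))).
    rewrite ler_wpM2r ?invr_ge0 ?(ltW c20)//.
    by have := vV f i; rewrite ler_norml => /andP[? ?]; lra.
  have -> : 2 * V / (c / 2) = (4 * (D * `|(g : 'M[R]_(n + m))|)
      * (D * `|(invSL g : 'M[R]_(n + m))| + 1)) * K%:R.
    by rewrite /V invf_div /c invrK; ring.
  set a := 4 * _ * _.
  have a0 : 0 <= a by rewrite !mulr_ge0// addr_ge0.
  rewrite /L natrM.
  have aA : a < A%:R.
    rewrite (@lt_trans _ _ (Num.truncn a).+1%:R)//; first by have /andP[] := truncn_itv a0.
    by rewrite ltr_nat; exact: ltnSn.
  apply: (@le_lt_trans _ _ (A%:R * K%:R)); first by rewrite ler_wpM2r// ltW.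
  by rewrite ltr_pM2l ?ltr_nat ?ltr0n.
pose code f : {ffun 'I_m -> 'I_L} := [ffun i => Ordinal (qL f i)].
have [f [f' [ff' cff']]] : exists f f', f != f' /\ code f = code f'.
  apply: contrapT => no.
  have inj : injective code.
    move=> f f' e; apply: contrapT => /eqP ff'; apply: no; by exists f, f'.
  have := leq_card code inj; rewrite !card_ffun !card_ord leqNgt.
  by rewrite box_lt.
pose w := (g : 'M[R]_(n + m)) *m map_mx intr (emb f - emb f').
have xw : lattice_points (act_lattices g x0) w.
  rewrite lattice_points_act; exists (map_mx intr (emb f - emb f')) => //.
  by rewrite lattice_points_x0; exists (emb f - emb f').
have w0 : w != 0.
  rewrite SL_mul_eq0; apply: contraNneq ff' => /matrixP e; apply/eqP/ffunP => i.
  have := e i 0; rewrite !mxE => /eqP; rewrite intr_eq0 subr_eq0 => /eqP[] /val_inj.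
  exact.
have vw : `|dsubmx w| < c.
  apply: mx_norm_lt => // i j; rewrite (ord1 j).
  have -> : dsubmx w i 0 = v f i 0 - v f' i 0.
    by rewrite /w map_mxB mulmxBr linearB /= !mxE.
  have -> : v f i 0 - v f' i 0 = (q f i - q f' i) * (c / 2).
    by rewrite /q -mulrBl divfK ?gt_eqF//; ring.
  have := congr1 (fun h : {ffun 'I_m -> 'I_L} => (h i : nat)) cff'; rewrite !ffunE /= => e.
  have := truncn_itv (q0 f i); have := truncn_itv (q0 f' i); rewrite e -natr1.
  move=> /andP[? ?] /andP[? ?].
  rewrite normrM [`|c / 2|]gtr0_norm//.
  have : `|q f i - q f' i| <= 1 by rewrite ler_norml; apply/andP; split; lra.
  move=> /(ler_wpM2r (ltW c20)); lra.
exists w; split=> //; apply: (lt_le_trans vw).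
(* The norm of [w] is at least [c] while its last [m] coordinates are below [c], so the maximum is
   attained among the first [n]. *)
have := short w xw w0; apply: contraTT; rewrite -!ltNge => uc.
have [uv|uv] := leP `|usubmx w| `|dsubmx w|.
  apply: le_lt_trans vw; exact: vec_norm_le.
by apply: le_lt_trans uc; apply: vec_norm_le => //; exact: ltW.
Qed.

End pigeonhole.

Definition hit T x := exists w, [/\ lattice_points x w, `|dsubmx w| < `|usubmx w| & `|usubmx w| <= T].

Lemma hit_values_neq0 x : [set `|usubmx w| | w in lattice_points x `&` C1] !=set0.
Proof.
have [g ->] := act_transitive x; have [w [xw uv]] := cone_point g.
by exists `|usubmx w|; exists w => //; split=> //; apply/C1P.
Qed.

Lemma hit_values_finite x B :
  finite_set [set a | [set `|usubmx w| | w in lattice_points x `&` C1] a /\ a <= B].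
Proof.
apply: (@sub_finite_set _ _ [set `|usubmx w| | w in [set w | lattice_points x w /\ `|w| <= B]]).
  move=> _ [[w [xw /C1P uv] <-] uB]; exists w => //; split=> //.
  apply: vec_norm_le => //; first exact: le_trans uB.
  by rewrite (le_trans (ltW uv)).
by apply: finite_image; exact: finite_lattice_ball.
Qed.

Lemma F1_le T x : F1 x <= T <-> hit T x.
Proof.
rewrite /F1 set_min_le; [|exact: hit_values_neq0|exact: hit_values_finite].
split=> [[_ [w [xw /C1P uv] <-] uT]|[w [xw uv uT]]]; first by exists w.
by exists `|usubmx w| => //; exists w => //; split=> //; apply/C1P.
Qed.

Section approximation.
Variables (T : R) (T0 : 0 < T).

(** A signed depth: positive exactly when [|v| < |u| < T], negative exactly when [|u| > T] or
    [|u| < |v|]. *)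
Definition margin w := Num.min (T - `|usubmx w|) (`|usubmx w| - `|dsubmx w|).

Lemma lipschitz_margin : lipschitz_vec margin.
Proof.
have lu := lipschitz_usubmx; have lv := lipschitz_dsubmx.
apply: lipschitz_vec_min; apply: lipschitz_vecB => //; exact: lipschitz_vec_cst.
Qed.

Lemma margin_large w b : 0 <= b -> T + 2 * b < `|w| -> margin w <= - b.
Proof.
move=> b0 wb; rewrite /margin ge_min.
have [ub|ub] := leP (T + b) `|usubmx w|; first by apply/orP; left; lra.
have [vb|vb] := leP (T + 2 * b) `|dsubmx w|; first by apply/orP; right; lra.
exfalso; move: wb; apply/negP; rewrite -leNgt.
by apply: vec_norm_le; [have := T0; lra|lra|exact: ltW].
Qed.

Lemma clamp_margin_test_function b c : 0 <= b -> 0 < c ->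
  test_function (fun w => clamp (b + c * margin w)).
Proof.
move=> b0 c0; apply: clamp_test_function.
  apply: lipschitz_vecD; first exact: lipschitz_vec_cst.
  by apply: lipschitz_vecZ; exact: lipschitz_margin.
exists (T + 2 * (b / c)) => w /(margin_large (divr_ge0 b0 (ltW c0))).
by move=> /(ler_wpM2l (ltW c0)); rewrite mulrN mulrCA mulfV ?gt_eqF// mulr1; lra.
Qed.

(** The inner ramp starts at margin 0 and the outer ramp has reached 1 there, so these two functions
    enclose the indicator of [hit T]. *)
Definition inner_hit c := lattice_sup (fun w => clamp (0 + c * margin w)) : X -> R.
Definition outer_hit c := lattice_sup (fun w => clamp (1 + c * margin w)) : X -> R.

Lemma hit_point_neq0 w : `|dsubmx w| < `|usubmx w| -> w != 0.
Proof. by move=> uv; apply: contraTneq uv => ->; rewrite !linear0 !normr0 ltxx. Qed.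

Lemma inner_hitP c x : 0 < c -> 0 < inner_hit c x -> hit T x.
Proof.
move=> c0 /(lattice_sup_gt0 d0)[w [xw _] /clamp_gt0].
rewrite add0r pmulr_rgt0// lt_min !subr_gt0 => /andP[uT uv].
by exists w; split=> //; exact: ltW.
Qed.

Lemma outer_hitP c x : 0 < c -> hit T x -> 1 <= outer_hit c x.
Proof.
move=> c0 [w [xw uv uT]].
have tf := clamp_margin_test_function ler01 c0.
have := @le_lattice_sup _ _ _ tf x w (conj xw (hit_point_neq0 uv)).
rewrite clamp_ge1// lerDl mulr_ge0 ?(ltW c0)// le_min !subr_ge0 uT /=.
exact: ltW.
Qed.

(** The strict inequality is a countable union of the closed conditions with gap [1/(k+1)]. Each of
    these is a superlevel set at 1 of a continuous supremum, because a supremum equal to 1 is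
    attained. *)
Lemma measurable_hit : measurable [set x : borel_lattices R (n + m) | hit T x].
Proof.
pose psi k w := clamp (1 + (Num.min (T - `|usubmx w|) (`|usubmx w| - `|dsubmx w| - k.+1%:R^-1))).
have tf k : test_function (psi k).
  apply: clamp_test_function.
    apply: lipschitz_vecD; first exact: lipschitz_vec_cst.
    have lu := lipschitz_usubmx; have lv := lipschitz_dsubmx.
    apply: lipschitz_vec_min; apply: lipschitz_vecB => //; try exact: lipschitz_vec_cst.
    exact: lipschitz_vecB.
  exists (T + 2 * 1) => w /(margin_large ler01); rewrite /margin ge_min => h.
  suff : Num.min (T - `|usubmx w|) (`|usubmx w| - `|dsubmx w| - k.+1%:R^-1) <= - 1 by lra.
  rewrite ge_min; case/orP: h => [->//|h]; apply/orP; right.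
  by rewrite (le_trans _ h)// lerBlDr lerDl ltW.
have -> : [set x : borel_lattices R (n + m) | hit T x] =
    \bigcup_k (lattice_sup (psi k) @^-1` `[1, +oo[%classic).
  apply/seteqP; split=> [x [w [xw uv uT]]|x [k _ /=]].
    have [k kuv] : exists k : nat, k.+1%:R^-1 <= `|usubmx w| - `|dsubmx w|.
      exists (Num.bound (`|usubmx w| - `|dsubmx w|)^-1).
      rewrite invf_ple ?posrE ?subr_gt0//.
      rewrite (le_trans (ltW (archi_boundP _)))// ?ler_nat//.
      by rewrite invr_ge0 subr_ge0 ltW.
    exists k => //=; rewrite in_itv/= andbT.
    have := @le_lattice_sup _ _ _ (tf k) x w (conj xw (hit_point_neq0 uv)).
    by rewrite {1}/psi clamp_ge1// lerDl le_min !subr_ge0 uT.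
  rewrite in_itv/= andbT => /(lattice_sup_attained d0 (tf k))[w [xw _] /clamp_eq1].
  rewrite lerDl le_min !subr_ge0 => /andP[uT kuv]; exists w; split=> //.
  by rewrite -subr_gt0 (lt_le_trans _ kuv)// invr_gt0.
apply: bigcup_measurable => k _; rewrite -[X in measurable X]setTI.
apply: ucont_measurable => //; first by case: (bounded_ucont_lattice_sup d0 (tf k)).
Qed.

Variables (mu : probability (borel_lattices R (n + m)) R) (hmu : SL_invariant mu).

Lemma boundary_rarely_met e : 0 < e -> exists2 eta, 0 < eta &
  rarely_met mu [set w | `|margin w| <= eta] e.
Proof.
move=> e0; pose B := T + 2.
(* Half of [e] is shared by the [2 * n] faces where a coordinate of [u] is near [T] or [-T], a
   quarter by the [2 * n * m] faces where a coordinate of [u] is near plus or minus one of [v]; the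
   last quarter is for short vectors. *)
pose e' := e / 2 / (2 * n)%:R; pose e'' := e / 4 / (2 * (n * m))%:R.
have n0 : (0 : R) < (2 * n)%:R by rewrite ltr0n muln_gt0.
have nm0 : (0 : R) < (2 * (n * m))%:R by rewrite ltr0n !muln_gt0 hn hm.
have e'0 : 0 < e' by rewrite !divr_gt0.
have e''0 : 0 < e'' by rewrite !divr_gt0.
have e40 : 0 < e / 4 by rewrite divr_gt0.
pose sg (b : bool) : R := (-1) ^+ b.
have sg1 b : `|sg b| = 1 by rewrite /sg normrX normrN1 expr1n.
have sgc (b : bool) : sg b * T != 0 by rewrite mulf_neq0 ?signr_eq0 ?gt_eqF.
have [k k0 Hk] := rarely_met_short d1 mu e40.
have /choice[eA eAP] : forall ib : 'I_n * bool, exists eta, 0 < eta /\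
    rarely_met mu [set w : vec | `|w (lshift m ib.1) 0 - sg ib.2 * T| <= eta /\ `|w| <= B] e'.
  by move=> ib; have [eta] := rarely_met_coord d1 hmu (lshift m ib.1) B (sgc ib.2) e'0; exists eta.
have /choice[eB eBP] : forall ijb : 'I_n * 'I_m * bool, exists eta, 0 < eta /\
    rarely_met mu [set w : vec | `|w (lshift m ijb.1.1) 0 - sg ijb.2 * w (rshift n ijb.1.2) 0| <= eta
      /\ `|w| <= B] e''.
  move=> ijb; have ne : lshift m ijb.1.1 != rshift n ijb.1.2 by rewrite eq_lrshift.
  have sgle : `|sg ijb.2| <= 1 by rewrite sg1.
  by have [eta] := rarely_met_diagonal d1 hmu ne B sgle e''0; exists eta.
have [sA sA0 sAP] := fin_positive_lb (fun ib => (eAP ib).1).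
have [sB sB0 sBP] := fin_positive_lb (fun ijb => (eBP ijb).1).
pose eta := Num.min (Num.min sA sB) (Num.min (Num.min (T / 2) 1) (k / 2)).
have eta0 : 0 < eta by rewrite !lt_min sA0 sB0 ltr01 !divr_gt0.
exists eta => //.
have : eta <= eta by [].
rewrite {2}/eta !le_min => /andP[/andP[etaA etaB] /andP[/andP[etaT eta1] etak]].
have HA := rarely_met_bigU (fun ib => (eAP ib).2).
have HB := rarely_met_bigU (fun ijb => (eBP ijb).2).
have cA : #|{: 'I_n * bool}|%:R * e' = e / 2.
  by rewrite card_prod card_ord card_bool mulnC /e' mulrC divfK ?gt_eqF.
have cB : #|{: 'I_n * 'I_m * bool}|%:R * e'' = e / 4.
  by rewrite !card_prod !card_ord card_bool mulnC /e'' mulrC divfK ?gt_eqF.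
rewrite cA in HA; rewrite cB in HB.
have -> : e = e / 2 + (e / 4 + e / 4) by field.
apply: rarely_metS (rarely_metU HA (rarely_metU HB Hk)) => w /= wa.
have uB : `|usubmx w| <= T + 1.
  move: wa; rewrite ler_norml => /andP[+ _]; rewrite le_min => /andP[h _]; lra.
have vB : `|dsubmx w| <= T + 2.
  move: wa; rewrite ler_norml => /andP[+ _]; rewrite le_min => /andP[_ h]; lra.
have wB : `|w| <= B by apply: vec_norm_le => //; rewrite /B; have := T0; lra.
have abs_sg (t : R) : exists b, `|t| = sg b * t.
  have [t0|t0] := leP 0 t.
    by exists false; rewrite /sg expr0 mul1r ger0_norm.
  by exists true; rewrite /sg expr1 mulN1r ltr0_norm.
have [wT|wuv] : `|T - `|usubmx w| | <= eta \/ `| `|usubmx w| - `|dsubmx w| | <= eta.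
  by move: wa; rewrite /margin; have [_|_] := leP (T - `|usubmx w|) _; [left|right].
- left; have u0 : 0 < `|usubmx w|.
    by move: wT; rewrite ler_norml => /andP[? ?]; have := T0; lra.
  have [i [j uij]] := mx_norm_attained u0; rewrite (ord1 j) mxE in uij.
  have [b wb] := abs_sg (w (lshift m i) 0).
  exists (i, b) => //=; split=> //; apply: le_trans (sAP (i, b)); apply: le_trans etaA.
  move: wT; rewrite uij wb.
  have ss : sg b * sg b = 1 by rewrite /sg -expr2 sqrr_sign.
  have -> : w (lshift m i) 0 - sg b * T = - sg b * (T - sg b * w (lshift m i) 0).
    transitivity ((sg b * sg b) * w (lshift m i) 0 - sg b * T); last by ring.
    by rewrite ss mul1r.
  by rewrite normrM normrN sg1 mul1r.
(* If [u] is within [eta] of zero or [v] vanishes, [w] is short; otherwise both norms are attained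
   at coordinates. *)
right; have [u0|u0] := leP `|usubmx w| eta.
  right; apply: vec_norm_le; [exact: ltW|lra|].
  by move: wuv; rewrite ler_norml => /andP[? ?]; lra.
have [v0|v0] := leP `|dsubmx w| 0.
  right; apply: vec_norm_le; [exact: ltW| |lra].
  by move: wuv; rewrite ler_norml => /andP[? ?]; lra.
left; have [i [j uij]] := mx_norm_attained (lt_trans eta0 u0); rewrite (ord1 j) mxE in uij.
have [i' [j' vij]] := mx_norm_attained v0; rewrite (ord1 j') mxE in vij.
have [b ub] := abs_sg (w (lshift m i) 0); have [b' vb] := abs_sg (w (rshift n i') 0).
exists (i, i', b (+) b') => //=; split=> //; apply: le_trans (sBP (i, i', b (+) b')).
apply: le_trans etaB; move: wuv; rewrite uij vij ub vb.
have ss : sg b * sg b = 1 by rewrite /sg -expr2 sqrr_sign.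
have -> : w (lshift m i) 0 - sg (b (+) b') * w (rshift n i') 0 =
    sg b * (sg b * w (lshift m i) 0 - sg b' * w (rshift n i') 0).
  transitivity ((sg b * sg b) * w (lshift m i) 0 - sg b * sg b' * w (rshift n i') 0).
    by rewrite ss mul1r /sg signr_addb.
  by ring.
by rewrite normrM sg1 mul1r.
Qed.

(** With slope [1 / eta] both ramps equal 1 above margin [eta] and 0 below [-eta], so the two
    suprema differ only through points near the boundary. *)
Lemma hit_mean_approx e : 0 < e -> exists2 c, 0 < c &
  mean mu (outer_hit c) <= mean mu (inner_hit c) + e.
Proof.
move=> /boundary_rarely_met[eta eta0 [f [bf f0 fS fe]]].
have c0 : 0 < eta^-1 by rewrite invr_gt0.
have ti := clamp_margin_test_function (lexx 0) c0.
have to := clamp_margin_test_function ler01 c0.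
have bi := bounded_ucont_lattice_sup d0 ti; have bo := bounded_ucont_lattice_sup d0 to.
exists eta^-1 => //; apply: (@le_trans _ _ (mean mu (fun x => inner_hit eta^-1 x + f x))).
  apply: le_mean => [//||x]; first exact: bounded_ucontD.
  apply: (lattice_sup_le d0) => w xw.
  have i0 : 0 <= inner_hit eta^-1 x by exact: lattice_sup_ge0.
  have [wa|wa] := leP `|margin w| eta.
    by rewrite (le_trans (clamp_le1 _))// (le_trans (fS x w xw wa))// lerDr.
  move: wa; rewrite lter_normr => /orP[wa|wa].
    rewrite (le_trans (clamp_le1 _))//.
    have := le_lattice_sup ti xw; rewrite clamp_ge1; last first.
      by rewrite add0r mulrC ler_pdivlMr// mul1r ltW.
    by have := f0 x; rewrite /inner_hit; lra.
  rewrite clamp_le0 ?addr_ge0//.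
  have : margin w / eta <= - 1 by rewrite ler_pdivrMr//; lra.
  by rewrite [_^-1 * _]mulrC; lra.
by rewrite meanD// lerD2l.
Qed.

End approximation.
End cone.

(** * Measuring events in the cube by counting grid cells *)

Section counting_cells.
Context {d : measure_display} {T : measurableType d} {R : realType}.
Variables (P : probability T R) (I : finType) (C : I -> set T) (w : R).
Hypotheses (mC : forall i, measurable (C i)) (PC : forall i, P (C i) = w%:E).
Hypothesis trivC : forall i j x, C i x -> C j x -> i = j.

Lemma cells_lower (E : set T) (S : {set I}) : measurable E ->
  (forall i, i \in S -> C i `<=` E) -> #|S|%:R * w <= fine (P E).
Proof.
move=> mE SE.
have PU s : uniq s -> P (\big[setU/set0]_(i <- s) C i) = ((size s)%:R * w)%:E.
  elim: s => [|i s IH] /=; first by rewrite big_nil measure0 mul0r.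
  move=> /andP[is_ us]; rewrite big_cons measureU//.
  - by rewrite [X in (X + _)%E]PC [X in (_ + X)%E](IH us) -EFinD -natr1 mulrDl mul1r addrC.
  - exact: bigsetU_measurable.
  - rewrite -bigcup_seq; apply/seteqP; split=> // x [Cx [j /= js Cjx]].
    by move: is_; rewrite (trivC Cx Cjx) js.
rewrite cardE -lee_fin -PU ?enum_uniq// fineK ?fin_num_measure//.
apply: le_measure; rewrite ?inE//; first exact: bigsetU_measurable.
by rewrite -bigcup_seq => x [i /=]; rewrite mem_enum => /SE; exact.
Qed.

(** The lower count applied to the complements of [E] and of [S]; total mass 1 means that the cells
    miss only a null set. *)
Lemma cells_upper (E : set T) (S : {set I}) : measurable E -> #|I|%:R * w = 1 ->
  (forall i x, C i x -> E x -> i \in S) -> fine (P E) <= #|S|%:R * w.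
Proof.
move=> mE Iw SE.
have SE' i : i \in (~: S)%SET -> C i `<=` ~` E.
  by rewrite finset.in_setC => iS x Cx Ex; rewrite (SE i x Cx Ex) in iS.
have := cells_lower (measurableC mE) SE'.
rewrite probability_setC// fineB ?fin_num_measure// -[fine 1%E]/(1 : R).
have cS : #|S|%:R + #|(~: S)%SET|%:R = #|I|%:R :> R by rewrite -natrD cardsC.
have := Iw; rewrite -cS mulrDl => Iw'; move=> le1; move: (fine (P E)) le1 => pE; lra.
Qed.

End counting_cells.

Section uniform_cells.
Context {R : realType} {m n : nat}.
Notation tup := ((m * n).-tuple (measurableTypeR R)).
Notation idx := ('I_m * 'I_n)%type.

Lemma tuple_mxE (t : tup) i j : tuple_mx t i j = tnth t (mxvec_index i j).
Proof. by rewrite !mxE. Qed.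

Lemma measurable_entry i j : measurable_fun [set: tup] (fun t => tuple_mx t i j).
Proof.
under eq_fun do rewrite tuple_mxE; exact: measurable_tnth.
Qed.

Lemma uniform_prob_itv (a b : R) : 0 <= a -> a <= b -> b <= 1 ->
  uniform_prob (@ltr01 R) `[a, b[%classic = (b - a)%:E.
Proof.
move=> a0 ab b1; rewrite /uniform_prob integral_uniform_pdf setIidl; last first.
  by move=> x /=; rewrite !in_itv/= => /andP[ax /ltW xb]; rewrite (le_trans a0)// (le_trans xb).
rewrite (eq_integral (fun=> 1%E)); last first.
  move=> x; rewrite inE/= in_itv/= => /andP[ax /ltW xb].
  by rewrite /uniform_pdf (le_trans a0 ax) (le_trans xb b1) subr0 invr1.
rewrite integral_cst//= mul1e lebesgue_measure_itv/= lte_fin.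
case: ltP => [_|ba]; first by rewrite EFinB.
by have -> : b = a by [apply/eqP; rewrite eq_le ba ab]; rewrite subrr.
Qed.

Variables (N : nat) (N0 : (0 < N)%N).

(** Half-open, so that the cells are disjoint. *)
Definition grid_cell (a : {ffun idx -> 'I_N}) : set tup :=
  [set t | forall i j, (a (i, j))%:R / N%:R <= tuple_mx t i j < (a (i, j)).+1%:R / N%:R].

Let Nr0 : (0 : R) < N%:R. Proof. by rewrite ltr0n. Qed.

Let entry (k : 'I_(m * n)) : idx := enum_val (cast_ord (esym (mxvec_cast m n)) k).

Let entryK i j : entry (mxvec_index i j) = (i, j).
Proof. by rewrite /entry /mxvec_index cast_ordK enum_rankK. Qed.

Let box (a : {ffun idx -> 'I_N}) k : set (measurableTypeR R) :=
  `[(a (entry k))%:R / N%:R, (a (entry k)).+1%:R / N%:R[%classic.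

Let grid_cell_box a : grid_cell a = [set t | forall k, box a k (tnth t k)].
Proof.
apply/seteqP; split=> t /= at_ => [k|i j].
  case/mxvec_indexP: k => i j; rewrite /box entryK /= in_itv/= -tuple_mxE.
  exact: at_.
by have := at_ (mxvec_index i j); rewrite /box entryK /= in_itv/= -tuple_mxE.
Qed.

Lemma measurable_grid_cell a : measurable (grid_cell a).
Proof.
have -> : grid_cell a = \bigcap_(k : 'I_(m * n)) ((fun t => tnth t k) @^-1` box a k).
  rewrite grid_cell_box; apply/seteqP; split=> t /= h; last by move=> k; exact: h.
  by move=> k _; exact: h.
apply: fin_bigcap_measurable => // k _.
rewrite -[X in measurable X]setTI; apply: measurable_tnth => //.
exact: measurable_itv.
Qed.

Lemma grid_cell_prob a : uniform_cube (m * n) (grid_cell a) = ((N ^ (m * n))%:R^-1)%:E.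
Proof.
rewrite grid_cell_box uniform_cube_box; last by move=> k; exact: measurable_itv.
rewrite (eq_bigr (fun=> (N%:R^-1)%:E)) => [|k _]; last first.
  rewrite /box uniform_prob_itv//; last by rewrite ler_pdivrMr// mul1r ler_nat.
    by rewrite -mulrBl -natrB// subSn// subnn mul1r.
  by rewrite ler_wpM2r ?invr_ge0 ?(ltW Nr0)// ler_nat.
rewrite -(big_morph EFin EFinM erefl) prodr_const card_ord.
by rewrite natrX exprVn.
Qed.

Lemma grid_cell_inj a b t : grid_cell a t -> grid_cell b t -> a = b.
Proof.
move=> at_ bt; apply/ffunP => -[i j]; apply: val_inj => /=.
have := at_ i j; have := bt i j; move: (tuple_mx t i j) => y.
rewrite !ler_pdivrMr// !ltr_pdivlMr// => /andP[b1 b2] /andP[a1 a2].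
have := le_lt_trans a1 b2; have := le_lt_trans b1 a2; rewrite !ltr_nat !ltnS => ba ab.
by apply/eqP; rewrite eqn_leq ab.
Qed.

Lemma grid_cell_near a t : grid_cell a t -> `|tuple_mx t - grid_point a| <= N%:R^-1.
Proof.
move=> at_; apply: mx_norm_le => [|i j]; first by rewrite invr_ge0 ltW.
have -> : (tuple_mx t - grid_point a) i j = tuple_mx t i j - (a (i, j))%:R / N%:R.
  by rewrite [LHS]mxE [X in _ + X]mxE [grid_point a i j]mxE.
have := at_ i j.
move=> /andP[t1 t2]; rewrite ger0_norm ?subr_ge0//.
by rewrite lerBlDl (le_trans (ltW t2))// -natr1 mulrDl mul1r.
Qed.

Lemma grid_cell_cube a t : grid_cell a t -> forall i j, 0 <= tuple_mx t i j <= 1.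
Proof.
move=> at_ i j; have /andP[t1 t2] := at_ i j; apply/andP; split.
  by apply: le_trans t1; rewrite divr_ge0.
by rewrite (le_trans (ltW t2))// ler_pdivrMr// mul1r ler_nat.
Qed.

End uniform_cells.

(** * The event on [Q] as a condition on horospherical lattices *)

Section approximation_event.
Context {R : realType} {m n : nat} (hm : (0 < m)%N) (hn : (0 < n)%N).
Variables (al dl : R) (al0 : 0 < al) (dl0 : 0 < dl).
Hypothesis albe : al ^+ n * (al / dl) ^+ m = 1.
Notation be := (al / dl).

Let be0 : 0 < be. Proof. by rewrite divr_gt0. Qed.

Lemma horo_lattice_points (Y : 'M[R]_(m, n)) w :
  lattice_points (act_lattices (horo albe Y) x0) w <->
  exists q : 'cV[int]_n, exists p : 'cV[int]_m,
    usubmx w = al *: map_mx intr q /\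
    dsubmx w = be *: (Y *m map_mx intr q - map_mx intr p).
Proof.
have mulE (q : 'cV[int]_n) (p : 'cV[int]_m) :
    (horo albe Y : 'M[R]_(n + m)) *m map_mx intr (col_mx q (- p)) =
    col_mx (al *: map_mx intr q) (be *: (Y *m map_mx intr q - map_mx intr p)).
  rewrite horoE map_col_mx mul_block_col mul0mx addr0 !mul_scalar_mx map_mxN.
  by rewrite -scalemxAl -scalerDr.
rewrite lattice_points_act lattice_points_x0.
split=> [[_ [z _ <-] <-]|[q [p [uw dw]]]].
  exists (usubmx z), (- dsubmx z).
  have -> : map_mx intr z = map_mx intr (col_mx (usubmx z) (- - dsubmx z)) :> 'cV[R]_(n + m).
    by rewrite opprK vsubmxK.
  by rewrite mulE col_mxKu col_mxKd.
exists (map_mx intr (col_mx q (- p))); first by exists (col_mx q (- p)).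
by rewrite mulE -uw -dw vsubmxK.
Qed.

Lemma affine_form_entry (Y : 'M[R]_(m, n)) (q : 'cV[int]_n) (p : 'cV[int]_m) i :
  (Y *m map_mx intr q - map_mx intr p) i 0 =
  \sum_j Y i j * (q j 0)%:~R - (p i 0)%:~R :> R.
Proof. by rewrite !mxE; congr (_ - _); apply: eq_bigr => j _; rewrite mxE. Qed.

Lemma Q_vectorsP (Y : 'M[R]_(m, n)) (q : 'cV[int]_n) :
  Q_vectors Y dl q <-> exists w, [/\ lattice_points (act_lattices (horo albe Y) x0) w,
    `|dsubmx w| < `|usubmx w| & usubmx w = al *: map_mx intr q].
Proof.
have E (p : 'cV[int]_m) : (`|be *: (Y *m map_mx intr q - map_mx intr p : 'cV[R]_m)| <
    `|al *: map_mx intr q : 'cV[R]_n|) =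
    (`|Y *m map_mx intr q - map_mx intr p : 'cV[R]_m| < dl * `|map_mx intr q : 'cV[R]_n|).
  rewrite !mx_normZ !gtr0_norm// -mulrA ltr_pM2l// mulrC ltr_pdivrMr//.
  by rewrite [in RHS]mulrC.
split=> [[p Yqp]|[w [xw uv uw]]].
  exists (col_mx (al *: map_mx intr q) (be *: (Y *m map_mx intr q - map_mx intr p))).
  by rewrite col_mxKu col_mxKd E; split=> //; apply/horo_lattice_points; exists q, p; rewrite col_mxKu col_mxKd.
have [q' [p [uw' dw]]] := (horo_lattice_points _ _).1 xw.
have qq' : map_mx intr q = map_mx intr q' :> 'cV[R]_n.
  by apply: (scalerI (lt0r_neq0 al0)); rewrite -uw -uw'.
by exists p; rewrite -E qq' -uw' -dw.
Qed.

Lemma Q_le T (Y : 'M[R]_(m, n)) :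
  al * Q Y dl <= T <-> hit T (act_lattices (horo albe Y) x0).
Proof.
rewrite mulrC -ler_pdivlMr//; set x := act_lattices _ _.
rewrite /Q set_min_le; last 2 first.
- have [w [xw uv]] := cone_point hn (horo albe Y).
  have [q [p [uw _]]] := (horo_lattice_points _ _).1 xw.
  by exists `|map_mx intr q : 'cV[R]_n|; exists q => //; apply/Q_vectorsP; exists w.
- move=> B; apply: (@sub_finite_set _ _
    [set al^-1 * `|usubmx w| | w in [set w | lattice_points x w /\ `|w| <= al * B]]).
    move=> _ [[q /Q_vectorsP[w [xw uv uw]] <-] qB].
    have uE : `|usubmx w| = al * `|map_mx intr q : 'cV[R]_n|.
      by rewrite uw mx_normZ gtr0_norm.
    exists w; last by rewrite uE mulKf ?gt_eqF.
    have uB : `|usubmx w| <= al * B by rewrite uE ler_pM2l.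
    split=> //; apply: vec_norm_le => //; first exact: le_trans uB.
    by rewrite (le_trans (ltW uv)).
  by apply: finite_image; exact: finite_lattice_ball.
split=> [[_ [q /Q_vectorsP[w [xw uv uw]] <-] qT]|[w [xw uv uT]]].
  by exists w; split=> //; rewrite uw mx_normZ gtr0_norm// mulrC -ler_pdivlMr.
have [q [p [uw _]]] := (horo_lattice_points _ _).1 xw.
exists `|map_mx intr q : 'cV[R]_n|; first by exists q => //; apply/Q_vectorsP; exists w.
by rewrite ler_pdivlMr// mulrC; move: uT; rewrite uw mx_normZ gtr0_norm.
Qed.

Definition event T : set ((m * n).-tuple (measurableTypeR R)) :=
  @tuple_mx R m n @^-1` [set Y : 'M[R]_(m, n) | (forall i j, 0 <= Y i j <= 1) /\ al * Q Y dl <= T].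

(** For fixed integer vectors [q] and [p] the inequality is a finite intersection of strips in the
    entries of the matrix, and there are countably many pairs. *)
Lemma measurable_event T : measurable (event T).
Proof.
pose qp (z : 'cV[int]_n * 'cV[int]_m) : set ((m * n).-tuple (measurableTypeR R)) :=
  \bigcap_(i : 'I_m) [set t | `|\sum_j tuple_mx t i j * (z.1 j 0)%:~R - (z.2 i 0)%:~R|
    < dl * `|map_mx intr z.1 : 'cV[R]_n|].
pose good : set ('cV[int]_n * 'cV[int]_m) :=
  [set z | 0 < `|map_mx intr z.1 : 'cV[R]_n| /\ al * `|map_mx intr z.1 : 'cV[R]_n| <= T].
have -> : event T = (\bigcap_(ij : 'I_m * 'I_n)
      ((fun t => tuple_mx t ij.1 ij.2) @^-1` `[0, 1]%classic)) `&` (\bigcup_(z in good) qp z).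
  apply/seteqP; split=> [t [t01 /Q_le[w [xw uv uT]]]|t [t01 [z [z0 zT] tz]]].
    split=> [[i j] _ /=|]; first by rewrite in_itv/=.
    have [q [p [uw dw]]] := (horo_lattice_points _ _).1 xw.
    have qn : `|usubmx w| = al * `|map_mx intr q : 'cV[R]_n| by rewrite uw mx_normZ gtr0_norm.
    exists (q, p).
      split=> /=; last by rewrite -qn.
      have : 0 < `|usubmx w| by exact: le_lt_trans uv.
      by rewrite qn pmulr_rgt0.
    move=> i _ /=; move: uv; rewrite qn dw mx_normZ gtr0_norm// -mulrA ltr_pM2l//.
    rewrite mulrC ltr_pdivrMr// mulrC; apply: le_lt_trans.
    by rewrite -affine_form_entry mx_entry_norm.
  split=> [i j|].
    by have := t01 (i, j) Logic.I; rewrite /= in_itv.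
  apply/Q_le; exists (col_mx (al *: map_mx intr z.1)
    (be *: (tuple_mx t *m map_mx intr z.1 - map_mx intr z.2))).
  rewrite col_mxKu col_mxKd !mx_normZ !gtr0_norm//; split=> //.
    by apply/horo_lattice_points; exists z.1, z.2; rewrite col_mxKu col_mxKd.
  rewrite -mulrA ltr_pM2l// mulrC ltr_pdivrMr// mulrC.
  apply: mx_norm_lt => [|i k]; first by rewrite mulr_gt0.
  by have := tz i Logic.I; rewrite /= (ord1 k) affine_form_entry.
apply: measurableI.
  apply: fin_bigcap_measurable => // ij _.
  rewrite -[X in measurable X]setTI.
  exact: (measurable_entry ij.1 ij.2 measurableT (measurable_itv `[0, 1])).
have -> : \bigcup_(z in good) qp z = \bigcup_z (if `[< good z >] then qp z else set0).
  apply/seteqP; split=> [t [z gz tz]|t [z _]].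
    by exists z => //; rewrite asboolT.
  by case: asboolP => // gz tz; exists z.
apply: countable_bigcupT_measurable; first exact: countableP.
move=> z; case: ifP => // _; apply: fin_bigcap_measurable => // i _.
set c := dl * _.
rewrite (_ : [set _ | _] = (fun t => \sum_j tuple_mx t i j * (z.1 j 0)%:~R - (z.2 i 0)%:~R)
    @^-1` `]- c, c[%classic); last first.
  by apply/seteqP; split=> t /=; rewrite in_itv/= ltr_norml.
rewrite -[X in measurable X]setTI.
suff mf : measurable_fun [set: (m * n).-tuple (measurableTypeR R)]
    (fun t => \sum_j tuple_mx t i j * (z.1 j 0)%:~R - (z.2 i 0)%:~R : measurableTypeR R).
  exact: (mf measurableT _ (measurable_itv _)).
apply: measurable_funB; last exact: measurable_cst.
apply: measurable_sum => j; apply: measurable_funM; last exact: measurable_cst.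
exact: measurable_entry.
Qed.

Lemma horo_modulus f e : ucont f -> 0 < e ->
  eventually_dvd (fun N => forall Y Z : 'M[R]_(m, n), `|Y - Z| <= N%:R^-1 ->
    `|f (act_lattices (horo albe Y) x0) - f (act_lattices (horo albe Z) x0)| <= e).
Proof.
move=> uf /uf[r r0 fr]; exists (Num.bound (be / al / r)).+1 => // N N0 MN Y Z YZ.
have YZr : be / al * `|Y - Z| < r.
  apply: le_lt_trans (_ : be / al * N%:R^-1 < _).
    by rewrite ler_wpM2l// ltW// divr_gt0.
  rewrite ltr_pdivrMr ?ltr0n// -ltr_pdivrMl// [ltLHS]mulrC.
  rewrite (lt_le_trans (archi_boundP _))//.
    by rewrite ltW// !divr_gt0.
  by rewrite ler_nat (leq_trans _ (dvdn_leq N0 MN)).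
have := fr _ (act_lattices (horo albe Z) x0) (horo_div_near al0 be0 albe r0 YZr).
by rewrite -actM -mulSLA mulVSL mulSL1.
Qed.

End approximation_event.

(** * Comparison of the two probabilities *)

Lemma grid_mean_card_ge {R : realType} {m n N : nat} (H : 'M[R]_(m, n) -> R) (e : R)
    (S : {set {ffun 'I_m * 'I_n -> 'I_N}}) : (0 < N)%N ->
  (forall a, H (grid_point a) <= (a \in S)%:R + e) ->
  grid_mean N H <= #|S|%:R * (N ^ (m * n))%:R^-1 + e.
Proof.
move=> N0 HS; have W0 : (0 : R) < (N ^ (m * n))%:R by rewrite ltr0n expn_gt0 N0.
rewrite /grid_mean ler_pdivrMr// mulrDl divfK ?gt_eqF//.
apply: le_trans (ler_sum _ (fun a _ => HS a)) _.
rewrite big_split /= sumr_const card_ffun card_ord card_idx mulr_natr lerD2r.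
by rewrite -sum1_card natr_sum [leRHS]big_mkcond /=; apply: ler_sum => a _; case: ifP.
Qed.

Lemma grid_mean_card_le {R : realType} {m n N : nat} (H : 'M[R]_(m, n) -> R) (e : R)
    (S : {set {ffun 'I_m * 'I_n -> 'I_N}}) : (0 < N)%N ->
  (forall a, (a \in S)%:R <= H (grid_point a) + e) ->
  #|S|%:R * (N ^ (m * n))%:R^-1 <= grid_mean N H + e.
Proof.
move=> N0 HS; have W0 : (0 : R) < (N ^ (m * n))%:R by rewrite ltr0n expn_gt0 N0.
rewrite /grid_mean ler_pdivrMr// mulrDl divfK ?gt_eqF//.
apply: le_trans (_ : \sum_(a : {ffun 'I_m * 'I_n -> 'I_N}) (H (grid_point a) + e) <= _).
  rewrite -sum1_card natr_sum [leLHS]big_mkcond /=; apply: ler_sum => a _.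
  by apply: le_trans (HS a); case: ifP.
by rewrite big_split /= sumr_const card_ffun card_ord card_idx mulr_natr.
Qed.

(** Cells contained in the event number at least the inner grid mean, up to [e / 4], and cells
    meeting it at most the outer one; equidistribution costs another [e / 4] on each side. Both
    probabilities thus lie within [e / 2] of an interval of length [e / 4], which contains that of
    [hit T]. *)
Lemma event_approximation {R : realType} {m n : nat} (hm : (0 < m)%N) (hn : (0 < n)%N)
    (mu : probability (borel_lattices R (n + m)) R) (hmu : SL_invariant mu)
    (T e : R) : 0 < T -> 0 < e ->
  exists2 d0, 0 < d0 & forall al dl : R, 0 < al -> 0 < dl -> dl < d0 ->
    al ^+ n * (al / dl) ^+ m = 1 ->
    `|fine (mu [set x : borel_lattices R (n + m) | hit T x]) -
      fine (uniform_cube (m * n) (event (m := m) (n := n) al dl T))| <= e.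
Proof.
move=> T0 e0; have e40 : 0 < e / 4 by rewrite divr_gt0.
have nm0 : (0 < n + m)%N by rewrite addn_gt0 hn.
have [c c0 cP] := hit_mean_approx hm hn T0 hmu e40.
have ti := clamp_margin_test_function (m := m) (n := n) T0 (lexx 0) c0.
have to := clamp_margin_test_function (m := m) (n := n) T0 ler01 c0.
pose inn := inner_hit T c : lattices R (n + m) -> R.
pose out := outer_hit T c : lattices R (n + m) -> R.
have bi : bounded_ucont inn := bounded_ucont_lattice_sup nm0 ti.
have bo : bounded_ucont out := bounded_ucont_lattice_sup nm0 to.
have i0 x : 0 <= inn x := lattice_sup_ge0 nm0 ti x.
have i1 x : inn x <= 1 := lattice_sup_le1 nm0 ti x.
have o0 x : 0 <= out x := lattice_sup_ge0 nm0 to x.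
have o1 x : out x <= 1 := lattice_sup_le1 nm0 to x.
have mH := measurable_hit hn T0.
have mu_lo : mean mu inn <= fine (mu [set x : borel_lattices R (n + m) | hit T x]).
  apply: le_mean_indic => // x; rewrite indicE.
  have [hx|nhx] := pselect (hit T x); first by rewrite mem_set.
  by rewrite memNset// leNgt; apply/negP => /(inner_hitP hn c0).
have mu_hi : fine (mu [set x : borel_lattices R (n + m) | hit T x]) <= mean mu out.
  apply: ge_mean_indic => // x; rewrite indicE.
  have [hx|nhx] := pselect (hit T x); last by rewrite memNset.
  by rewrite mem_set//; exact: outer_hitP.
have [d1 d10 H1] := horo_equidistribution hmu hm hn bi i0 i1 e40.
have [d2 d20 H2] := horo_equidistribution hmu hm hn bo o0 o1 e40.
exists (Num.min (Num.min d1 d2) 1); first by rewrite !lt_min d10 d20 ltr01.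
move=> al dl al0 dl0; rewrite !lt_min => /andP[/andP[/ltW dl1 /ltW dl2] /ltW dlt1] albe.
have ab : al <= al / dl by rewrite ler_pdivlMr// ler_piMr// ltW.
(* The contraction ratio of the flow is delta itself, so the thresholds of equidistribution are
   thresholds for delta. *)
have abd : al / (al / dl) = dl by rewrite invf_div mulrC divfK ?gt_eqF.
have := eventually_dvdI (eventually_dvdI (H1 _ _ albe al0 ab _) (H2 _ _ albe al0 ab _))
  (eventually_dvdI (horo_modulus al0 dl0 albe bi.1 e40) (horo_modulus al0 dl0 albe bo.1 e40)).
rewrite abd => /(_ dl1 dl2)[N N0 /(_ N N0 (dvdnn N))[[E1 E2] [M1 M2]]].
pose E : set ((m * n).-tuple (measurableTypeR R)) := event al dl T.
have mE : measurable E by exact: measurable_event.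
have W0 : (0 : R) < (N ^ (m * n))%:R by rewrite ltr0n expn_gt0 N0.
have eventP (t : (m * n).-tuple (measurableTypeR R)) : E t <->
    (forall i j, 0 <= tuple_mx t i j <= 1) /\ hit T (act_lattices (horo albe (tuple_mx t)) x0).
  by split=> -[t01 /(Q_le hn al0 dl0 albe)].
have near a t : grid_cell (R := R) (m := m) (n := n) (N := N) a t ->
    `|tuple_mx t - grid_point a| <= N%:R^-1 by exact: grid_cell_near.
have lo : mean mu inn <= fine (uniform_cube (m * n) E) + e / 2.
  pose S := finset (fun a : {ffun 'I_m * 'I_n -> 'I_N} =>
    `[< grid_cell (R := R) a `<=` E >]).
  have L1 : #|S|%:R * (N ^ (m * n))%:R^-1 <= fine (uniform_cube (R := R) (m * n) E).
    apply: (cells_lower (@measurable_grid_cell R m n N) (grid_cell_prob N0) (grid_cell_inj N0) mE) => a.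
    by rewrite inE => /asboolP.
  have L2 : horo_mean albe N inn x0 <= #|S|%:R / (N ^ (m * n))%:R + e / 4.
    apply: grid_mean_card_ge => // a; rewrite inE.
    have [_|nS] := asboolP; first by rewrite (le_trans (i1 _))// lerDl ltW.
    (* A value above [e / 4] at the corner stays positive on the whole cell, and a positive inner
       function means a hit. *)
    rewrite add0r leNgt; apply/negP => ia; apply: nS => t ta; apply/eventP; split.
      exact: grid_cell_cube ta.
    apply: (inner_hitP hn c0); have := M1 _ _ (near _ _ ta).
    rewrite ler_norml => /andP[h _]; rewrite -/inn; move: h ia; rewrite -/inn; lra.
  move: L1 L2 E1; rewrite ler_norml => L1 L2 /andP[h _]; lra.
have hi : fine (uniform_cube (m * n) E) <= mean mu out + e / 2.
  pose S := finset (fun a : {ffun 'I_m * 'I_n -> 'I_N} =>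
    `[< exists2 t, grid_cell (R := R) a t & E t >]).
  have L1 : fine (uniform_cube (R := R) (m * n) E) <= #|S|%:R * (N ^ (m * n))%:R^-1.
    apply: (cells_upper (@measurable_grid_cell R m n N) (grid_cell_prob N0) (grid_cell_inj N0) mE).
      by rewrite card_ffun card_ord card_idx mulfV// gt_eqF.
    by move=> a t ta Et; rewrite inE; apply/asboolP; exists t.
  have L2 : #|S|%:R / (N ^ (m * n))%:R <= horo_mean albe N out x0 + e / 4.
    apply: grid_mean_card_le => // a; rewrite inE.
    have [[t ta /eventP[_ ht]]|_] := asboolP; last by rewrite addr_ge0// ltW.
    have := outer_hitP T0 c0 ht; have := M2 _ _ (near _ _ ta).
    rewrite ler_norml -/(out _) => /andP[_ h] o.
    by rewrite -[true%:R]/(1 : R) (le_trans o)// -lerBlDl.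
  apply: (le_trans L1); apply: (le_trans L2).
  by move: E2; rewrite ler_norml => /andP[_]; lra.
move: cP; rewrite -/inn -/out => cP.
by rewrite ler_norml; apply/andP; split; lra.
Qed.

Lemma dilation_unimodular {R : realType} (m n : nat) (dl : R) : (0 < n)%N -> 0 < dl ->
  let al := dl `^ (m%:R / (m + n)%:R) in al ^+ n * (al / dl) ^+ m = 1.
Proof.
move=> n0 dl0 al; have k0 : (m + n)%:R != 0 :> R by rewrite pnatr_eq0 -lt0n addn_gt0 n0 orbT.
have e : al ^+ (m + n) = dl ^+ m.
  by rewrite -powR_mulrn ?powR_ge0// -powRrM divfK// powR_mulrn// ltW.
by rewrite expr_div_n mulrA -exprD addnC e divff// expf_neq0// gt_eqF.
Qed.

Theorem theorem5p6 (R : realType) (m n : nat) (hm : (0 < m)%N) (hn : (0 < n)%N)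
    (mu : probability (borel_lattices R (n + m)) R) (hmu : SL_invariant mu)
    (T : R) (hT : 0 < T) :
  uniform_mx [set X : 'M[R]_(m, n) | (forall i j, 0 <= X i j <= 1) /\
      delta `^ (m%:R / (m + n)%:R) * Q X delta <= T] @[delta --> 0^'+]
    --> mu [set L : borel_lattices R (n + m) | F1 L <= T].
Proof.
pose al dl : R := dl `^ (m%:R / (m + n)%:R).
have al0 dl : 0 < dl -> 0 < al dl by exact: powR_gt0.
have albe dl (dl0 : 0 < dl) : al dl ^+ n * (al dl / dl) ^+ m = 1.
  exact: dilation_unimodular.
have -> : [set L : borel_lattices R (n + m) | F1 L <= T] = [set L | hit T L].
  by apply/seteqP; split=> L /=; move=> /F1_le; apply.
have fin_mu : mu [set x | hit T x] \is a fin_num.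
  by apply: fin_num_measure; exact: measurable_hit.
rewrite -(fineK fin_mu); apply/fine_cvgP; split.
  near=> dl; have dl0 : 0 < dl by near: dl; exact: nbhs_right_gt.
  apply: (@fin_num_measure _ _ _ (uniform_cube (m * n))).
  exact: (measurable_event hn (al0 _ dl0) dl0 (albe _ dl0) T).
apply/cvgrPdist_le => e e0.
have [d0 d00 H] := event_approximation hm hn hmu hT e0.
near=> dl; have dl0 : 0 < dl by near: dl; exact: nbhs_right_gt.
apply: (H _ _ (al0 _ dl0) dl0 _ (albe _ dl0)).
by near: dl; exact: nbhs_right_lt.
Unshelve. all: by end_near. Qed.
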